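(* Let $G$ be a discrete Cayley graph, $\mathcal P$ a spin model on its vertex set $V$ and $\xi$ a score function such that one of the following two conditions holds: 1. $G$ is $b$-amenable; $\mathcal P$ is a clustering spin model whose clustering function $\phi$ is summable in $G$; and $\xi$ is a local score function. 2. $G$ has polynomial growth; $\mathcal P$ is an exponentially clustering spin model; $\xi$ is an exponentially quasi-local score function on $\mathcal P$ satisfying the exponential growth condition, and $(\xi,\mathcal P)$ satisfies the $p$-moment condition for all $p\ge1$. Let $H_n^\xi=\sum_{x\in\mathcal P_n}\xi(x,\mathcal P_n)$. If for some $\nu>0$ it holds that $\operatorname{Var}(H_n^\xi)=\Omega(w_n^\nu)$, then as $n\to\infty$, $$\frac{H_n^\xi-\mathbb E(H_n^\xi)}{\sqrt{\operatorname{Var}(H_n^\xi)}}\stackrel{d}{\Rightarrow}N(0,1).$$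
   Context: **Cayley graphs.** $(V,+)$ is a countably infinite group (not necessarily commutative) with identity $O$, generated by a finite symmetric set $S$ ($h\in S\iff -h\in S$) with $O\notin S$. The discrete Cayley graph $G=(V,E)$ has $(g_1,g_2)\in E$ iff $-g_1+g_2\in S$. $d$ is the graph distance, $|x|=d(O,x)$, so $d(x,y)=|-x+y|$; $d(A,B)=\min_{x\in A,y\in B}d(x,y)$. $W_r(x)=\{y:d(x,y)\le r\}$, $W_r=W_r(O)$, $W_\infty=V$, $w_n=|W_n|$. $\partial A=\{x\in A:\exists y\notin A,\ (x,y)\in E\}$. $G$ is $b$-amenable if $|\partial W_n|/|W_n|\to0$ as $n\to\infty$; $G$ has polynomial growth if $|W_n|=O(n^{d_2})$ for some $d_2>0$. $a_n=\Omega(b_n)$ means there is $c>0$ with $a_n\ge c\,b_n$ for all large $n$. **Spin models.** $\mathcal N=\{0,1\}^V$; $\mu\in\mathcal N$ is identified with the subset $\{x:\mu_x=1\}$ of $V$. A spin model is an $\mathcal N$-valued random variable $\mathcal P$; $\mathcal P_n=\mathcal P\cap W_n$, $\mathcal P_\infty=\mathcal P$. $\mathcal P$ is stationary if $y+\mathcal P\stackrel d=\mathcal P$ for all $y\in V$, non-degenerate if $\mathbb P(O\in\mathcal P)\in(0,1)$. A function $\phi:[0,\infty)\to[0,\infty)$ is fast decreasing if $\phi\le1$, $\phi$ is decreasing and $\lim_{s\to\infty}s^m\phi(s)=0$ for all $m\ge1$. A stationary non-degenerate $\mathcal P$ is a clustering spin model if there are constants $C_k,c_k\in(0,\infty)$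 ($C_k$ non-decreasing, $c_k$ non-increasing in $k$) and a fast decreasing $\phi$ (the clustering function) such that for all $p,q\ge1$ and distinct $x_1,\dots,x_{p+q}\in V$, $$|\mathbb P(\{x_1,\dots,x_{p+q}\}\subset\mathcal P)-\mathbb P(\{x_1,\dots,x_p\}\subset\mathcal P)\mathbb P(\{x_{p+1},\dots,x_{p+q}\}\subset\mathcal P)|\le C_{p+q}\phi(c_{p+q}s),$$ $s=d(\{x_1,\dots,x_p\},\{x_{p+1},\dots,x_{p+q}\})$. It is exponentially clustering if moreover $c_k\ge c>0$ for all $k$, $C_k=O(k^{ak})$ for some $a\in[0,1)$ and $\limsup_{t\to\infty}\log\phi(t)/t^b<0$ for some $b\in(0,\infty)$. A fast decreasing $\phi$ is summable in $G$ if $\sum_{x\in V}\phi^{1/p}(c|x|)<\infty$ for all $c>0$, $p\ge1$. **Score functions.** A score function is a measurable $\xi:V\times\mathcal N\to\mathbb R$ that is translation-invariant, $\xi(y+x,y+\mu)=\xi(x,\mu)$, with the convention $\xi(x,\mu)=0$ if $x\notin\mu$. It is local if there is $r>0$ such that $\xi(O,\mu)$ depends only on $\mu\cap W_r$ for every $\mu$. The radius of stabilisation is $R(O,\mu)=\inf\{r>0,\ r\in\mathbb N:\xi(O,\mu)=\xi(O,\mu')\ \forall\mu'\in\mathcal N\text{ with }\mu'\cap W_r=\mu\cap W_r\}$ and $R(x,\mu)=R(O,-x+\mu)$. $\xi$ is exponentially quasi-local on $\mathcal P$ if there are $A>0$ and a function $\varphi(t)\downarrow0$ with $\sup_{1\le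 n\le\infty}\sup_{x\in W_n}\mathbb P(R(x,\mathcal P_n)\ge t)\le A\varphi(t)$ for all $t$ and $\limsup_{t\to\infty}\log\varphi(t)/t^c<0$ for some $c\in(0,\infty)$. Exponential growth condition: for some $\kappa\in[0,\infty)$ and constant $c_*<\infty$, $|\xi(O,\mu\cap W_t)|\le e^{c_*t^\kappa}$ for all $t>0$, $\mu\in\mathcal N$. $p$-moment condition: $\sup_{1\le n\le\infty}\sup_{x\in W_n}\mathbb E(\max\{|\xi(x,\mathcal P_n)|,1\}^p)<\infty$. *)

(* Defs.v *)
(* The (possibly non-commutative) group (V, +) is a groupType, written
   multiplicatively: O is 1%g, -x is (x^-1)%g and y + x is (y * x)%g. *)
From HB Require Import structures.
From mathcomp Require Import all_boot all_order all_algebra finmap.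
From mathcomp Require Import all_classical all_reals all_analysis.

Set Implicit Arguments.
Unset Strict Implicit.
Unset Printing Implicit Defensive.

Import Order.TTheory GRing.Theory Num.Theory.
Import numFieldNormedType.Exports.

Local Open Scope classical_set_scope.
Local Open Scope ring_scope.

(* 0 if A is empty *)
Definition least (A : set nat) : nat :=
  xget 0%N [set k | A k /\ forall j, A j -> (k <= j)%N].

(* meaningful for finite A only (0 otherwise) *)
Definition fin_card (V : choiceType) (A : set V) : nat := #|` fset_set A|%fset.

Section CayleyGraph.
Variables (V : groupType) (S : set V).

Definition is_subgroup (H : set V) : Prop :=
  [/\ H 1%g,
      forall x y, H x -> H y -> H (x * y)%g
    & forall x, H x -> H (x^-1)%g].

Record cayley_generators : Prop := {
  gen_finite : finite_set S;
  gen_symmetric : forall h, S h <-> S (h^-1)%g;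
  gen_one : ~ S 1%g;
  gen_generates : smallest is_subgroup S = setT }.

Definition cayley_edge : rel V := fun g1 g2 => (g1^-1 * g2)%g \in S.

Definition word_dist (x y : V) : nat :=
  least [set k | exists p : seq V,
    [/\ path cayley_edge x p, last x p = y & size p = k]].

Definition set_dist (A B : set V) : nat :=
  least [set word_dist x y | x in A & y in B].

Definition wball (n : nat) : set V := [set y | (word_dist 1%g y <= n)%N].

Definition wcard (n : nat) : nat := fin_card (wball n).

Definition boundary (A : set V) : set V :=
  [set x | A x /\ exists y, ~ A y /\ cayley_edge x y].

(* The windows W_n, 1 <= n <= oo, with W_oo = V. *)
Definition windows : set (set V) :=
  [set wball n | n in [set n | (1 <= n)%N]] `|` [set setT].

(* sup_{1 <= n <= oo} sup_{x in W_n} f W_n x *)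
Definition window_sup (R : realType) (f : set V -> V -> \bar R) : \bar R :=
  ereal_sup [set f z.1 z.2 | z in [set z | windows z.1 /\ z.1 z.2]].

Definition b_amenable (R : realType) : Prop :=
  (fin_card (boundary (wball n)))%:R / (wcard n)%:R @[n --> \oo] --> (0 : R).

Definition polynomial_growth (R : realType) : Prop :=
  exists2 d2 : R, 0 < d2 &
    (fun n => (wcard n)%:R : R^o) =O_\oo (fun n => n%:R `^ d2 : R^o).

End CayleyGraph.

(* y + mu *)
Definition translate (V : groupType) (y : V) (mu : set V) : set V :=
  [set (y * x)%g | x in mu].

Definition cylinders (V : Type) : set (set (set V)) :=
  [set [set mu : set V | mu x] | x in setT].

(* {0,1}^V, each element being identified with a subset of V, with the product
   sigma-algebra *)
Definition configuration (V : Type) := g_sigma_algebraType (@cylinders V).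

(* V with the sigma-algebra of all its subsets *)
Definition discrete_group (V : groupType) : Type := V.

HB.instance Definition _ (V : groupType) := Choice.on (discrete_group V).
HB.instance Definition _ (V : groupType) :=
  isPointed.Build (discrete_group V) 1%g.
HB.instance Definition _ (V : groupType) :=
  @isMeasurable.Build default_measure_display (discrete_group V)
    (@discrete_measurable V) (@discrete_measurable0 V)
    (@discrete_measurableC V) (@discrete_measurableU V).

Section FastDecreasing.
Variable R : realType.

(* Functions on [0, oo) are represented by total functions on R, whose values
   on negative numbers are irrelevant. *)
Definition fast_decreasing (phi : R -> R) : Prop :=
  [/\ forall s : R, 0 <= s -> 0 <= phi s <= 1,
      forall s t : R, 0 <= s -> s <= t -> phi t <= phi s
    & forall m, (1 <= m)%N -> s ^+ m * phi s @[s --> +oo] --> (0 : R)].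

Definition summable_in (V : groupType) (S : set V) (phi : R -> R) : Prop :=
  forall c p : R, 0 < c -> 1 <= p ->
    (\esum_(x in [set: V])
       (phi (c * (word_dist S 1%g x)%:R) `^ p^-1)%:E < +oo)%E.

(* limsup_{t -> oo} log (f t) / t ^ b < 0; with lne, log 0 is -oo, whereas
   ln 0 would be 0 *)
Definition stretched_exp_decay (f : R -> R) (b : R) : Prop :=
  (limf_esup (fun t : R => lne (f t)%:E * ((t `^ b)^-1)%:E) +oo%R < 0)%E.

End FastDecreasing.

Section SpinModel.
Context d (T : measurableType d) (R : realType) (P : probability T R).
Context (V : groupType) (S : set V).
Variable X : {RV P >-> configuration V}.

Definition stationary : Prop :=
  forall (y : V) (A : set (configuration V)), measurable A ->
    P [set u | A (translate y (X u))] = distribution P X A.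

Definition non_degenerate : Prop :=
  (0 < P [set u | X u 1%g] /\ P [set u | X u 1%g] < 1)%E.

Definition prob_contains (A : set V) : \bar R := P [set u | A `<=` X u].

Definition clustering_bound (phi : R -> R) (C c : nat -> R) : Prop :=
  [/\ forall k, 0 < C k, forall k, 0 < c k,
      nondecreasing_seq C, nonincreasing_seq c
    & forall (p q : nat) (x : p.-tuple V) (y : q.-tuple V),
        (1 <= p)%N -> (1 <= q)%N -> uniq (x ++ y) ->
        (`| prob_contains [set` x ++ y]
            - prob_contains [set` x] * prob_contains [set` y] |
         <= (C (p + q)%N
             * phi (c (p + q)%N * (set_dist S [set` x] [set` y])%:R))%:E)%E].

(* X is a clustering spin model with clustering function phi *)
Definition clustering (phi : R -> R) : Prop :=
  [/\ stationary, non_degenerate, fast_decreasing phi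
    & exists C c : nat -> R, clustering_bound phi C c].

Definition exponentially_clustering : Prop :=
  [/\ stationary, non_degenerate
    & exists phi : R -> R, exists C c : nat -> R,
      [/\ fast_decreasing phi, clustering_bound phi C c,
          exists2 c0 : R, 0 < c0 & forall k, c0 <= c k,
          exists a : R, [/\ 0 <= a, a < 1 &
            (C : nat -> R^o) =O_\oo (fun k => k%:R `^ (a * k%:R) : R^o)]
        & exists2 b : R, 0 < b & stretched_exp_decay phi b]].

End SpinModel.

Section ScoreFunction.
Context (R : realType) (V : groupType) (S : set V).
Variable xi : V -> configuration V -> R.

Record score_function : Prop := {
  score_measurable : measurable_fun setT
    (fun z : discrete_group V * configuration V => xi z.1 z.2);
  score_invariant : forall (x y : V) (mu : set V),
    xi (y * x)%g (translate y mu) = xi x mu;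
  score_out : forall (x : V) (mu : set V), ~ mu x -> xi x mu = 0 }.

Definition local_score : Prop :=
  exists2 r : nat, (0 < r)%N & forall mu mu' : set V,
    mu `&` wball S r = mu' `&` wball S r -> xi 1%g mu = xi 1%g mu'.

(* R(O, mu), equal to +oo if no radius stabilises *)
Definition stab_radius_at_one (mu : set V) : \bar R :=
  ereal_inf [set (r%:R)%:E | r in [set r : nat | (0 < r)%N /\
    forall mu' : set V, mu' `&` wball S r = mu `&` wball S r ->
      xi 1%g mu = xi 1%g mu']].

Definition stab_radius (x : V) (mu : set V) : \bar R :=
  stab_radius_at_one (translate (x^-1)%g mu).

Definition exponential_growth : Prop :=
  exists kappa c : R, 0 <= kappa /\
    forall (t : R) (mu : set V), 0 < t ->
      `| xi 1%g (mu `&` [set y | (word_dist S 1%g y)%:R <= t]) |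
        <= expR (c * t `^ kappa).

Context d (T : measurableType d) (P : probability T R).
Variable X : {RV P >-> configuration V}.

Definition exponentially_quasi_local : Prop :=
  exists (A : R) (f : R -> R),
    [/\ 0 < A,
        forall s t : R, 0 <= s -> s <= t -> f t <= f s,
        f t @[t --> +oo] --> (0 : R),
        forall t : R, 0 <= t ->
          (window_sup S (fun Wn x =>
             P [set u | t%:E <= stab_radius x (X u `&` Wn)]) <= (A * f t)%:E)%E
      & exists2 c : R, 0 < c & stretched_exp_decay f c].

Definition moment_condition (p : R) : Prop :=
  (window_sup S (fun Wn x =>
     'E_P[fun u => (Num.max `| xi x (X u `&` Wn) | 1 `^ p)%R]) < +oo)%E.

(* H_n; the sum ranges over a finite set *)
Definition total_score (n : nat) (u : T) : R :=
  \sum_(x \in X u `&` wball S n) xi x (X u `&` wball S n).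

End ScoreFunction.

(* Convergence in distribution of real random variables to the law m:
   convergence of distribution functions at each continuity point of the
   distribution function of m. *)
Definition cvg_in_distribution d (T : measurableType d) (R : realType)
    (P : probability T R) (Y : nat -> T -> R)
    (m : probability (measurableTypeR R) R) : Prop :=
  forall x : R, {for x, continuous (fun t : R => m `]-oo, t]%classic)} ->
    P [set u | Y n u <= x] @[n --> \oo] --> m `]-oo, x]%classic.

(* Main.v *)
(* The cumulant method. By Janson's refinement of a theorem of Marcinkiewicz, a
   sequence of centred variables of variance 1 whose cumulants of every
   sufficiently large order tend to 0 has all its cumulants of order >= 3 tending
   to 0; its moments then converge to those of the normal law, which is determined
   by its moments. So it suffices that each cumulant of H_n is O(w_n): divided by
   Var(H_n)^(k/2) >= c w_n^(k nu / 2), it vanishes for k > 2 / nu.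

   The k-th cumulant of H_n is a sum of joint cumulants (Ursell functions) of the
   centred scores. A joint cumulant is small when the k points split into two
   groups at distance s: up to a stabilisation error, the mixed moments of the two
   groups are expectations of functions of the spins near the points, and expanding
   these functions in indicators of {A is a subset of P} bounds their covariance by
   clustering. If the decay in s is summable over V, summing over all points but
   one leaves O(w_n). For quasi-local scores one truncates at a stabilisation
   radius t with t^q ~ s; for q large the decay of phi at t^q beats the factor
   3^|W_t| of the expansion, the constants C_k with k of order |W_t|, and the growth
   of the scores. *)
Require Import Defs.
From HB Require Import structures.
From mathcomp Require Import all_boot all_order all_algebra finmap.
From mathcomp Require Import all_classical all_reals all_analysis.
From mathcomp Require Import measurable_realfun ring lra zify.

Set Implicit Arguments.
Unset Strict Implicit.
Unset Printing Implicit Defensive.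

Import Order.TTheory GRing.Theory Num.Theory.
Import numFieldNormedType.Exports.

Local Open Scope classical_set_scope.
Local Open Scope ring_scope.

(** * The theorem of Marcinkiewicz and convergence of cumulants *)

(** Each sum is a function of the spins in a finite ball, hence bounded, so all its moments exist.
    The source of the theorem of Marcinkiewicz is |E exp(zY)|^2 <= E exp(2 Re(z) Y): with finitely
    many nonzero cumulants both sides are exponentials of polynomials in |z|, and two choices of the
    direction of z bound the top cumulant by 0 from below and from above. In the step of Janson the
    cumulants of order between 3 and s are not known to be bounded in n, so compactness cannot be
    applied to them directly; multiplying the variable by a factor at most 1 bounds them, keeps one
    of them away from 0 and keeps the second at most 1. The limit exists only as a sequence of
    moments, so positivity is recorded as a closed inequality between moments rather than through a
    limiting law. The Ursell functions come from a recursion on the block containing a base point,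
    which replaces sums over set partitions by sums over splits of a list in two. *)

Lemma mean_value_eq (R : realType) (f df : R -> R) (a b : R) :
  a <= b -> (forall x : R, is_derive x 1 f (df x)) ->
  exists2 c, a <= c <= b & f b - f a = df c * (b - a).
Proof.
move=> ab fdf.
have cf : {within `[a, b], continuous f}.
  apply: continuous_subspaceT => x.
  by apply: differentiable_continuous; apply/derivable1_diffP; case: (fdf x).
have [c + ->] := MVT_segment ab (fun x _ => fdf x) cf.
by rewrite in_itv /= => cab; exists c.
Qed.

Lemma horner_le_coef (R : realType) (p q : {poly R}) (r : R) :
  (forall i, `|p`_i| <= q`_i) -> 0 <= r <= 1 -> `|p.[r]| <= q.[1].
Proof.
move=> pq /andP[r0 r1].
pose n := maxn (size p) (size q).
rewrite (@horner_coef_wide _ n p) ?leq_maxl// (@horner_coef_wide _ n q) ?leq_maxr//.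
rewrite (le_trans (ler_norm_sum _ _ _))//; apply: ler_sum => i _.
rewrite normrM expr1n mulr1 (le_trans _ (pq i))// normrX (ger0_norm r0).
by rewrite ler_piMr// exprn_ile1.
Qed.

Lemma horner_ge0_coef (R : realType) (p : {poly R}) (r : R) :
  (forall i, 0 <= p`_i) -> 0 <= r -> 0 <= p.[r].
Proof.
move=> p0 r0; rewrite horner_coef sumr_ge0// => i _.
by rewrite mulr_ge0// exprn_ge0.
Qed.

Definition poly_primitive (R : realType) (p : nat) (G : nat -> R) : {poly R} :=
  \poly_(j < p.+1) (if j is i.+1 then G i / i.+1%:R else 0).

Lemma deriv_primitive (R : realType) (p : nat) (G : nat -> R) :
  (poly_primitive p G)^`() = \poly_(j < p) G j.
Proof.
apply/polyP => i; rewrite coef_deriv !coef_poly ltnS; case: ifP => _; last by rewrite mul0rn.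
by rewrite -[LHS]mulr_natr mulfVK// pnatr_eq0.
Qed.

Lemma primitive_at0 (R : realType) (p : nat) (G : nat -> R) :
  (poly_primitive p G).[0] = 0.
Proof. by rewrite horner_coef0 coef_poly. Qed.

Lemma primitive_at1 (R : realType) (p : nat) (G : nat -> R) :
  (poly_primitive p G).[1] = \sum_(j < p) G j / j.+1%:R.
Proof.
rewrite horner_poly big_ord_recl /= mul0r add0r; apply: eq_bigr => i _.
by rewrite expr1n mulr1.
Qed.

(** The integrating factor: where p' + q' p has a sign, p exp(q) is monotone, which turns
    coefficient recursions into growth bounds. *)
Lemma is_derive_weighted (R : realType) (p q : {poly R}) (x : R) :
  is_derive x 1 (fun r => p.[r] * expR (q.[r]))
    ((p^`().[x] + q^`().[x] * p.[x]) * expR (q.[x])).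
Proof.
have h1 : is_derive x 1 (horner p * (expR \o horner q))
   (p.[x] *: (expR q.[x] * q^`().[x]) + expR q.[x] *: p^`().[x]).
  exact: is_deriveM.
apply: (@is_derive_eq _ _ _ _ _ _ _ _ h1).
by rewrite /GRing.scale /=; ring.
Qed.

(** A Gronwall bound. By the recursion the truncated generating function [S] satisfies S' <= Gq S
    coefficientwise, so S exp(-K) does not increase on [0, 1], where [K] is the primitive of
    [Gq]. *)
Lemma poly_bound_ind_sum (R : realType) (p : nat) (G s : nat -> R) (N : nat) :
  (forall j, 0 <= G j) -> (forall j, (p <= j)%N -> G j = 0) ->
  (forall l, 0 <= s l) ->
  (forall l, l.+1%:R * s l.+1 <= \sum_(j < l.+1) G j * s (l - j)%N) ->
  \sum_(l < N) s l <= s 0%N * expR (\sum_(j < p) G j / j.+1%:R).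
Proof.
move=> G0 Gp s0 sS.
pose S := \poly_(l < N) s l; pose Gq := \poly_(j < p) G j; pose K := poly_primitive p G.
have GqE j : Gq`_j = G j.
  by rewrite coef_poly; case: ltnP => // /Gp ->.
have le0 r : 0 <= r -> S^`().[r] - Gq.[r] * S.[r] <= 0.
  move=> r0; rewrite subr_le0 -subr_ge0 -hornerM -hornerN -hornerD.
  apply: horner_ge0_coef => // i; rewrite coefB subr_ge0 coefM coef_deriv coef_poly.
  case: ifP => iN.
    rewrite -mulr_natl (le_trans (sS i))//; apply: ler_sum => j _.
    by rewrite GqE coef_poly ifT// (leq_ltn_trans _ (ltnW iN))// leq_subr.
  rewrite mul0rn; apply: sumr_ge0 => j _.
  by rewrite GqE coef_poly mulr_ge0//; case: ifP.
have [c /andP[c0 c1] /eqP] := @mean_value_eq R _ _ 0 1 ler01 (is_derive_weighted S (- K)).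
rewrite derivN !hornerN deriv_primitive -/Gq mulNr subr0 mulr1 subr_eq => /eqP.
rewrite primitive_at0 primitive_at1 oppr0 expR0 mulr1 => h.
have S1 : S.[1] = \sum_(l < N) s l.
  by rewrite horner_poly; apply: eq_bigr => i _; rewrite expr1n mulr1.
have S0 : S.[0] <= s 0%N by rewrite horner_coef0 coef_poly; case: ifP.
have : S.[1] * expR (- (\sum_(j < p) G j / j.+1%:R)) <= s 0%N.
  rewrite h (le_trans _ S0)// gerDr; rewrite mulr_le0_ge0// ?expR_ge0//.
  exact: le0.
by rewrite S1 expRN ler_pdivrMr ?expR_gt0.
Qed.

(** The recursion is the real part of a linear differential equation for c + i d. Cutting at degree
    N spoils it only in the coefficients from N - 1 on, and these involve only terms c_l, d_l with l
    >= N - p. *)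
Lemma poly_trunc_error (R : realType) (p N : nat) (A B G s c d : nat -> R) (r : R) :
  (forall j, G j = `|A j| + `|B j|) -> (forall l, s l = `|c l| + `|d l|) ->
  (forall j, (p <= j)%N -> G j = 0) ->
  (forall l, l.+1%:R * c l.+1 = \sum_(j < l.+1) (A j * c (l - j)%N - B j * d (l - j)%N)) ->
  0 <= r <= 1 ->
  `| (\poly_(l < N) c l)^`().[r] - ((\poly_(j < p) A j).[r] * (\poly_(l < N) c l).[r]
     - (\poly_(j < p) B j).[r] * (\poly_(l < N) d l).[r]) |
  <= (\sum_(j < p) G j) * \sum_(l < N | (N <= l + p)%N) s l.
Proof.
move=> GE sE Gp cS r01.
set C := \poly_(l < N) c l; set D := \poly_(l < N) d l.
set Ap := \poly_(j < p) A j; set Bp := \poly_(j < p) B j.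
pose T := \poly_(l < N) (if (N <= l + p)%N then s l else 0).
pose Gq := \poly_(j < p) G j.
have A0 j : (p <= j)%N -> A j = 0.
  by move=> /Gp; rewrite GE => /eqP; rewrite paddr_eq0// normr_eq0 => /andP[/eqP ->].
have B0 j : (p <= j)%N -> B j = 0.
  by move=> /Gp; rewrite GE => /eqP; rewrite paddr_eq0// !normr_eq0 => /andP[_ /eqP ->].
have ApE j : Ap`_j = A j by rewrite coef_poly; case: ltnP => // /A0 ->.
have BpE j : Bp`_j = B j by rewrite coef_poly; case: ltnP => // /B0 ->.
have GqE j : Gq`_j = G j by rewrite coef_poly; case: ltnP => // /Gp ->.
have -> : (\sum_(j < p) G j) * \sum_(l < N | (N <= l + p)%N) s l = (Gq * T).[1].
  rewrite hornerM !horner_poly; congr (_ * _).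
    by apply: eq_bigr => j _; rewrite expr1n mulr1.
  by rewrite big_mkcond; apply: eq_bigr => j _; rewrite expr1n mulr1.
rewrite -!hornerM -!hornerN -!hornerD -hornerN -hornerD.
apply: horner_le_coef => // i.
rewrite coefD coefN coefD coefN !coefM -sumrB coef_deriv coef_poly.
have T0 j : 0 <= T`_j.
  by rewrite coef_poly; do 2 case: ifP => // _; rewrite sE addr_ge0.
have G0 j : 0 <= G j by rewrite GE addr_ge0.
case: ifP => iN.
  rewrite -[_ *+ _]mulr_natl cS -sumrB big1 ?normr0.
    by rewrite sumr_ge0// => j _; rewrite GqE mulr_ge0.
  move=> j _; rewrite ApE BpE !coef_poly !ifT ?subrr//.
    by rewrite (leq_ltn_trans _ (ltnW iN))// leq_subr.
  by rewrite (leq_ltn_trans _ (ltnW iN))// leq_subr.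
rewrite mul0rn add0r normrN (le_trans (ler_norm_sum _ _ _))//; apply: ler_sum => j _.
rewrite ApE BpE GqE.
have [pj|jp] := leqP p j; first by rewrite A0// B0// Gp// !mul0r subrr normr0.
rewrite !coef_poly; case: ifP => ij; last by rewrite !mulr0 subrr normr0.
rewrite ifT; last first.
  move: iN ij jp (ltn_ord j); move: (nat_of_ord j) => jj; lia.
rewrite (le_trans (ler_normB _ _))// !normrM GE sE.
rewrite mulrDl !mulrDr; have := normr_ge0 (A j); have := normr_ge0 (B j).
have := normr_ge0 (c (i - j)%N); have := normr_ge0 (d (i - j)%N).
by move=> *; nra.
Qed.

(* The coefficients c_l + i d_l are those of the power series exp (K z), where
   K' has coefficients A_j + i B_j; its squared modulus at z = 1 is
   exp (2 Re (K 1)). *)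
Lemma sqmod_exp_cvg (R : realType) (p : nat) (A B c d : nat -> R) :
  (forall j, (p <= j)%N -> A j = 0 /\ B j = 0) ->
  c 0%N = 1 -> d 0%N = 0 ->
  (forall l, l.+1%:R * c l.+1 = \sum_(j < l.+1) (A j * c (l - j)%N - B j * d (l - j)%N)) ->
  (forall l, l.+1%:R * d l.+1 = \sum_(j < l.+1) (A j * d (l - j)%N + B j * c (l - j)%N)) ->
  (\sum_(l < N) c l) ^+ 2 + (\sum_(l < N) d l) ^+ 2 @[N --> \oo] -->
    expR (2 * \sum_(j < p) A j / j.+1%:R).
Proof.
move=> AB0 c0 d0 cS dS.
pose G j := `|A j| + `|B j|; pose s l := `|c l| + `|d l|.
have Gp j : (p <= j)%N -> G j = 0 by move=> /AB0[]; rewrite /G => -> ->; rewrite normr0 addr0.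
have G0 j : 0 <= G j by rewrite addr_ge0.
have s0 j : 0 <= s j by rewrite addr_ge0.
pose Mx := expR (\sum_(j < p) G j / j.+1%:R).
have sM N : \sum_(l < N) s l <= Mx.
  rewrite (le_trans (@poly_bound_ind_sum R p G s N _ _ _ _))//; last first.
    by rewrite /s c0 d0 normr1 normr0 addr0 mul1r.
  move=> l; rewrite /s mulrDr -{1}[l.+1%:R]ger0_norm// -normrM cS.
  rewrite -{1}[l.+1%:R]ger0_norm// -normrM dS.
  rewrite (le_trans (lerD (ler_norm_sum _ _ _) (ler_norm_sum _ _ _)))//.
  rewrite -big_split/=; apply: ler_sum => j _.
  rewrite (le_trans (lerD (ler_normB _ _) (ler_normD _ _)))// !normrM /G.
  by rewrite le_eqVlt; apply/orP; left; apply/eqP; ring.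
have M0 : 0 <= Mx by rewrite expR_ge0.
pose sm := \sum_(j < p) A j / j.+1%:R.
pose e N := \sum_(l < N | (N <= l + p)%N) s l.
(* [e N] collects the last [p] terms of a partial sum of the convergent series of [s], so it is a
   difference of two partial sums. *)
have e0 : e N @[N --> \oo] --> (0 : R).
  pose sm' N := \sum_(l < N) s l.
  have cvgs : cvgn sm'.
    have -> : sm' = series s by apply/funext => N; rewrite /series/= big_mkord.
    apply: nondecreasing_is_cvgn; first exact: nondecreasing_series.
    by exists Mx => _ [N _ <-]; rewrite /series/= big_mkord.
  have h : (fun N => sm' (N + p)%N - sm' N) @ \oo --> (0 : R).
    rewrite -(subrr (limn sm')); apply: cvgB => //.
    have : [sequence sm' (n + p)%N]_n @ \oo --> limn sm' by rewrite cvg_shiftn.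
    exact.
  rewrite -(cvg_shiftn p); apply: cvg_trans h; apply: near_eq_cvg; near=> N.
  rewrite /e /sm' -(big_mkord xpredT s) -(big_mkord xpredT s).
  rewrite (@big_cat_nat _ _ _ N) ?leq_addr//= addrAC subrr add0r.
  rewrite -(big_mkord (fun l => (N + p <= l + p)%N) s).
  rewrite (@big_cat_nat _ _ _ N 0)//= ?leq_addr//.
  have -> : \sum_(0 <= i < N | (N + p <= i + p)%N) s i = 0.
    by rewrite big_nat_cond big1// => i /andP[/andP[_ iN]]; rewrite leq_add2r leqNgt iN.
  rewrite add0r big_nat_cond [RHS]big_nat_cond; apply: eq_bigl => i.
  by rewrite leq_add2r andbT; case: (N <= i)%N => //=; rewrite andbT.
pose E := expR (2 * \sum_(j < p) `|A j|).
pose SG := \sum_(j < p) G j.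
have key N : (0 < N)%N ->
    `| (\sum_(l < N) c l) ^+ 2 + (\sum_(l < N) d l) ^+ 2 - expR (2 * sm) | <=
    (4 * Mx * SG * E) * E * e N.
  move=> N0.
  pose C := \poly_(l < N) c l; pose D := \poly_(l < N) d l.
  pose Ap := \poly_(j < p) A j; pose Bp := \poly_(j < p) B j.
  pose K := poly_primitive p A.
  pose F : {poly R} := C ^+ 2 + D ^+ 2.
  have Fd r : F^`().[r] = 2 * (C.[r] * C^`().[r] + D.[r] * D^`().[r]).
    rewrite /F derivD !expr2 !derivM !hornerD !hornerM; ring.
  have [r r01 hr] := @mean_value_eq R _ _ 0 1 ler01 (is_derive_weighted F (- (2%:R *: K))).
  have C1 : C.[1] = \sum_(l < N) c l.
    by rewrite horner_poly; apply: eq_bigr => i _; rewrite expr1n mulr1.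
  have D1 : D.[1] = \sum_(l < N) d l.
    by rewrite horner_poly; apply: eq_bigr => i _; rewrite expr1n mulr1.
  have K1 : K.[1] = sm by exact: primitive_at1.
  move: hr; rewrite subr0 mulr1 !hornerN !hornerZ primitive_at0 K1 mulr0 oppr0 expR0 mulr1.
  rewrite derivN derivZ !hornerN !hornerZ deriv_primitive -/Ap Fd.
  have FE x : F.[x] = C.[x] ^+ 2 + D.[x] ^+ 2 by rewrite /F hornerD !horner_exp.
  rewrite !FE C1 D1 [C.[0]]horner_coef0 [D.[0]]horner_coef0 !coef_poly N0 c0 d0.
  rewrite expr1n expr0n addr0 => hr.
  have e1 := @poly_trunc_error R p N A B G s c d r (fun=> erefl) (fun=> erefl) Gp cS r01.
  have e2 := @poly_trunc_error R p N A (fun j => - B j) G s d c r.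
  have {}e2 := e2 (fun j => congr1 (+%R `|A j|) (esym (normrN (B j)))) (fun l => addrC _ _) Gp.
  have {}e2 : `|D^`().[r] - (Ap.[r] * D.[r] + Bp.[r] * C.[r])| <= SG * e N.
    have BN : (\poly_(j < p) (- B j)).[r] = - Bp.[r].
      rewrite -hornerN; congr (_.[r]); apply/polyP => i; rewrite coefN !coef_poly.
      by case: ifP; rewrite ?oppr0.
    move: e2; rewrite BN mulNr opprK; apply => // l.
    by rewrite dS; apply: eq_bigr => j _; rewrite mulNr opprK.
  have Cr (t : nat -> R) : (forall l, `|t l| <= s l) -> `|(\poly_(l < N) t l).[r]| <= Mx.
    move=> ts; rewrite (le_trans _ (sM N))//.
    rewrite (le_trans (@horner_le_coef R _ (\poly_(l < N) s l) r _ r01))//.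
      by move=> i; rewrite !coef_poly; case: ifP; rewrite ?normr0.
    by rewrite horner_poly; apply: ler_sum => i _; rewrite expr1n mulr1.
  have CM : `|C.[r]| <= Mx by apply: Cr => l; rewrite /s lerDl.
  have DM : `|D.[r]| <= Mx by apply: Cr => l; rewrite /s lerDr.
  have hK (x : R) : 0 <= x <= 1 -> `|K.[x]| <= \sum_(j < p) `|A j|.
    move=> x01; rewrite (le_trans (@horner_le_coef R K (poly_primitive p (fun j => `|A j|)) x _ x01))//.
      case=> [|i]; rewrite /K /poly_primitive !coef_poly /=; first by rewrite normr0.
      by case: ifP => _; rewrite ?normr0// normrM normfV normr_nat.
    rewrite primitive_at1; apply: ler_sum => j _.
    by rewrite ler_piMr// invf_le1// ler1n.
  have EK (x t : R) : `|t| <= \sum_(j < p) `|A j| -> expR (2 * t) <= E /\ expR (- (2 * t)) <= E.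
    by move=> tA; rewrite /E !ler_expR; have := ler_norm t; have := ler_norm (- t); rewrite normrN; lra.
  have [EK1 _] := EK 0 sm ltac:(by rewrite -K1; apply: hK; rewrite ler01 lexx).
  have [_ EKr] := EK 0 K.[r] (hK _ r01).
  have -> : (\sum_(l < N) c l) ^+ 2 + (\sum_(l < N) d l) ^+ 2 - expR (2 * sm)
    = (((\sum_(l < N) c l) ^+ 2 + (\sum_(l < N) d l) ^+ 2) * expR (- (2%:R * sm)) - 1) * expR (2 * sm).
    by rewrite mulrBl mul1r -mulrA expRN mulVf ?mulr1// gt_eqF// expR_gt0.
  rewrite hr normrM (ger0_norm (expR_ge0 _)).
  rewrite -[leRHS]mulrA [E * e N]mulrC mulrA.
  apply: ler_pM => //.
  rewrite normrM (ger0_norm (expR_ge0 _)) -mulrA [E * _]mulrC mulrA.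
  apply: ler_pM => //.
  (* The contributions of [Bp] to the derivative of C^2 + D^2 cancel: the imaginary part of the rate
     only rotates. *)
  have -> : 2 * (C.[r] * C^`().[r] + D.[r] * D^`().[r]) + - (2%:R * Ap.[r]) * (C.[r] ^+ 2 + D.[r] ^+ 2)
    = 2 * (C.[r] * (C^`().[r] - (Ap.[r] * C.[r] - Bp.[r] * D.[r]))
        + D.[r] * (D^`().[r] - (Ap.[r] * D.[r] + Bp.[r] * C.[r]))) by ring.
  rewrite normrM ger0_norm//.
  have -> : 4 * Mx * SG * e N = 2 * (Mx * (SG * e N) + Mx * (SG * e N)) by ring.
  rewrite ler_pM2l// (le_trans (ler_normD _ _))// lerD// normrM ler_pM//.
rewrite -/sm.
have h0 : (fun N => (4 * Mx * SG * E) * E * e N) @ \oo --> (0 : R).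
  by rewrite -(mulr0 ((4 * Mx * SG * E) * E)); apply: cvgMl_tmp.
apply/cvgrPdist_le => /= eps eps0.
move/cvgrPdist_le : h0 => /(_ _ eps0) h0.
near=> N.
rewrite distrC (le_trans (key N _))//; first by near: N; exists 1%N.
rewrite (le_trans (ler_norm _))// -normrN -[- _]add0r.
near: N; exact: h0.
Unshelve. all: by end_near.
Qed.

Lemma seq_cvg_le (R : realType) (u v : nat -> R) (a b : R) :
  u @ \oo --> a -> v @ \oo --> b -> (forall n, u n <= v n) -> a <= b.
Proof. by move=> ua vb uv; apply: (ler_cvg_to ua vb); near do exact: uv.
Unshelve. all: by end_near. Qed.

(** The coefficient form of M' = K' M for the exponential generating functions M of [m] and K of
    [k]; the value [k 0] is left free. *)
Definition is_cumulant (R : realType) (m k : nat -> R) : Prop :=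
  m 0%N = 1 /\ forall l, m l.+1 = \sum_(j < l.+1) 'C(l, j)%:R * k j.+1 * m (l - j)%N.

(** The Cauchy-Schwarz inequality (E v(Y))^2 <= E v(Y)^2 for polynomials v. As a closed condition on
    finitely many moments at a time, it passes to limits of moment sequences. *)
Definition moment_positive (R : realType) (m : nat -> R) : Prop :=
  forall (N : nat) (v : nat -> R),
    (\sum_(j < N) v j * m j) ^+ 2 <= \sum_(j < N) \sum_(k < N) v j * v k * m (j + k)%N.

Lemma sum_triangle (R : realType) (F : nat -> nat -> R) (n : nat) :
  \sum_(j < n) \sum_(k < n - j) F j k = \sum_(l < n) \sum_(j < l.+1) F j (l - j)%N.
Proof.
elim: n => [|n ih]; first by rewrite !big_ord0.
rewrite [RHS]big_ord_recr /= -ih [in RHS]big_ord_recr /= [LHS]big_ord_recr /=.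
rewrite addrA -big_split/= subSnn subnn big_ord1; congr (_ + _).
by apply: eq_bigr => j _; rewrite subSn ?big_ord_recr// ltnW.
Qed.

(** The real part of the binomial expansion of (e^{it} + e^{-it})^l e^{if}. The phase [f] is general
    because the rule of Pascal shifts it by t and by -t. *)
Lemma sum_bin_cos (R : realType) (l : nat) (t f : R) :
  \sum_(j < l.+1) 'C(l, j)%:R * cos ((j%:R - (l - j)%:R) * t + f) = (2 * cos t) ^+ l * cos f.
Proof.
elim: l f => [|l ih] f; first by rewrite big_ord1 bin0 subr0 mul0r add0r expr0.
rewrite big_ord_recl /= bin0 subn0 !mul1r.
under eq_bigr => i _.
  rewrite /bump /= add1n binS subSS natrD mulrDl.
  over.
rewrite big_split /= addrA.
have e1 : cos ((0 - l.+1%:R) * t + f) +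
    \sum_(i < l.+1) 'C(l, i.+1)%:R * cos ((i.+1%:R - (l - i)%:R) * t + f) =
    \sum_(j < l.+1) 'C(l, j)%:R * cos ((j%:R - (l - j)%:R) * t + (f - t)).
  rewrite big_ord_recr /= bin_small// mul0r addr0 [RHS]big_ord_recl /= bin0 subn0 mul1r.
  congr (_ + _); first by congr cos; rewrite -natr1; ring.
  apply: eq_bigr => i _; rewrite /bump /= add1n; congr (_ * cos _).
  rewrite (_ : (l - i = (l - i.+1).+1)%N); last by rewrite subnSK.
  by rewrite -[(_ - _).+1%:R]natr1; ring.
have e2 : \sum_(i < l.+1) 'C(l, i)%:R * cos ((i.+1%:R - (l - i)%:R) * t + f) =
    \sum_(j < l.+1) 'C(l, j)%:R * cos ((j%:R - (l - j)%:R) * t + (f + t)).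
  by apply: eq_bigr => i _; congr (_ * cos _); rewrite -natr1; ring.
rewrite e1 e2 !ih -mulrDr exprSr -mulrA; congr (_ * _).
by rewrite !cosD cosN sinN; ring.
Qed.

Lemma fact_neq0 (R : realType) (n : nat) : n`!%:R != 0 :> R.
Proof. by rewrite pnatr_eq0 -lt0n fact_gt0. Qed.

Lemma bin_ratio (R : realType) (l j : nat) : (j <= l)%N ->
  'C(l, j)%:R = l`!%:R / (j`!%:R * (l - j)`!%:R) :> R.
Proof. by move=> jl; rewrite -(bin_fact jl) !natrM mulfK// mulf_neq0 ?fact_neq0. Qed.

Section cumulant_growth.
Variables (R : realType) (m k : nat -> R) (p : nat).
Hypotheses (mk : is_cumulant m k) (kp : forall j, (p < j)%N -> k j = 0).

(** With z = r e^{it}, c + i d is m_l z^l / l! and A + i B is k_{j+1} z^{j+1} / j!: the coefficients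
    in s of E exp(s z Y) and of its logarithmic derivative in s. *)
Let c (r t : R) l := m l * r ^+ l / l`!%:R * cos (l%:R * t).
Let d (r t : R) l := m l * r ^+ l / l`!%:R * sin (l%:R * t).
Let A (r t : R) j := k j.+1 * r ^+ j.+1 / j`!%:R * cos (j.+1%:R * t).
Let B (r t : R) j := k j.+1 * r ^+ j.+1 / j`!%:R * sin (j.+1%:R * t).

Lemma scaled_moment_rec (r : R) (l : nat) :
  l.+1%:R * (m l.+1 * r ^+ l.+1 / l.+1`!%:R) =
  \sum_(j < l.+1) (k j.+1 * r ^+ j.+1 / j`!%:R) * (m (l - j)%N * r ^+ (l - j) / (l - j)`!%:R).
Proof.
have [_ ->] := mk.
rewrite !mulr_suml mulr_sumr; apply: eq_bigr => j _.
have jl : (j <= l)%N by rewrite -ltnS.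
rewrite factS natrM invfM.
have -> : r ^+ l.+1 = r ^+ j.+1 * r ^+ (l - j) by rewrite -exprD addSn subnKC.
rewrite bin_ratio//.
have l0 : l.+1%:R != 0 :> R by rewrite pnatr_eq0.
by field; rewrite !fact_neq0 nat1r l0.
Qed.

Lemma cos_coef_rec (r t : R) (l : nat) :
  l.+1%:R * c r t l.+1 =
    \sum_(j < l.+1) (A r t j * c r t (l - j)%N - B r t j * d r t (l - j)%N).
Proof.
rewrite /c mulrA scaled_moment_rec mulr_suml; apply: eq_bigr => j _.
have jl : (j <= l)%N by rewrite -ltnS.
have -> : l.+1%:R * t = j.+1%:R * t + (l - j)%:R * t.
  by rewrite -mulrDl -natrD addSn subnKC.
by rewrite cosD /A /B /d; ring.
Qed.

Lemma sin_coef_rec (r t : R) (l : nat) :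
  l.+1%:R * d r t l.+1 =
    \sum_(j < l.+1) (A r t j * d r t (l - j)%N + B r t j * c r t (l - j)%N).
Proof.
rewrite /d mulrA scaled_moment_rec mulr_suml; apply: eq_bigr => j _.
have jl : (j <= l)%N by rewrite -ltnS.
have -> : l.+1%:R * t = j.+1%:R * t + (l - j)%:R * t.
  by rewrite -mulrDl -natrD addSn subnKC.
by rewrite sinD /A /B /c; ring.
Qed.

Lemma sqmod_mgf_cvg (r t : R) :
  (\sum_(l < N) c r t l) ^+ 2 + (\sum_(l < N) d r t l) ^+ 2 @[N --> \oo] -->
    expR (2 * \sum_(j < p) k j.+1 * r ^+ j.+1 / j.+1`!%:R * cos (j.+1%:R * t)).
Proof.
have -> : \sum_(j < p) k j.+1 * r ^+ j.+1 / j.+1`!%:R * cos (j.+1%:R * t) =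
    \sum_(j < p) A r t j / j.+1%:R.
  apply: eq_bigr => j _; rewrite /A factS natrM invfM.
  have l0 : j.+1%:R != 0 :> R by rewrite pnatr_eq0.
  by field; rewrite !fact_neq0 nat1r l0.
apply: (@sqmod_exp_cvg R p (A r t) (B r t)).
- by move=> j pj; rewrite /A /B kp ?ltnS// !mul0r.
- by case: mk => m0 _; rewrite /c m0 expr0 fact0 invr1 !mul0r cos0 !mul1r.
- by rewrite /d mul0r sin0 mulr0.
- exact: cos_coef_rec.
- exact: sin_coef_rec.
Qed.

(** Finitely many nonzero cumulants make the weight in the Gronwall bound a finite sum, so the
    exponential moment series converges absolutely at every r. *)
Lemma mgf_abs_bounded (r : R) :
  exists M, forall N, \sum_(l < N) `|m l * r ^+ l / l`!%:R| <= M.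
Proof.
pose G j := `|k j.+1 * r ^+ j.+1 / j`!%:R|.
pose s l := `|m l * r ^+ l / l`!%:R|.
exists (s 0%N * expR (\sum_(j < p) G j / j.+1%:R)) => N.
apply: (@poly_bound_ind_sum R p G s N) => //.
- by move=> j; rewrite normr_ge0.
- by move=> j pj; rewrite /G kp ?ltnS// !mul0r normr0.
- by move=> l; rewrite normr_ge0.
move=> l; rewrite -{1}[l.+1%:R]ger0_norm// -normrM scaled_moment_rec.
rewrite (le_trans (ler_norm_sum _ _ _))//; apply: ler_sum => j _.
by rewrite normrM.
Qed.

Hypothesis mpos : moment_positive m.

(* Cauchy-Schwarz [|E exp (z Y)|^2 <= E exp (2 Re z Y)] for z = r exp (i t),
   applied to truncated exponential series. *)
Lemma cumulant_gen_le (r t : R) : 0 <= r ->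
  2 * (\sum_(j < p) k j.+1 * r ^+ j.+1 / j.+1`!%:R * cos (j.+1%:R * t)) <=
  \sum_(j < p) k j.+1 * (2 * r * cos t) ^+ j.+1 / j.+1`!%:R.
Proof.
move=> r0.
pose g (i j : nat) := m (i + j)%N * r ^+ (i + j) / (i`!%:R * j`!%:R) * cos ((i%:R - j%:R) * t).
pose Q N := \sum_(i < N) \sum_(j < N) g i j.
pose T N := \sum_(l < N) c (2 * r * cos t) 0 l.
pose s l := `|m l * (2 * r) ^+ l / l`!%:R|.
have [M sM] := mgf_abs_bounded (2 * r).
have CS N : (\sum_(l < N) c r t l) ^+ 2 + (\sum_(l < N) d r t l) ^+ 2 <= Q N.
  have h1 := mpos N (fun l => r ^+ l / l`!%:R * cos (l%:R * t)).
  have h2 := mpos N (fun l => r ^+ l / l`!%:R * sin (l%:R * t)).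
  have e1 : \sum_(l < N) c r t l = \sum_(l < N) r ^+ l / l`!%:R * cos (l%:R * t) * m l.
    by apply: eq_bigr => l _; rewrite /c; ring.
  have e2 : \sum_(l < N) d r t l = \sum_(l < N) r ^+ l / l`!%:R * sin (l%:R * t) * m l.
    by apply: eq_bigr => l _; rewrite /d; ring.
  rewrite e1 e2 (le_trans (lerD h1 h2))// -big_split/= /Q.
  rewrite le_eqVlt; apply/orP; left; apply/eqP; apply: eq_bigr => i _.
  rewrite -big_split/=; apply: eq_bigr => j _.
  by rewrite /g mulrBl cosB exprD invfM; ring.
have TE n : T n = \sum_(i < n) \sum_(j < n - i) g i j.
  rewrite sum_triangle; apply: eq_bigr => l _; rewrite /c mulr0 cos0 mulr1.
  have := sum_bin_cos l t 0; rewrite cos0 mulr1 => h.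
  rewrite (_ : 2 * r * cos t = r * (2 * cos t)); last by ring.
  rewrite exprMn -h !(mulr_sumr, mulr_suml); apply: eq_bigr => j _.
  have jl : (j <= l)%N by rewrite -ltnS.
  rewrite /g subnKC// addr0.
  rewrite bin_ratio//.
  by field; rewrite !fact_neq0.
pose H (i j : nat) := `|m (i + j)%N * r ^+ (i + j) / (i`!%:R * j`!%:R)|.
have gH i j : `|g i j| <= H i j.
  by rewrite /g normrM ler_piMr// ler_norml cos_geN1 cos_le1.
have SE n : \sum_(l < n) s l = \sum_(i < n) \sum_(j < n - i) H i j.
  rewrite sum_triangle; apply: eq_bigr => l _.
  have := @sum_bin_cos R l 0 0; rewrite cos0 !mulr1 => h.
  rewrite /s exprMn -h.
  transitivity (\sum_(j < l.+1) `|'C(l, j)%:R * (m l * r ^+ l / l`!%:R)|).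
    under [in RHS]eq_bigr do rewrite normrM normr_nat.
    rewrite -mulr_suml.
    under eq_bigr do rewrite mulr0 addr0 cos0 mulr1.
    rewrite mulrCA -!mulrA normrM !mulrA; congr (_ * _).
    by rewrite ger0_norm// sumr_ge0.
  apply: eq_bigr => j _.
  have jl : (j <= l)%N by rewrite -ltnS.
  rewrite /H subnKC//; congr (`|_|).
  rewrite bin_ratio//.
  by field; rewrite !fact_neq0.
(* The square i, j < N exceeds the triangle i + j < N only in pairs with N <= i + j < 2N, whose
   terms are controlled by a block of the convergent series of [s]. *)
have QT N : Q N <= T N + (\sum_(l < N + N) s l - \sum_(l < N) s l).
  have S2 : \sum_(i < N) \sum_(j < N) H i j <= \sum_(l < N + N) s l.
    rewrite SE big_split_ord /= -[leLHS]addr0; apply: lerD; last first.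
      by apply: sumr_ge0 => i _; apply: sumr_ge0 => j _; rewrite normr_ge0.
    apply: ler_sum => i _; rewrite -!(big_mkord xpredT (H i)).
    rewrite (@big_cat_nat _ _ _ N 0 (N + N - i))//=; last first.
      by rewrite -addnBA ?leq_addr// ltnW.
    by rewrite lerDl sumr_ge0// => j _; rewrite normr_ge0.
  rewrite (SE N) TE; apply: (le_trans _ (lerD (lexx _) (lerB S2 (lexx _)))).
  rewrite -sumrB -big_split/=; apply: ler_sum => i _.
  have split3 (F : nat -> R) : \sum_(j < N) F j = \sum_(j < N - i) F j + \sum_(N - i <= j < N) F j.
    by rewrite -!(big_mkord xpredT F) (@big_cat_nat _ _ _ (N - i)%N)// leq_subr.
  rewrite (split3 (g i)) lerD2l (split3 (H i)) addrAC subrr add0r.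
  by apply: ler_sum => j _; rewrite (le_trans (ler_norm _)).
pose S n := \sum_(l < n) s l.
have cvgS : cvgn S.
  have -> : S = series s by apply/funext => N; rewrite /series/= big_mkord.
  apply: nondecreasing_is_cvgn.
    by apply: nondecreasing_series => i _ _; rewrite /s normr_ge0.
  by exists M => _ [N _ <-]; rewrite /series/= big_mkord; exact: sM.
have S20 : (fun N => S (N + N)%N - S N) @ \oo --> (0 : R).
  rewrite -(subrr (limn S)); apply: cvgB => //.
  have h : (fun n => (n + n)%N) @ \oo --> \oo.
    move=> U [N0 _ NU]; exists N0 => // n /= Nn; apply: NU => /=.
    by rewrite (leq_trans Nn)// leq_addr.
  exact: (cvg_comp _ S h cvgS).
set a := (X in 2 * X <= _); set b := (X in _ <= X).
(* At angle 0, [sqmod_mgf_cvg] gives the limit of the square of [T]. Its root is |T|, and below only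
   T <= |T| is used. *)
have Tb : (fun N => Num.sqrt (T N ^+ 2)) @ \oo --> expR b.
  have := @sqmod_mgf_cvg (2 * r * cos t) 0.
  have -> : (fun N => (\sum_(l < N) c (2 * r * cos t) 0 l) ^+ 2 +
      (\sum_(l < N) d (2 * r * cos t) 0 l) ^+ 2) = fun N => T N ^+ 2.
    apply/funext => N; rewrite [X in _ + X ^+ 2]big1 ?expr0n ?addr0// => l _.
    by rewrite /d mulr0 sin0 mulr0.
  have -> : \sum_(j < p) k j.+1 * (2 * r * cos t) ^+ j.+1 / j.+1`!%:R * cos (j.+1%:R * 0) = b.
    by apply: eq_bigr => j _; rewrite mulr0 cos0 mulr1.
  move=> h.
  have -> : expR b = Num.sqrt (expR (2 * b)).
    by rewrite expRM_natl sqrtr_sqr ger0_norm// expR_ge0.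
  exact: (continuous_cvg _ (@sqrt_continuous R _) h).
have key : expR (2 * a) <= expR b.
  have lim2 : (fun N => Num.sqrt (T N ^+ 2) + (S (N + N)%N - S N)) @ \oo --> expR b.
    by rewrite -[X in _ --> X]addr0; apply: cvgD.
  apply: (seq_cvg_le (@sqmod_mgf_cvg r t) lim2) => N.
  rewrite (le_trans (CS N))// (le_trans (QT N))// lerD2r sqrtr_sqr.
  exact: ler_norm.
by rewrite ler_expR in key.
Qed.

End cumulant_growth.

Lemma top_coef_ge0 (R : realType) (p : nat) (a : nat -> R) :
  (forall r, 0 <= r -> 0 <= \sum_(j < p.+1) a j * r ^+ j) -> 0 <= a p.
Proof.
case: p => [|p] h; first by have := h 0 (lexx _); rewrite big_ord1 mulr1.
rewrite leNgt; apply/negP => ap0.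
pose B := \sum_(j < p.+1) `|a j|.
have B0 : 0 <= B by apply: sumr_ge0.
(* The value at which B + a_{p+1} r = a_{p+1}: the leading term absorbs the bound B r^p on all the
   others and a negative number remains. *)
pose r := 1 + B / - a p.+1.
have r1 : 1 <= r by rewrite lerDl divr_ge0// oppr_ge0 ltW.
have r0 : 0 < r by rewrite (lt_le_trans ltr01).
have := h r (ltW r0); rewrite big_ord_recr /= leNgt => /negP; apply.
have le1 : \sum_(j < p.+1) a j * r ^+ j <= B * r ^+ p.
  rewrite mulr_suml; apply: ler_sum => j _.
  rewrite (le_trans (ler_norm _))// normrM ler_wpM2l//.
  by rewrite ger0_norm ?exprn_ge0 ?(ltW r0)// (ler_weXn2l r1)// -ltnS.
apply: (le_lt_trans (lerD le1 (lexx _))).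
rewrite exprS mulrA -mulrDl /r.
have -> : B + a p.+1 * (1 + B / - a p.+1) = a p.+1.
  by field; rewrite lt_eqF.
by rewrite nmulr_rlt0// exprn_gt0// -/r.
Qed.

(** With c = cos(pi / 3), the formula for cos 3x at cos pi = -1 reads (c + 1)(2c - 1)^2 = 0, and c
    >= 0. *)
Lemma cos_third_pi (R : realType) : cos (pi / 3 : R) = 2^-1.
Proof.
set c := cos _.
have p3 : 0 < pi :> R := pi_gt0 R.
have c0 : 0 <= c.
  by apply: cos_ge0_pihalf; apply/andP; split; lra.
have e : cos (pi / 3 * 2 + pi / 3) = -1 :> R.
  by rewrite (_ : _ + _ = pi) ?cospi//; field.
have sc : sin (pi / 3 : R) ^+ 2 = 1 - c ^+ 2 by rewrite sin2cos2.
move: e; rewrite cosD (_ : pi / 3 * 2 = pi / 3 + pi / 3 :> R); last by field.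
rewrite cosD sinD -/c => e.
have : (c + 1) * (2 * c - 1) ^+ 2 = 0 by move: e sc; move: (sin _) => s; nra.
move/eqP; rewrite mulf_eq0 expf_eq0 /= => /orP[/eqP|/eqP]; lra.
Qed.

Lemma norm_cos_le_half (R : realType) (t : R) :
  pi / 3 <= t <= pi / 3 * 2 -> `|2 * cos t| <= 1.
Proof.
move=> /andP[t1 t2].
have p0 := pi_gt0 R.
have I3 : pi / 3 \in `[0, pi : R] by rewrite in_itv /=; apply/andP; split; lra.
have I23 : pi / 3 * 2 \in `[0, pi : R] by rewrite in_itv /=; apply/andP; split; lra.
have It : t \in `[0, pi] by rewrite in_itv /=; apply/andP; split; lra.
have h1 : cos t <= cos (pi / 3) by rewrite leNgt ltr_cos// -leNgt.
have h2 : cos (pi / 3 * 2) <= cos t by rewrite leNgt ltr_cos// -leNgt.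
have e : cos (pi / 3 * 2) = - cos (pi / 3) :> R.
  rewrite (_ : pi / 3 * 2 = - (pi / 3) + pi :> R); last by field.
  by rewrite cosDpi cosN.
move: h1 h2; rewrite e cos_third_pi => h1 h2; rewrite ler_norml; lra.
Qed.

Section marcinkiewicz.
Variables (R : realType) (m k : nat -> R).
Hypotheses (mk : is_cumulant m k) (mpos : moment_positive m).

(** Both sides of [cumulant_gen_le] are polynomials in r >= 0, so the top coefficient of their
    difference is nonnegative; the angle remains free. *)
Lemma top_cumulant_sign (p : nat) (t : R) :
  (forall j, (p.+1 < j)%N -> k j = 0) ->
  0 <= k p.+1 * ((2 * cos t) ^+ p.+1 - 2 * cos (p.+1%:R * t)).
Proof.
move=> kp.
pose a j := k j * ((2 * cos t) ^+ j - 2 * cos (j%:R * t)) / j`!%:R * (j != 0)%:R.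
have : 0 <= a p.+1.
  apply: top_coef_ge0 => r r0.
  rewrite big_ord_recl /= /a eqxx mulr0 mul0r add0r.
  have := cumulant_gen_le mk kp mpos t r0.
  rewrite -subr_ge0 mulr_sumr -sumrB => h; apply: le_trans h _.
  rewrite le_eqVlt; apply/orP; left; apply/eqP; apply: eq_bigr => j _.
  by rewrite /bump /= add1n !exprMn; ring.
by rewrite /a mulr1 pmulr_lge0// invr_gt0 ltr0n fact_gt0.
Qed.

(** At t = pi / p the bracket of [top_cumulant_sign] is at least 2, so k_p >= 0. At t = 2 pi q / p,
    with q the integer part of p / 3, cos(p t) = 1 and t lies in [pi / 3, 2 pi / 3], so |2 cos t| <=
    1, the bracket is negative and k_p <= 0. *)
Lemma top_cumulant_eq0 (p : nat) : (3 <= p)%N ->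
  (forall j, (p < j)%N -> k j = 0) -> k p = 0.
Proof.
case: p => // p p3 kp.
have P0 := pi_gt0 R.
have p0 : 0 < p.+1%:R :> R by rewrite ltr0n.
case: (ltgtP (k p.+1) 0) => // kp0.
  have := top_cumulant_sign (pi / p.+1%:R) kp.
  rewrite nmulr_rge0// [p.+1%:R * _]mulrC divfK ?gt_eqF// cospi => h.
  have c0 : 0 <= cos (pi / p.+1%:R : R).
    apply: cos_ge0_pihalf; apply/andP; split.
      by rewrite (@le_trans _ _ 0)// ?divr_ge0 ?pi_ge0//; lra.
    by rewrite ler_pM2l// lef_pV2 ?posrE// ler_nat (leq_trans _ p3).
  have : 0 <= (2 * cos (pi / p.+1%:R) : R) ^+ p.+1 by rewrite exprn_ge0 ?mulr_ge0.
  lra.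
pose q := (p.+1 %/ 3)%N.
pose t : R := 2 * pi * q%:R / p.+1%:R.
have := top_cumulant_sign t kp.
have -> : cos (p.+1%:R * t) = 1.
  have -> : p.+1%:R * t = 0 + (pi *+ 2) *+ q.
    by rewrite /t add0r -[pi *+ 2]mulr_natl -[RHS]mulr_natr mulrC divfK ?gt_eqF.
  by rewrite (periodicn (@cosD2pi R)) cos0.
rewrite pmulr_rge0// mulr1 subr_ge0 => h.
have q1 : (p.+1 <= 6 * q)%N by rewrite /q; move: p3; clear; lia.
have q2 : (3 * q <= p.+1)%N by rewrite /q; clear; lia.
have tle : `|2 * cos t| <= 1.
  apply: norm_cos_le_half; apply/andP; split; rewrite /t.
    rewrite ler_pdivlMr// -[leRHS]mulrA mulrC mulrA.
    have : p.+1%:R <= (6 * q)%:R :> R by rewrite ler_nat.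
    by rewrite natrM => h1; nra.
  rewrite ler_pdivrMr//.
  have : (3 * q)%:R <= p.+1%:R :> R by rewrite ler_nat.
  by rewrite natrM => h1; nra.
have : (2 * cos t) ^+ p.+1 <= 1.
  by rewrite (le_trans (ler_norm _))// normrX exprn_ile1.
lra.
Qed.

Lemma marcinkiewicz (s : nat) :
  (forall j, (s <= j)%N -> k j = 0) -> forall j, (3 <= j)%N -> k j = 0.
Proof.
move=> ks; have {}ks j : (s + 3 <= j)%N -> k j = 0.
  by move=> h; apply: ks; rewrite (leq_trans _ h)// leq_addr.
elim: s ks => [|s ih] ks j j3; first exact: ks.
apply: ih => // i; rewrite leq_eqVlt => /orP[/eqP <-|]; last exact: ks.
by apply: top_cumulant_eq0; [rewrite leq_addl|exact: ks].
Qed.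
End marcinkiewicz.

Lemma cvg_uniqueR (R : realType) (T : Type) (F : set_system T) (f : T -> R) (a b : R) :
  ProperFilter F -> f @ F --> a -> f @ F --> b -> a = b.
Proof. by move=> FF fa fb; apply: (cvg_unique (@Rhausdorff R) fa fb). Qed.

Lemma cvg_sumr (R : realType) (T I : Type) (F : set_system T) (r : seq I) (P : pred I)
    (f : I -> T -> R) (l : I -> R) : Filter F ->
  (forall i, P i -> f i x @[x --> F] --> l i) ->
  \sum_(i <- r | P i) f i x @[x --> F] --> \sum_(i <- r | P i) l i.
Proof. by move=> FF h; apply: cvg_big => //; exact: add_continuous. Qed.

Lemma is_cumulant_scale (R : realType) (m k : nat -> R) (a : R) :
  is_cumulant m k -> is_cumulant (fun l => a ^+ l * m l) (fun l => a ^+ l * k l).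
Proof.
move=> [m0 mS]; split; first by rewrite mul1r.
move=> l; rewrite mS mulr_sumr; apply: eq_bigr => j _.
have jl : (j <= l)%N by rewrite -ltnS.
have -> : a ^+ l.+1 = a ^+ j.+1 * a ^+ (l - j) by rewrite -exprD addSn subnKC.
by ring.
Qed.

Lemma moment_positive_scale (R : realType) (m : nat -> R) (a : R) :
  moment_positive m -> moment_positive (fun l => a ^+ l * m l).
Proof.
move=> mp N v; have := mp N (fun l => v l * a ^+ l).
under eq_bigr do rewrite -mulrA.
move=> /le_trans; apply; rewrite le_eqVlt; apply/orP; left; apply/eqP.
apply: eq_bigr => i _; apply: eq_bigr => j _; rewrite exprD; ring.
Qed.

(** [a] is 2^-i for the least i that brings all the scaled terms to at most 1. By minimality,
    doubling [a] pushes some a^j |k j| above 1, so this term exceeds 2^-j >= 2^-s; if i = 0, the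
    order [j0] serves. *)
Lemma dyadic_scale (R : realType) (k : nat -> R) (s j0 : nat) (e : R) :
  (3 <= j0 < s)%N -> e <= 2^-1 ^+ s -> e <= `|k j0| ->
  exists a : R, [/\ 0 < a <= 1, forall j, (3 <= j < s)%N -> a ^+ j * `|k j| <= 1 &
    exists2 j, (3 <= j < s)%N & e <= a ^+ j * `|k j|].
Proof.
move=> j0s es ek.
pose P i := [forall j : 'I_s, (3 <= j)%N ==> ((2^-1 ^+ i) ^+ j * `|k j| <= 1)].
have exP : exists i, P i.
  pose A := \sum_(j < s) `|k j|.
  exists (Num.truncn A).+1; apply/forallP => j; apply/implyP => j3.
  have kA : `|k j| <= A by rewrite /A (bigD1 j)//= lerDl sumr_ge0.
  have A2 : A <= 2 ^+ (Num.truncn A).+1.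
    rewrite (le_trans (ltW (truncnS_gt A)))// -natrX ler_nat.
    by rewrite ltnW// ltn_expl.
  set i := (Num.truncn A).+1 in A2 *.
  have h1 : (2^-1 ^+ i) ^+ j <= 2^-1 ^+ i :> R.
    rewrite -[leRHS]expr1 ler_wiXn2l ?exprn_ge0 ?exprn_ile1// ?invf_le1 ?ler1n//.
    by rewrite (leq_trans _ j3).
  rewrite (le_trans (ler_wpM2r _ h1))// exprVn mulrC ler_pdivrMr ?exprn_gt0//.
  by rewrite mul1r (le_trans kA).
case: (ex_minnP exP) => i Pi imin.
have i0 : 0 < (2^-1 ^+ i : R) by rewrite exprn_gt0.
exists (2^-1 ^+ i); split.
- by rewrite i0 exprn_ile1// invf_le1// ler1n.
- move=> j /andP[j3 js]; have := forallP Pi (Ordinal js).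
  by rewrite /= j3.
case: i Pi imin i0 => [|i] Pi imin i0.
  by exists j0 => //; rewrite expr0 expr1n mul1r.
have /forallPn[j] : ~~ P i by apply/negP => /imin; rewrite ltnn.
rewrite negb_imply -ltNge => /andP[j3 kj].
exists j; first by rewrite j3 ltn_ord.
rewrite (le_trans es)// exprSr exprMn mulrAC.
rewrite (@le_trans _ _ (2^-1 ^+ j))//.
  by rewrite ler_wiXn2l// ?invf_le1 ?ler1n// ltnW.
by rewrite ler_peMl ?exprn_ge0// ltW.
Qed.

Lemma ultra_fmap (T U : Type) (f : T -> U) (G : set_system T) :
  UltraFilter G -> UltraFilter (f @ G).
Proof.
move=> GU; split; first exact: fmap_proper_filter.
move=> H HP fGH; apply/seteqP; split => // A HA.
have [//|GnA] := in_ultra_setVsetC (f @^-1` A) GU.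
have HnA : H (~` A) by apply: fGH.
by have := filter_not_empty H; rewrite -(setICr A); case; apply: filterI.
Qed.

Lemma ultra_bounded_cvg (R : realType) (T : Type) (G : set_system T) (u : T -> R) (M : R) :
  UltraFilter G -> G [set n | `|u n| <= M] -> exists l : R, u @ G --> l.
Proof.
move=> GU GM; have := @segment_compact R (- M) M.
rewrite compact_ultra => /(_ (u @ G) (ultra_fmap u GU)) [].
  have h : [set n | `|u n| <= M] `<=` u @^-1` `[- M, M].
    by move=> n /=; rewrite in_itv /= ler_norml.
  exact: filterS h GM.
by move=> l [_ ul]; exists l.
Qed.

Fixpoint gauss_moment (R : realType) (l : nat) : R :=
  match l with
  | 0 => 1
  | 1 => 0
  | (l'.+1 as l1).+1 => l1%:R * gauss_moment R l'
  end.

Section janson.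
Variables (R : realType) (m k : nat -> nat -> R) (s : nat).
Hypotheses (mk : forall n, is_cumulant (m n) (k n))
  (mpos : forall n, moment_positive (m n))
  (k0 : forall n, k n 0%N = 0) (k1 : forall n, k n 1%N = 0) (k2 : forall n, k n 2%N = 1)
  (ks : forall j, (s <= j)%N -> k n j @[n --> \oo] --> (0 : R)).

(* Along an ultrafilter, the rescaled cumulants would converge to those of a
   positive moment sequence contradicting [marcinkiewicz]. *)
Lemma cumulants_cvg0 (j : nat) : (3 <= j)%N -> k n j @[n --> \oo] --> (0 : R).
Proof.
move=> j3; apply: contrapT => nk.
have [e e0 eN] : exists2 e : R, 0 < e & forall N, exists2 n, (N <= n)%N & e <= `|k n j|.
  apply: contrapT => h; apply: nk; apply/cvgr0Pnorm_lt => e e0.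
  apply: contrapT => h2; apply: h; exists e => // N.
  apply: contrapT => h3; apply: h2; exists N => // n /= Nn.
  by rewrite ltNge; apply/negP => h4; apply: h3; exists n.
have js : (j < s)%N.
  rewrite ltnNge; apply/negP => sj; apply: nk; exact: ks.
pose d := Num.min e (2^-1 ^+ s).
have d0 : 0 < d by rewrite lt_min e0 exprn_gt0.
(* The indices at which the cumulant of order j stays away from 0. The filter at infinity restricted
   to [E] is still proper, and all limits are taken along an ultrafilter finer than it. *)
pose E := [set n | d <= `|k n j|].
have EP : ProperFilter (within E \oo).
  split; last exact: within_filter.
  move=> [N _ NE]; have [n Nn en] := eN N.
  by apply: (NE n Nn); rewrite /E /= ge_min en.
have [a aP] : exists a : nat -> R, forall n, E n ->
    [/\ 0 < a n <= 1, forall j, (3 <= j < s)%N -> a n ^+ j * `|k n j| <= 1 &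
    exists2 j, (3 <= j < s)%N & d <= a n ^+ j * `|k n j|].
  have h n : exists b : R, E n -> [/\ 0 < b <= 1,
    forall j, (3 <= j < s)%N -> b ^+ j * `|k n j| <= 1 &
    exists2 j, (3 <= j < s)%N & d <= b ^+ j * `|k n j|].
    have [En|nE] := pselect (E n); last by exists 0.
    have j3s : (3 <= j < s)%N by rewrite j3.
    have ds : d <= 2^-1 ^+ s by rewrite ge_min lexx orbT.
    by have [b bP] := dyadic_scale j3s ds En; exists b.
  by have [a aP] := choice h; exists a.
have [G [GU GE]] := ultraFilterLemma EP.
have GP : ProperFilter G by exact: ultra_proper.
have GEE : G E by apply: GE; exists 0%N.
have Goo A : \oo A -> G A.
  by move=> [N _ NA]; apply: GE; exists N => // n Nn _; exact: NA.
have ksG l (x : R) : (s <= l)%N -> 0 < x -> G [set n | `|k n l| < x].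
  by move=> sl x0; apply: Goo; move/cvgr0Pnorm_lt: (ks sl); apply.
pose m' n l := a n ^+ l * m n l.
pose k' n l := a n ^+ l * k n l.
have mk' n : is_cumulant (m' n) (k' n) by exact: is_cumulant_scale.
have mp' n : moment_positive (m' n) by exact: moment_positive_scale.
(* Orders below s are bounded thanks to the scaling, and orders from s on still tend to 0 because a
   <= 1; so every scaled cumulant converges along the ultrafilter, and the recursion then gives
   convergence of the moments. *)
have k'b l : exists x : R, k' n l @[n --> G] --> x.
  have [ls|sl] := ltnP l s; last first.
    exists 0; apply/cvgr0Pnorm_lt => x x0.
    have h1 := ksG _ _ sl x0.
    suff : G [set n | `|k' n l| < x] by [].
    apply: (filterS2 _ _ GEE h1) => n /aP[/andP[a0 a1] _ _] h.
    rewrite /= /k' normrM (le_lt_trans _ h)// ler_piMl// ger0_norm ?exprn_ge0 ?(ltW a0)//.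
    by rewrite exprn_ile1// ltW.
  case: l ls => [|[|[|l]]] ls.
  - by exists 0; rewrite /k'; under eq_cvg do rewrite k0 mulr0; exact: cvg_cst.
  - by exists 0; rewrite /k'; under eq_cvg do rewrite k1 mulr0; exact: cvg_cst.
  - apply: (@ultra_bounded_cvg _ _ _ _ 1) => //.
    apply: filterS GEE => n /aP[/andP[a0 a1] _ _] /=.
    by rewrite /k' k2 mulr1 ger0_norm ?exprn_ile1// ?exprn_ge0// ltW.
  - apply: (@ultra_bounded_cvg _ _ _ _ 1) => //.
    apply: filterS GEE => n /aP[/andP[a0 a1] h _] /=.
    by rewrite /k' normrM ger0_norm ?exprn_ge0 ?(ltW a0)//; exact: h.
have [kl klP] := choice k'b.
have m'b l : exists x : R, m' n l @[n --> G] --> x.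
  elim/ltn_ind: l => -[_|l ih].
    exists 1; rewrite /m'; under eq_cvg do rewrite expr0 mul1r (proj1 (mk _)).
    exact: cvg_cst.
  have h i : exists x : R, (i < l.+1)%N -> m' n i @[n --> G] --> x.
    have [il|li] := ltnP i l.+1; last by exists 0.
    by have [x xP] := ih i il; exists x.
  have [ml mlP] := choice h.
  exists (\sum_(j < l.+1) 'C(l, j)%:R * kl j.+1 * ml (l - j)%N).
  under eq_cvg do rewrite (proj2 (mk' _)).
  apply: cvg_sumr => i _; apply: cvgM; first by apply: cvgMl_tmp; exact: klP.
  by apply: mlP; rewrite ltnS leq_subr.
have [ml mlP] := choice m'b.
have mkl : is_cumulant ml kl.
  split.
    apply: (cvg_uniqueR GP (mlP 0%N)).
    under eq_cvg do rewrite /m' expr0 mul1r (proj1 (mk _)).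
    exact: cvg_cst.
  move=> l; apply: (cvg_uniqueR GP (mlP l.+1)).
  under eq_cvg do rewrite (proj2 (mk' _)).
  apply: cvg_sumr => i _; apply: cvgM; last exact: mlP.
  by apply: cvgMl_tmp; exact: klP.
have mpl : moment_positive ml.
  move=> N v.
  have h1 : (\sum_(j < N) v j * m' n j) ^+ 2 @[n --> G] --> (\sum_(j < N) v j * ml j) ^+ 2.
    by under eq_cvg do rewrite expr2; rewrite expr2; apply: cvgM; apply: cvg_sumr => i _; apply: cvgMl_tmp; exact: mlP.
  have h2 : \sum_(i < N) \sum_(j < N) v i * v j * m' n (i + j)%N @[n --> G] -->
      \sum_(i < N) \sum_(j < N) v i * v j * ml (i + j)%N.
    by apply: cvg_sumr => i _; apply: cvg_sumr => l _; apply: cvgMl_tmp; exact: mlP.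
  apply: (@ler_cvg_to _ G GP _ _ _ _ _ h1 h2); apply: filterE => n; exact: mp'.
have kl0 : forall l, (3 <= l)%N -> kl l = 0.
  apply: (marcinkiewicz mkl mpl (s := s)) => l sl.
  apply: (cvg_uniqueR GP (klP l)).
  apply/cvgr0Pnorm_lt => x x0.
  have h1 := ksG _ _ sl x0.
  suff : G [set n | `|k' n l| < x] by [].
  apply: (filterS2 _ _ GEE h1) => n /aP[/andP[a0 a1] _ _] h.
  rewrite /= /k' normrM (le_lt_trans _ h)// ler_piMl// ger0_norm ?exprn_ge0 ?(ltW a0)//.
  by rewrite exprn_ile1// ltW.
(* All orders are summed because the order at which the scaled cumulant reaches [d] may depend on
   n. *)
have lim0 : \sum_(l < s | (3 <= l)%N) `|k' n l| @[n --> G] --> (0 : R).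
  have kl0s : \sum_(l < s | (3 <= l)%N) `|kl l| = 0.
    by rewrite big1// => l l3; rewrite kl0// normr0.
  rewrite -[X in _ --> X]kl0s; apply: (@cvg_sumr R nat _ G _ _ (fun l n => `|k' n (nat_of_ord l)|)) => l _.
  by apply: cvg_norm; exact: klP.
have [n [En nd]] : exists n, E n /\ `|\sum_(l < s | (3 <= l)%N) `|k' n l| | < d.
  have h1 : G [set n | `|\sum_(l < s | (3 <= l)%N) `|k' n l| | < d].
    by move/cvgr0Pnorm_lt: lim0; apply.
  by have [n [? ?]] := filter_ex (filterI GEE h1); exists n.
have [/andP[a0 a1] _ [l /andP[l3 ls] dl]] := aP n En.
move: nd; rewrite ltNge => /negP; apply.
rewrite (le_trans dl)// (le_trans _ (ler_norm _))//.
rewrite (bigD1 (Ordinal ls))//= /k' normrM (ger0_norm (exprn_ge0 _ (ltW a0))).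
by rewrite lerDl sumr_ge0.
Qed.

Lemma moments_cvg_gauss (l : nat) : m n l @[n --> \oo] --> gauss_moment R l.
Proof.
elim/ltn_ind: l => -[_|[_|l ih]].
- by under eq_cvg do rewrite (proj1 (mk _)); exact: cvg_cst.
- under eq_cvg do rewrite (proj2 (mk _)) big_ord1 k1 mulr0 mul0r.
  exact: cvg_cst.
under eq_cvg do rewrite (proj2 (mk _)).
(* The limiting cumulants vanish except the second, which is the term j = 1. *)
have -> : gauss_moment R l.+2 = \sum_(j < l.+2) 'C(l.+1, j)%:R * (j == 1 :> nat)%:R *
    gauss_moment R (l.+1 - j)%N.
  rewrite 2!big_ord_recl /= mulr0 mul0r add0r bin1 mulr1 subSS subn0 big1 ?addr0// => j _.
  by rewrite mulr0 mul0r.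
apply: cvg_sumr => j _; apply: cvgM; last first.
  by apply: ih; rewrite ltnS leq_subr.
apply: cvgMl_tmp; case: j => -[|[|j]] _ /=.
- by under eq_cvg do rewrite k1; exact: cvg_cst.
- by under eq_cvg do rewrite k2; exact: cvg_cst.
- exact: cumulants_cvg0.
Qed.
End janson.

(** * The method of moments *)

(** The Taylor polynomial at 0 of x |-> cos(x + f). Differentiating a cosine adds pi / 2 to its
    phase, so the family is closed under derivatives and the error bound goes by induction on the
    degree. *)
Definition cos_taylor (R : realType) (N : nat) (f x : R) : R :=
  \sum_(k < N) cos (f + k%:R * (pi / 2)) * x ^+ k / k`!%:R.

Lemma is_derive_cos_taylor (R : realType) (N : nat) (f x : R) :
  is_derive x 1 (cos_taylor N.+1 f) (cos_taylor N (f + pi / 2) x).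
Proof.
pose p : {poly R} := \poly_(k < N.+1) (cos (f + k%:R * (pi / 2)) / k`!%:R).
have -> : cos_taylor N.+1 f = horner p.
  apply/funext => y; rewrite /cos_taylor /p horner_poly; apply: eq_bigr => k _; ring.
have -> : cos_taylor N (f + pi / 2) x = p^`().[x]; last exact: is_derive_poly.
have -> : p^`() = \poly_(k < N) (cos (f + pi / 2 + k%:R * (pi / 2)) / k`!%:R).
  apply/polyP => k; rewrite coef_deriv !coef_poly ltnS; case: ifP => // _; last by rewrite mul0rn.
  rewrite -[LHS]mulr_natr factS natrM invfM.
  have k0 : k.+1%:R != 0 :> R by rewrite pnatr_eq0.
  have -> : f + k.+1%:R * (pi / 2) = f + pi / 2 + k%:R * (pi / 2) by rewrite -natr1; ring.
  by field; rewrite fact_neq0 nat1r k0.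
by rewrite horner_poly /cos_taylor; apply: eq_bigr => k _; ring.
Qed.

Lemma cos_taylor_ge0 (R : realType) (N : nat) (f x : R) : 0 <= x ->
  `|cos (x + f) - cos_taylor N f x| <= x ^+ N / N`!%:R.
Proof.
elim: N f x => [|N ih] f x x0.
  by rewrite /cos_taylor big_ord0 subr0 fact0 expr0 invr1 mulr1 ler_norml cos_geN1 cos_le1.
pose D y := cos (y + f) - cos_taylor N.+1 f y.
pose M y : R := y ^+ N.+1 / N.+1`!%:R.
have D0 : D 0 = 0.
  rewrite /D /cos_taylor big_ord_recl /= fact0 expr0 invr1 !mulr1 mul0r addr0 add0r.
  by rewrite big1 ?addr0 ?subrr// => i _; rewrite expr0n /= mulr0 mul0r.
have M0 : M 0 = 0 by rewrite /M expr0n mul0r.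
have dD (y : R) : is_derive y (1 : R) D (cos (y + (f + pi / 2)) - cos_taylor N (f + pi / 2) y).
  have h1 : is_derive y 1 (fun z => cos (z + f)) (cos (y + (f + pi / 2))).
    have -> : cos (y + (f + pi / 2)) = - sin (y + f) * 1 by rewrite addrA cosDpihalf mulr1.
    have hs : is_derive y 1 (fun z : R => z + f) 1.
      by apply: is_derive_eq; rewrite addr0.
    exact: (@is_derive1_comp _ cos (fun z => z + f) _ _ _ (is_derive_cos _) hs).
  exact: (is_deriveB h1 (is_derive_cos_taylor N f y)).
have dM (y : R) : is_derive y (1 : R) M (y ^+ N / N`!%:R).
  pose p : {poly R} := (N.+1`!%:R)^-1 *: 'X^(N.+1).
  have -> : M = horner p by apply/funext => z; rewrite /M /p hornerZ hornerXn mulrC.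
  have -> : y ^+ N / N`!%:R = p^`().[y]; last exact: is_derive_poly.
  rewrite /p derivZ derivXn hornerZ hornerMn hornerXn /= factS natrM invfM -[_ *+ N.+1]mulr_natr.
  have k0 : N.+1%:R != 0 :> R by rewrite pnatr_eq0.
  by field; rewrite fact_neq0 nat1r k0.
(* Used with s = 1 and s = -1: [M] dominates both D and -D because all vanish at 0 and M' dominates
   |D'| by induction. *)
have mono (s : R) : `|s| <= 1 -> s * D x <= M x.
  move=> s1; rewrite -subr_ge0.
  have h (y : R) : is_derive y (1 : R) (fun z => M z - s * D z)
      (y ^+ N / N`!%:R - s * (cos (y + (f + pi / 2)) - cos_taylor N (f + pi / 2) y)).
    by apply: is_deriveB; exact: is_deriveZ.
  have [c /andP[c0 cx]] := mean_value_eq x0 h.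
  rewrite D0 M0 mulr0 !subr0 => ->; apply: mulr_ge0 => //; rewrite subr_ge0.
  apply: (le_trans (ler_norm _)); rewrite normrM; apply: (le_trans _ (ih (f + pi / 2) _ c0)).
  by rewrite ler_piMl.
rewrite -/(D x) -/(M x) ler_norml; apply/andP; split.
  by rewrite lerNl -mulN1r; apply: mono; rewrite normrN1.
by rewrite -[D x]mul1r; apply: mono; rewrite normr1.
Qed.

Lemma cos_taylor_le (R : realType) (N : nat) (f x : R) :
  `|cos (x + f) - cos_taylor N f x| <= `|x| ^+ N / N`!%:R.
Proof.
have [x0|/ltW x0] := leP 0 x; first by rewrite (ger0_norm x0); exact: cos_taylor_ge0.
rewrite (ler0_norm x0).
have -> : cos (x + f) = cos (- x - f) by rewrite -opprD cosN.
suff -> : cos_taylor N f x = cos_taylor N (- f) (- x).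
  by apply: cos_taylor_ge0; rewrite oppr_ge0.
rewrite /cos_taylor; apply: eq_bigr => k _; congr (_ / _).
have e : cos (f + k%:R * (pi / 2)) = (-1) ^+ k * cos (- f + k%:R * (pi / 2)).
  have -> : f + k%:R * (pi / 2) = - (- f + k%:R * (pi / 2)) + pi *+ k.
    by rewrite -[pi *+ k]mulr_natl; field.
  by rewrite (alternatingn (@cosDpi R)) cosN.
by rewrite e [(- x) ^+ k]exprNn -mulrA mulrCA.
Qed.

Definition poly_bounded (R : realType) (h : R -> R) : Prop :=
  measurable_fun setT h /\ exists C N, forall x, `|h x| <= C * (1 + x ^+ 2) ^+ N.

(** The Gaussian integral and the law of any bounded variable are both instances, so the method of
    moments can be carried out for positive normalised linear functionals. *)
Record is_expectation (R : realType) (E : (R -> R) -> R) : Prop := {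
  expectation_lin : forall a f g, poly_bounded f -> poly_bounded g ->
    E (fun x => a * f x + g x) = a * E f + E g;
  expectation_ge0 : forall f, poly_bounded f -> (forall x, 0 <= f x) -> 0 <= E f;
  expectation_one : E (fun=> 1) = 1 }.

Section poly_bounded.
Variable R : realType.
Implicit Types f g : R -> R.

Lemma poly_bounded_cst (c : R) : poly_bounded (fun=> c).
Proof.
split; first exact: measurable_cst.
by exists `|c|, 0%N => x; rewrite expr0 mulr1.
Qed.

Lemma poly_boundedD f g : poly_bounded f -> poly_bounded g ->
  poly_bounded (fun x => f x + g x).
Proof.
move=> [mf [C [N fC]]] [mg [D [M gD]]]; split; first exact: measurable_funD.
exists (`|C| + `|D|), (N + M)%N => x.
have x1 : 1 <= 1 + x ^+ 2 by rewrite lerDl sqr_ge0.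
rewrite (le_trans (ler_normD _ _))// mulrDl lerD//.
  rewrite (le_trans (fC x))// (le_trans (ler_norm _))// normrM ler_wpM2l//.
  by rewrite ger0_norm ?exprn_ge0 ?(le_trans ler01)// ler_weXn2l// leq_addr.
rewrite (le_trans (gD x))// (le_trans (ler_norm _))// normrM ler_wpM2l//.
by rewrite ger0_norm ?exprn_ge0 ?(le_trans ler01)// ler_weXn2l// leq_addl.
Qed.

Lemma poly_boundedM f g : poly_bounded f -> poly_bounded g ->
  poly_bounded (fun x => f x * g x).
Proof.
move=> [mf [C [N fC]]] [mg [D [M gD]]]; split; first exact: measurable_funM.
exists (C * D), (N + M)%N => x.
by rewrite normrM exprD mulrACA ler_pM.
Qed.

Lemma poly_bounded_id : poly_bounded (fun x : R => x).
Proof.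
split; first exact: measurable_id.
exists 1, 1%N => x; rewrite mul1r expr1.
rewrite -(@ler_pXn2r _ 2)// ?nnegrE ?addr_ge0 ?sqr_ge0// real_normK ?num_real//.
have := sqr_ge0 x; have := sqr_ge0 (x ^+ 2); move: (x ^+ 2) => y; nra.
Qed.

Lemma poly_boundedX f n : poly_bounded f -> poly_bounded (fun x => f x ^+ n).
Proof.
move=> pf; elim: n => [|n ih].
  by under eq_fun do rewrite expr0; exact: poly_bounded_cst.
by under eq_fun do rewrite exprS; exact: poly_boundedM.
Qed.

Lemma poly_bounded_sum n (f : nat -> R -> R) : (forall i, poly_bounded (f i)) ->
  poly_bounded (fun x => \sum_(i < n) f i x).
Proof.
move=> pf; elim: n => [|n ih].
  by under eq_fun do rewrite big_ord0; exact: poly_bounded_cst.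
by under eq_fun do rewrite big_ord_recr; exact: poly_boundedD.
Qed.

Lemma poly_bounded_cos (t f : R) : poly_bounded (fun x => cos (t * x + f)).
Proof.
split; last by exists 1, 0%N => x; rewrite expr0 mulr1 ler_norml cos_geN1 cos_le1.
apply: (measurableT_comp (f := @cos R)).
  by apply: continuous_measurable_fun; exact: continuous_cos.
by apply: measurable_funD => //; exact: measurable_funM.
Qed.

Lemma poly_bounded_le_ind (a : R) : poly_bounded (fun x => (x <= a)%R%:R).
Proof.
split; last by exists 1, 0%N => x; rewrite expr0 mulr1; case: (x <= a); rewrite ?normr1 ?normr0.
have -> : (fun x => (x <= a)%R%:R) = \1_(`]-oo, a]) :> (R -> R).
  by apply/funext => x; rewrite indicE mem_setE in_itv.
by apply: measurable_indic.
Qed.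

End poly_bounded.

Section expectation_theory.
Variables (R : realType) (E : (R -> R) -> R).
Hypothesis EE : is_expectation E.

Lemma expectationD f g : poly_bounded f -> poly_bounded g ->
  E (fun x => f x + g x) = E f + E g.
Proof.
move=> pf pg; rewrite -[E f]mul1r -(expectation_lin EE 1 pf pg).
by congr E; apply/funext => x; rewrite mul1r.
Qed.

Lemma expectationZ a f : poly_bounded f -> E (fun x => a * f x) = a * E f.
Proof.
move=> pf; have p0 := poly_bounded_cst (0 : R).
have E0 : E (fun=> 0) = 0.
  have /eqP := expectationD p0 p0; rewrite (_ : (fun x : R => 0 + 0) = fun=> 0).
    by rewrite -subr_eq subrr eq_sym => /eqP.
  by apply/funext => x; rewrite addr0.
rewrite -[RHS]addr0 -[X in _ = _ + X]E0 -(expectation_lin EE a pf p0).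
by congr E; apply/funext => x; rewrite addr0.
Qed.

Lemma expectation_cst a : E (fun=> a) = a.
Proof.
have := expectationZ a (poly_bounded_cst (1 : R)).
by rewrite (expectation_one EE) mulr1.
Qed.

Lemma expectation_le f g : poly_bounded f -> poly_bounded g ->
  (forall x, f x <= g x) -> E f <= E g.
Proof.
move=> pf pg fg; rewrite -subr_ge0 addrC -mulN1r -(expectation_lin EE _ pf pg).
apply: (expectation_ge0 EE) => [|x]; last by rewrite mulN1r addrC subr_ge0.
by apply: poly_boundedD => //; apply: poly_boundedM => //; exact: poly_bounded_cst.
Qed.

Lemma expectation_sum n (f : nat -> R -> R) : (forall i, poly_bounded (f i)) ->
  E (fun x => \sum_(i < n) f i x) = \sum_(i < n) E (f i).
Proof.
move=> pf; elim: n => [|n ih].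
  by under eq_fun do rewrite big_ord0; rewrite expectation_cst big_ord0.
rewrite big_ord_recr /= -ih -expectationD//; last exact: poly_bounded_sum.
by congr E; apply/funext => x; rewrite big_ord_recr.
Qed.

Definition cos_moment_sum (N : nat) (t f : R) (m : nat -> R) : R :=
  \sum_(k < N) cos (f + k%:R * (pi / 2)) * t ^+ k / k`!%:R * m k.

(** The Taylor order is even so that the remainder |t x|^(2M) is a multiple of a moment. *)
Lemma expectation_cos_le (M : nat) (t f : R) :
  `|E (fun x => cos (t * x + f)) - cos_moment_sum M.*2 t f (fun k => E (fun x => x ^+ k))| <=
  t ^+ M.*2 / (M.*2)`!%:R * E (fun x => x ^+ M.*2).
Proof.
have pX k : poly_bounded (fun x : R => x ^+ k).
  by apply: poly_boundedX; exact: poly_bounded_id.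
have -> : cos_moment_sum M.*2 t f (fun k => E (fun x => x ^+ k)) =
    E (fun x => cos_taylor M.*2 f (t * x)).
  transitivity (E (fun x => \sum_(k < M.*2) (cos (f + k%:R * (pi / 2)) * t ^+ k / k`!%:R) * x ^+ k)).
    rewrite (@expectation_sum _ (fun k x => cos (f + k%:R * (pi / 2)) * t ^+ k / k`!%:R * x ^+ k)).
      by apply: eq_bigr => k _; rewrite expectationZ.
    by move=> i; apply: poly_boundedM => //; exact: poly_bounded_cst.
  by congr E; apply/funext => x; apply: eq_bigr => k _; rewrite exprMn; ring.
have pT : poly_bounded (fun x => cos_taylor M.*2 f (t * x)).
  apply: (@poly_bounded_sum R _ (fun k x => cos (f + k%:R * (pi / 2)) * (t * x) ^+ k / k`!%:R)) => i.
  apply: poly_boundedM; last exact: poly_bounded_cst.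
  apply: poly_boundedM; first exact: poly_bounded_cst.
  apply: poly_boundedX; apply: poly_boundedM; first exact: poly_bounded_cst.
  exact: poly_bounded_id.
have pC := poly_bounded_cos t f.
have pB : poly_bounded (fun x => t ^+ M.*2 / (M.*2)`!%:R * x ^+ M.*2).
  by apply: poly_boundedM => //; exact: poly_bounded_cst.
have key x : `|cos (t * x + f) - cos_taylor M.*2 f (t * x)| <= t ^+ M.*2 / (M.*2)`!%:R * x ^+ M.*2.
  rewrite (le_trans (cos_taylor_le _ _ _))// -mul2n exprM real_normK ?num_real// -exprM exprMn.
  by rewrite mulrAC.
have h1 := expectation_le pC (poly_boundedD pT pB).
have h2 := expectation_le pT (poly_boundedD pC pB).
rewrite !expectationD// expectationZ// in h1 h2.
have {}h1 := h1 (fun x => ltac:(move: (key x); rewrite ler_norml; lra)).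
have {}h2 := h2 (fun x => ltac:(move: (key x); rewrite ler_norml; lra)).
by rewrite ler_norml; lra.
Qed.

End expectation_theory.

(** The phase makes sines and constants instances of the generator, and the product formula for
    cosines makes the class an algebra. *)
Inductive trig_poly (R : realType) : (R -> R) -> Prop :=
| trig_poly_cos a t f : trig_poly (fun x => a * cos (t * x + f))
| trig_polyD g h : trig_poly g -> trig_poly h -> trig_poly (fun x => g x + h x).

Section trig_poly.
Variable R : realType.
Implicit Types g h : R -> R.

Lemma trig_polyM g h : trig_poly g -> trig_poly h -> trig_poly (fun x => g x * h x).
Proof.
elim=> [a t f|g1 g2 _ ih1 _ ih2] tr; last first.
  by under eq_fun do rewrite mulrDl; apply: trig_polyD; [exact: ih1|exact: ih2].
elim: tr => [b s e|h1 h2 _ ih1 _ ih2]; last first.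
  by under eq_fun do rewrite mulrDr; exact: trig_polyD.
have -> : (fun x => a * cos (t * x + f) * (b * cos (s * x + e))) =
   (fun x => (a * b / 2) * cos ((t + s) * x + (f + e)) + (a * b / 2) * cos ((t - s) * x + (f - e))).
  apply/funext => x.
  have -> : (t + s) * x + (f + e) = (t * x + f) + (s * x + e) by ring.
  have -> : (t - s) * x + (f - e) = (t * x + f) - (s * x + e) by ring.
  by move: (t * x + f) (s * x + e) => u v; rewrite cosB cosD; field.
by apply: trig_polyD; exact: trig_poly_cos.
Qed.

Lemma trig_poly_cst (a : R) : trig_poly (fun=> a).
Proof.
have -> : (fun=> a) = fun x : R => a * cos (0 * x + 0).
  by apply/funext => x; rewrite mul0r addr0 cos0 mulr1.
exact: trig_poly_cos.
Qed.

Lemma trig_polyX g n : trig_poly g -> trig_poly (fun x => g x ^+ n).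
Proof.
move=> tg; elim: n => [|n ih].
  by under eq_fun do rewrite expr0; exact: trig_poly_cst.
by under eq_fun do rewrite exprS; exact: trig_polyM.
Qed.

Lemma poly_bounded_trig g : trig_poly g -> poly_bounded g.
Proof.
elim=> [a t f|g1 g2 _ h1 _ h2]; last exact: poly_boundedD.
by apply: poly_boundedM; [exact: poly_bounded_cst|exact: poly_bounded_cos].
Qed.

(* [(1 - u ^ n) ^ (2 ^ n)] is close to 1 for u < 1/2 and to 0 for u > 1/2. *)
Lemma step_approx (eta e : R) : 0 < eta < 1 -> 0 < e ->
  exists n, (forall u, 0 <= u <= (1 - eta) / 2 -> 1 - e <= (1 - u ^+ n) ^+ (2 ^ n)) /\
    (forall u, (1 + eta) / 2 <= u <= 1 -> (1 - u ^+ n) ^+ (2 ^ n) <= e).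
Proof.
move=> /andP[eta0 eta1] e0.
have c1 : (1 - eta) ^+ n @[n --> \oo] --> 0.
  by apply: cvg_expr; rewrite ger0_norm; lra.
have c2 : (1 + eta)^-1 ^+ n @[n --> \oo] --> 0.
  apply: cvg_expr; rewrite ger0_norm ?invr_ge0; last by lra.
  by rewrite invf_lt1; lra.
move/cvgr0Pnorm_le : c1 => /(_ _ e0) c1.
move/cvgr0Pnorm_le : c2 => /(_ _ e0) c2.
have [n [c1n c2n]] := filter_ex (filterI c1 c2).
exists n; split => u /andP[u0 u1].
  have u2 : 0 <= u ^+ n <= 1.
    by rewrite exprn_ge0//= exprn_ile1//; lra.
  have bern (y : R) m : 0 <= y <= 1 -> 1 - m%:R * y <= (1 - y) ^+ m.
    move=> /andP[y0 y1]; elim: m => [|m ih]; first by rewrite mul0r subr0 expr0.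
    rewrite exprS (@le_trans _ _ ((1 - y) * (1 - m%:R * y)))//.
      rewrite -natr1; have : 0 <= m%:R :> R by []. nra.
    by rewrite ler_wpM2l// subr_ge0.
  apply: le_trans (bern _ (2 ^ n)%N u2); rewrite lerD2l lerN2 natrX -exprMn.
  apply: le_trans c1n; rewrite (le_trans _ (ler_norm _))//.
  by rewrite lerXn2r// ?nnegrE; lra.
have u0' : 0 < u by lra.
have un0 : 0 < u ^+ n by rewrite exprn_gt0.
have u2 : 0 <= u ^+ n <= 1 by rewrite ltW//= exprn_ile1// ltW.
(* By Bernoulli, m y (1 - y)^m <= (1 + y)^m (1 - y)^m <= 1. With y = u^n and m = 2^n this bounds (1
   - y)^m by (2u)^-n. *)
have bern (y : R) m : 0 <= y <= 1 -> m%:R * y * (1 - y) ^+ m <= 1.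
  move=> /andP[y0 y1].
  have h : m%:R * y <= (1 + y) ^+ m.
    have : 1 + m%:R * y <= (1 + y) ^+ m.
      elim: m => [|m ih]; first by rewrite mul0r addr0 expr0.
      rewrite exprS (@le_trans _ _ ((1 + y) * (1 + m%:R * y)))//.
        rewrite -natr1; have : 0 <= m%:R :> R by []. nra.
      by rewrite ler_wpM2l// addr_ge0.
    lra.
  rewrite (@le_trans _ _ ((1 + y) ^+ m * (1 - y) ^+ m))//.
    by rewrite ler_wpM2r// exprn_ge0// subr_ge0.
  rewrite -exprMn exprn_ile1//; nra.
have := bern _ (2 ^ n)%N u2; rewrite natrX -exprMn => h.
have p0 : 0 < (1 + eta) ^+ n by rewrite exprn_gt0//; lra.
have h2 : (1 + eta) ^+ n <= (2 * u) ^+ n by rewrite lerXn2r// ?nnegrE; lra.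
have h3 : (1 + eta)^-1 ^+ n <= e by rewrite (le_trans (ler_norm _)).
apply: le_trans h3; rewrite exprVn -[leRHS]mul1r ler_pdivlMr// mulrC.
apply: le_trans h; rewrite ler_wpM2r// exprn_ge0// subr_ge0.
by case/andP: u2.
Qed.

(** [step_approx] is applied to u = (1 + sin((x - x0) / A)) / 2. For |x - x0| <= A the sine is
    monotone, so the step is accurate outside |x - x0| < d; farther out periodicity spoils it, but
    there the quadratic term exceeds 1. *)
Lemma trig_step (x0 d e : R) : 0 < d -> 0 < e < 1 ->
  exists h, [/\ trig_poly h,
    forall x, (x <= x0 - d)%R%:R <= h x + e * (1 + (x - x0) ^+ 2) &
    forall x, h x <= (x <= x0 + d)%R%:R + e * (1 + (x - x0) ^+ 2)].
Proof.
move=> d0 /andP[e0 e1].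
(* From e A >= 1 the quadratic term takes over at distance A, and d / A < 1 keeps [eta] strictly
   below sin(pi / 2). *)
pose A := 1 + e^-1 + d.
have A1 : 1 <= A by rewrite /A -addrA lerDl addr_ge0 ?invr_ge0 ?ltW.
have A0 : 0 < A by rewrite (lt_le_trans ltr01).
have pi2 := @pihalf_ge1 R.
have dA1 : d / A < 1 by rewrite ltr_pdivrMr// mul1r /A ltrDr ltr_pwDl// invr_ge0 ltW.
have dA0 : 0 < d / A by rewrite divr_gt0.
pose eta := sin (d / A).
have eta01 : 0 < eta < 1.
  apply/andP; split; first by apply: sin_gt0_pi; apply/andP; split; lra.
  by rewrite -(@sin_pihalf R) ltr_sin ?in_itv /=; [|apply/andP; split|apply/andP; split]; lra.
have [n [lo hi]] := step_approx eta01 e0.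
pose u x := 2^-1 + 2^-1 * cos (A^-1 * x + (- (A^-1 * x0) - pi / 2)).
have uE x : u x = (1 + sin ((x - x0) / A)) / 2.
  rewrite /u (_ : A^-1 * x + _ = (x - x0) / A - pi / 2); last by ring.
  by rewrite -cosN opprB cosB cos_pihalf sin_pihalf mul0r add0r mul1r; ring.
have u01 x : 0 <= u x <= 1.
  rewrite uE; have := sin_le1 ((x - x0) / A); have := sin_geN1 ((x - x0) / A).
  by move=> ? ?; apply/andP; split; lra.
exists (fun x => (1 - u x ^+ n) ^+ (2 ^ n)).
have h0 x : 0 <= (1 - u x ^+ n) ^+ (2 ^ n).
  by case/andP: (u01 x) => ? ?; rewrite exprn_ge0// subr_ge0 exprn_ile1.
have h1 x : (1 - u x ^+ n) ^+ (2 ^ n) <= 1.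
  case/andP: (u01 x) => ? ?; rewrite exprn_ile1// ?subr_ge0 ?exprn_ile1//.
  by rewrite gerBl exprn_ge0.
have far x : A <= `|x - x0| -> 1 <= e * (1 + (x - x0) ^+ 2).
  move=> Ax; rewrite -[X in _ + X]real_normK ?num_real//.
  have eA : 1 <= e * A.
    have -> : e * A = 1 + e * (1 + d) by rewrite /A; field; rewrite gt_eqF.
    by rewrite lerDl mulr_ge0 ?(ltW e0)// addr_ge0 ?(ltW d0).
  apply: (le_trans eA); rewrite ler_pM2l//.
  by rewrite (le_trans Ax)//; move: (`|_|) (normr_ge0 (x - x0)) => y y0; nra.
have e2 x : e <= e * (1 + (x - x0) ^+ 2) by rewrite ler_peMr ?(ltW e0)// lerDl sqr_ge0.
have e20 x : 0 <= e * (1 + (x - x0) ^+ 2) by rewrite (le_trans (ltW e0)).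
split.
- have tu : trig_poly u by apply: trig_polyD; [exact: trig_poly_cst|exact: trig_poly_cos].
  apply: (@trig_polyX (fun x => 1 - u x ^+ n)).
  apply: trig_polyD; first exact: trig_poly_cst.
  have -> : (fun x => - u x ^+ n) = fun x => (-1) * u x ^+ n by apply/funext => x; rewrite mulN1r.
  by apply: trig_polyM; [exact: trig_poly_cst|exact: trig_polyX].
- move=> x; case: (leP x (x0 - d)) => [xd|_]; last by rewrite addr_ge0.
  have -> : true%:R = 1 :> R by [].
  have [/far fx|xA] := leP A `|x - x0|; first by rewrite (le_trans fx)// lerDr.
  suff : 1 - e <= (1 - u x ^+ n) ^+ (2 ^ n).
    by rewrite lerBlDr => /le_trans; apply; rewrite lerD2l.
  apply: lo; case/andP: (u01 x) => -> _ /=; rewrite uE.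
  move: xA; rewrite ltr_norml => /andP[xA1 xA2].
  have y1 : -1 <= (x - x0) / A by rewrite ler_pdivlMr// mulN1r ltW.
  have y2 : (x - x0) / A <= - (d / A) by rewrite -mulNr ler_pM2r ?invr_gt0//; lra.
  have : sin ((x - x0) / A) <= sin (- (d / A)).
    rewrite leNgt ltr_sin ?in_itv /= -?leNgt//; apply/andP; split; lra.
  by rewrite sinN -/eta; lra.
- move=> x; case: (leP x (x0 + d)) => [_|xd]; first by rewrite (le_trans (h1 x))// lerDl.
  rewrite add0r; have [/far|xA] := leP A `|x - x0|; first exact: le_trans.
  apply: le_trans (e2 x); apply: hi; case/andP: (u01 x) => _ ->; rewrite andbT uE.
  move: xA; rewrite ltr_norml => /andP[xA1 xA2].
  have y1 : (x - x0) / A <= 1 by rewrite ler_pdivrMr// mul1r ltW.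
  have y2 : d / A <= (x - x0) / A by rewrite ler_pM2r ?invr_gt0//; lra.
  have : sin (d / A) <= sin ((x - x0) / A).
    rewrite leNgt ltr_sin ?in_itv /= -?leNgt//; apply/andP; split; lra.
  by rewrite -/eta; lra.
Qed.

End trig_poly.

Section moment_method.
Variables (R : realType) (En : nat -> (R -> R) -> R) (E : (R -> R) -> R).
Hypotheses (EnE : forall n, is_expectation (En n)) (EE : is_expectation E).
Hypothesis moments_cvg : forall k,
  En n (fun x => x ^+ k) @[n --> \oo] --> E (fun x => x ^+ k).
Hypothesis moments_small : forall t : R,
  t ^+ M.*2 / (M.*2)`!%:R * E (fun x => x ^+ M.*2) @[M --> \oo] --> (0 : R).

Lemma cos_expectation_cvg (t f : R) :
  En n (fun x => cos (t * x + f)) @[n --> \oo] --> E (fun x => cos (t * x + f)).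
Proof.
apply/cvgrPdist_le => /= e e0.
have e4 : 0 < e / 4 by rewrite divr_gt0.
have [M rM] : exists M, `|t ^+ M.*2 / (M.*2)`!%:R * E (fun x => x ^+ M.*2)| <= e / 4.
  by move/cvgr0Pnorm_le : (moments_small t) => /(_ _ e4) /filter_ex.
pose r := t ^+ M.*2 / (M.*2)`!%:R * E (fun x => x ^+ M.*2).
have c1 : cos_moment_sum M.*2 t f (fun k => En n (fun x => x ^+ k)) @[n --> \oo] -->
    cos_moment_sum M.*2 t f (fun k => E (fun x => x ^+ k)).
  by apply: cvg_sumr => k _; apply: cvgMl_tmp; exact: moments_cvg.
have c2 : t ^+ M.*2 / (M.*2)`!%:R * En n (fun x => x ^+ M.*2) @[n --> \oo] --> r.
  by apply: cvgMl_tmp; exact: moments_cvg.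
move/cvgrPdist_le : c1 => /(_ _ e4) c1.
move/cvgrPdist_le : c2 => /(_ _ e4) c2.
near=> n.
have h1 := expectation_cos_le EE M t f.
have h2 := expectation_cos_le (EnE n) M t f.
have h3 : `|cos_moment_sum M.*2 t f (fun k => E (fun x => x ^+ k)) -
  cos_moment_sum M.*2 t f (fun k => En n (fun x => x ^+ k))| <= e / 4 by near: n.
have h4 : `|r - t ^+ M.*2 / (M.*2)`!%:R * En n (fun x => x ^+ M.*2)| <= e / 4 by near: n.
move: h1 h2 h3 h4 rM; rewrite -/r !ler_norml.
move: (cos_moment_sum _ _ _ _) (cos_moment_sum _ _ _ _) (E _) (En n _) (_ * En n _) => a b c d g.
by move=> /andP[? ?] /andP[? ?] /andP[? ?] /andP[? ?] /andP[? ?]; apply/andP; split; lra.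
Unshelve. all: by end_near.
Qed.

Lemma trig_expectation_cvg h : trig_poly h -> En n h @[n --> \oo] --> E h.
Proof.
elim=> [a t f|g1 g2 t1 h1 t2 h2].
  rewrite expectationZ//; last exact: poly_bounded_cos.
  have -> : (fun n => En n (fun x => a * cos (t * x + f))) =
      fun n => a * En n (fun x => cos (t * x + f)).
    by apply/funext => n; rewrite (expectationZ (EnE n))//; exact: poly_bounded_cos.
  by apply: cvgMl_tmp; exact: cos_expectation_cvg.
rewrite expectationD//; [|exact: poly_bounded_trig..].
have -> : (fun n => En n (fun x => g1 x + g2 x)) = fun n => En n g1 + En n g2.
  by apply/funext => n; rewrite (expectationD (EnE n))//; exact: poly_bounded_trig.
exact: cvgD.
Qed.

(** Up to a multiple of the quadratic [G], the indicator of y <= x lies above a trigonometric step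
    at x - s and below one at x + s. The expectations of the steps converge, that of [G] is governed
    by the second moment, and continuity at x closes the gap. *)
Lemma moments_cvg_cdf (x : R) :
  {for x, continuous (fun t => E (fun y => (y <= t)%R%:R))} ->
  En n (fun y => (y <= x)%R%:R) @[n --> \oo] --> E (fun y => (y <= x)%R%:R).
Proof.
pose F t := E (fun y => (y <= t)%R%:R).
move=> Fx; apply/cvgrPdist_le => /= e e0.
pose G (y : R) := 1 + 2 * (`|x| + 1) ^+ 2 + 2 * y ^+ 2.
have pG : poly_bounded G.
  apply: poly_boundedD; first exact: poly_bounded_cst.
  apply: poly_boundedM; first exact: poly_bounded_cst.
  by apply: poly_boundedX; exact: poly_bounded_id.
pose K := E G.
have EG E' : is_expectation E' -> E' G = 1 + 2 * (`|x| + 1) ^+ 2 + 2 * E' (fun y => y ^+ 2).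
  move=> EE'; have p2 : poly_bounded (fun y : R => y ^+ 2).
    by apply: poly_boundedX; exact: poly_bounded_id.
  rewrite /G expectationD//.
  - by rewrite expectationZ// expectation_cst.
  - exact: poly_bounded_cst.
  - by apply: poly_boundedM => //; exact: poly_bounded_cst.
have K1 : 1 <= K.
  rewrite -(expectation_cst EE 1); apply: expectation_le => // [|y].
    exact: poly_bounded_cst.
  by rewrite /G; have := sqr_ge0 y; have := sqr_ge0 (`|x| + 1); lra.
have GK : \forall n \near \oo, En n G <= K + 1.
  have c : En n G @[n --> \oo] --> K.
    have -> : (fun n => En n G) = fun n => 1 + 2 * (`|x| + 1) ^+ 2 + 2 * En n (fun y => y ^+ 2).
      by apply/funext => n; rewrite EG.
    rewrite /K EG//.
    by apply: cvgD; [exact: cvg_cst|apply: cvgMl_tmp; exact: moments_cvg].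
  move/cvgrPdist_le : c => /(_ _ ltr01); apply: filterS => n.
  by rewrite ler_norml; lra.
(* Each side loses c for the convergence of the step, c for the continuity of [F], and c (K + 1) + c
   K for the quadratic terms: less than e in total. *)
pose c := e / (2 * K + 4).
have K4 : 0 < 2 * K + 4 by lra.
have c0 : 0 < c by rewrite divr_gt0.
pose c' := Num.min c 2^-1.
have c'0 : 0 < c' by rewrite lt_min c0 invr_gt0 ltr0n.
have c'1 : c' < 1 by rewrite gt_min; apply/orP; right; lra.
have c'c : c' <= c by rewrite ge_min lexx.
move/cvgrPdist_le : Fx => /(_ _ c0) [d /= d0 dP].
pose s := Num.min (d / 4) (2^-1).
have s0 : 0 < s by rewrite lt_min divr_gt0// invr_gt0 ltr0n.
have s1 : s <= 2^-1 by rewrite ge_min lexx orbT.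
have sd : s <= d / 4 by rewrite ge_min lexx.
have near_x z : `|z - x| <= 2 * s -> `|F x - F z| <= c.
  by move=> zx; apply: dP; rewrite /= distrC (le_lt_trans zx)//; lra.
have GE x0 y : `|x0 - x| <= 1 -> 1 + (y - x0) ^+ 2 <= G y.
  move=> x01; rewrite /G -addrA lerD2l.
  have a1 : `|x0| <= `|x| + 1.
    by rewrite -(subrK x x0) (le_trans (ler_normD _ _))// addrC lerD2l.
  have a2 : x0 ^+ 2 <= (`|x| + 1) ^+ 2.
    by rewrite -[leLHS]real_normK ?num_real// lerXn2r// nnegrE// addr_ge0.
  have := sqr_ge0 (y + x0); nra.
have ple z : poly_bounded (fun y : R => (y <= z)%R%:R) by exact: poly_bounded_le_ind.
have pcG : poly_bounded (fun y => c' * G y).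
  by apply: poly_boundedM => //; exact: poly_bounded_cst.
have [hu [tu lou hiu]] := @trig_step R (x + s) s c' s0 ltac:(by rewrite c'0).
have [hl [tl lol hil]] := @trig_step R (x - s) s c' s0 ltac:(by rewrite c'0).
have x0u : `|x + s - x| <= 1 by rewrite addrAC subrr add0r ger0_norm; lra.
have x0l : `|x - s - x| <= 1 by rewrite addrAC subrr add0r normrN ger0_norm; lra.
have upn n : En n (fun y => (y <= x)%R%:R) <= En n hu + c' * En n G.
  rewrite -(expectationZ (EnE n))// -(expectationD (EnE n))//; last exact: poly_bounded_trig.
  apply: (expectation_le (EnE n)) => //.
    by apply: poly_boundedD => //; exact: poly_bounded_trig.
  move=> y; have := lou y; rewrite addrK => /le_trans; apply.
  by rewrite lerD2l ler_pM2l// GE.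
have up : E hu <= F (x + s + s) + c' * K.
  rewrite -expectationZ// -expectationD//.
  apply: expectation_le => //; [exact: poly_bounded_trig|exact: poly_boundedD|].
  by move=> y; apply: (le_trans (hiu y)); rewrite lerD2l ler_pM2l// GE.
have lon n : En n hl <= En n (fun y => (y <= x)%R%:R) + c' * En n G.
  rewrite -(expectationZ (EnE n))// -(expectationD (EnE n))//.
  apply: (expectation_le (EnE n)) => //; [exact: poly_bounded_trig|exact: poly_boundedD|].
  move=> y; have := hil y; rewrite subrK => /le_trans; apply.
  by rewrite lerD2l ler_pM2l// GE.
have lo : F (x - s - s) <= E hl + c' * K.
  rewrite -expectationZ// -expectationD//; last exact: poly_bounded_trig.
  apply: expectation_le => //.
    by apply: poly_boundedD => //; exact: poly_bounded_trig.
  by move=> y; apply: (le_trans (lol y)); rewrite lerD2l ler_pM2l// GE.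
move/cvgrPdist_le : (trig_expectation_cvg tu) => /(_ _ c0) cu.
move/cvgrPdist_le : (trig_expectation_cvg tl) => /(_ _ c0) cl.
near=> n.
have hG : En n G <= K + 1 by near: n.
have hcu : `|E hu - En n hu| <= c by near: n.
have hcl : `|E hl - En n hl| <= c by near: n.
have Fu : `|F x - F (x + s + s)| <= c.
  by apply: near_x; rewrite (_ : x + s + s - x = 2 * s); [rewrite ger0_norm; lra|ring].
have Fl : `|F x - F (x - s - s)| <= c.
  by apply: near_x; rewrite (_ : x - s - s - x = - (2 * s)); [rewrite normrN ger0_norm; lra|ring].
have m1 : c' * En n G <= c * (K + 1).
  rewrite (@le_trans _ _ (c' * (K + 1)))// ?ler_pM2l// ler_wpM2r//; lra.
have m2 : c' * K <= c * K by rewrite ler_wpM2r//; lra.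
have ce : c * K + c * K + 4 * c = e.
  by rewrite /c; field; rewrite gt_eqF.
have := upn n; have := lon n; move: up lo hcu hcl Fu Fl; rewrite -/(F x) !ler_norml.
rewrite mulrDr mulr1 in m1.
move: (c' * En n G) (c' * K) (c * K) (F x) (F _) (F _) (E hu) (E hl) (En n hu) (En n hl) (En n _) m1 m2 ce.
move=> {c'0 c'1 c'c} *.
by apply/andP; split; lra.
Unshelve. all: by end_near.
Qed.
End moment_method.

(** * Moments of the standard normal law *)

Section gaussian.
Variable R : realType.
Local Notation mu := (@lebesgue_measure R).
Local Notation pdf := (normal_pdf (0 : R) 1).

Definition gauss_expectation (h : R -> R) : R := (\int[mu]_x (h x * pdf x))%R.

Let one_neq0 : (1 : R) != 0. Proof. exact: oner_neq0. Qed.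
Let sqrt2_neq0 : Num.sqrt (2 : R) != 0. Proof. by rewrite sqrtr_eq0 -ltNge. Qed.

(** Half of the exponent is spent on (1 + x^2)^N <= 4^N N! exp((1 + x^2) / 4); what remains is, up
    to a constant, the density of variance 2. *)
Lemma poly_bounded_gauss (h : R -> R) : poly_bounded h ->
  exists C, forall x, `|h x * pdf x| <= C * normal_pdf 0 (Num.sqrt 2) x.
Proof.
move=> [_ [C [N hC]]].
pose B := `|C| * (4 ^+ N * N`!%:R * expR 4^-1) * normal_peak 1.
have p2 : 0 < normal_peak (Num.sqrt (2 : R)) by exact: normal_peak_gt0.
exists (B / normal_peak (Num.sqrt 2)) => x.
rewrite (normal_pdfE _ one_neq0) (normal_pdfE _ sqrt2_neq0) /normal_fun !subr0.
rewrite [leRHS]mulrA divfK ?gt_eqF// sqr_sqrtr// expr1n.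
rewrite normrM (ger0_norm (mulr_ge0 (normal_peak_ge0 _) (expR_ge0 _))) mulrA.
have -> : - x ^+ 2 / (1 *+ 2) = - x ^+ 2 / (2 *+ 2) + - (x ^+ 2 / 4) by field.
rewrite expRD mulrA mulrAC ler_wpM2r ?expR_ge0// mulrAC /B ler_wpM2r ?normal_peak_ge0//.
rewrite expRN ler_pdivrMr ?expR_gt0//.
rewrite (le_trans (hC x))// (le_trans (ler_norm _))// normrM -[leRHS]mulrA ler_wpM2l//.
have x1 : 0 <= 1 + x ^+ 2 by rewrite addr_ge0// sqr_ge0.
rewrite ger0_norm ?exprn_ge0//.
have -> : 4 ^+ N * N`!%:R * expR 4^-1 * expR (x ^+ 2 / 4) =
    4 ^+ N * N`!%:R * expR ((1 + x ^+ 2) / 4).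
  by rewrite -mulrA -expRD; congr (_ * expR _); field.
rewrite {1}(_ : 1 + x ^+ 2 = 4 * ((1 + x ^+ 2) / 4)); last by field.
rewrite exprMn -mulrA ler_wpM2l// [leRHS]mulrC -ler_pdivrMr ?ltr0n ?fact_gt0//.
case: N {hC B} => [|N].
  by rewrite expr0 fact0 mulr1n divr1 -[leLHS]expR0 ler_expR divr_ge0.
rewrite (le_trans _ (expR_ge1Dxn N _))// ?lerDr// divr_ge0//.
Qed.

Lemma gauss_integrable (h : R -> R) : poly_bounded h ->
  mu.-integrable setT (EFin \o (fun x => h x * pdf x)).
Proof.
move=> ph; have [C hC] := poly_bounded_gauss ph.
apply: (@le_integrable _ _ _ mu setT measurableT _
  (EFin \o (fun x => C * normal_pdf 0 (Num.sqrt 2) x))).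
- apply/measurable_EFinP; apply: measurable_funM; first by case: ph.
  exact: measurable_normal_pdf.
- move=> x _ /=; rewrite lee_fin (le_trans (hC x))// ler_norm//.
have -> : EFin \o (fun x => C * normal_pdf 0 (Num.sqrt 2) x) =
  (fun x => C%:E * (normal_pdf 0 (Num.sqrt 2) x)%:E)%E by [].
by apply: integrableZl => //; exact: integrable_normal_pdf.
Qed.

Lemma is_expectation_gauss : is_expectation gauss_expectation.
Proof.
split.
- move=> a f g pf pg; rewrite /gauss_expectation -RintegralZl//; last exact: gauss_integrable.
  rewrite -RintegralD//; last 2 first.
  + have -> : EFin \o (fun x => a * (f x * pdf x)) = (fun x => a%:E * ((f x * pdf x)%R)%:E)%E by [].
    by apply: integrableZl => //; exact: gauss_integrable.
  + exact: gauss_integrable.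
  by apply: eq_Rintegral => x _; ring.
- move=> f pf f0; apply: Rintegral_ge0 => x _.
  by rewrite mulr_ge0// normal_pdf_ge0.
- rewrite /gauss_expectation; under eq_Rintegral do rewrite mul1r.
  by rewrite /Rintegral integral_normal_pdf.
Qed.

Lemma gauss_expectation_le_ind (a : R) :
  (normal_prob 0 1 `]-oo, a])%E = (gauss_expectation (fun y => (y <= a)%R%:R))%:E.
Proof.
rewrite /gauss_expectation /Rintegral fineK; last first.
  by apply: integrable_fin_num => //; apply: gauss_integrable; exact: poly_bounded_le_ind.
rewrite /normal_prob [LHS]integral_mkcond; apply: eq_integral => x _.
rewrite patchE mem_setE in_itv /=; case: (x <= a); first by rewrite mul1r.
by rewrite mul0r.
Qed.

Lemma is_derive_pdf (x : R) : is_derive x 1 pdf (- x * pdf x).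
Proof.
have -> : pdf = fun x : R => (normal_peak (1:R))%:P.[x] * expR ((- 2^-1 *: 'X^2 : {poly R}).[x]).
  apply/funext => y; rewrite (normal_pdfE _ one_neq0) /normal_fun hornerC hornerZ hornerXn subr0.
  by congr (_ * expR _); rewrite expr1n; field.
apply: (is_derive_eq (is_derive_weighted _ _ _)).
rewrite derivC horner0 add0r derivZ derivXn hornerZ hornerMn hornerXn hornerC.
by rewrite expr1; field.
Qed.

(* Integration by parts, over [-n, n] with n going to infinity. *)
Lemma gauss_by_parts (j : nat) :
  gauss_expectation (fun x => x * x ^+ j - j%:R * x ^+ j.-1) = 0.
Proof.
pose f (x : R) := (x * x ^+ j - j%:R * x ^+ j.-1) * pdf x.
pose F (x : R) := - (x ^+ j * pdf x).
have pX k : poly_bounded (fun x : R => x ^+ k).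
  by apply: poly_boundedX; exact: poly_bounded_id.
have pf : poly_bounded (fun x : R => x * x ^+ j - j%:R * x ^+ j.-1).
  have -> : (fun x : R => x * x ^+ j - j%:R * x ^+ j.-1) = fun x => x * x ^+ j + (- j%:R) * x ^+ j.-1.
    by apply/funext => x; rewrite mulNr.
  apply: poly_boundedD; first by apply: poly_boundedM => //; exact: poly_bounded_id.
  by apply: poly_boundedM => //; exact: poly_bounded_cst.
have dF (x : R) : is_derive x 1 F (f x).
  have h1 : is_derive x 1 (horner 'X^j : R -> R) ('X^j)^`().[x] by exact: is_derive_poly.
  have h2 : is_derive x 1 (- ((horner 'X^j : R -> R) * pdf)) (- (('X^j).[x] *: (- x * pdf x) + pdf x *: ('X^j)^`().[x])).
    by apply: is_deriveN; apply: is_deriveM; exact: is_derive_pdf.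
  have -> : F = - ((horner 'X^j : R -> R) * pdf).
    by apply/funext => y; rewrite /F !fctE hornerXn.
  apply: (is_derive_eq h2).
  by rewrite /GRing.scale /= derivXn hornerMn !hornerXn /f -[_ *+ j]mulr_natl; ring.
have cF : continuous F.
  move=> x; apply: differentiable_continuous; apply/derivable1_diffP.
  by case: (dF x).
have cf : continuous f.
  have cp : continuous (fun x : R => x * x ^+ j - j%:R * x ^+ j.-1).
    have -> : (fun x : R => x * x ^+ j - j%:R * x ^+ j.-1) = horner ('X * 'X^j - j%:R *: 'X^(j.-1)).
      by apply/funext => y; rewrite hornerD hornerN hornerM hornerZ !hornerXn hornerX.
    exact: continuous_horner.
  by move=> x; apply: cvgM; [exact: cp|exact: continuous_normal_pdf].
have intf : mu.-integrable setT (EFin \o f) by exact: gauss_integrable.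
pose fn (n : nat) x := ((f \_ `[- n%:R, n%:R]) x)%:E.
have FTC n : (0 < n)%N -> (\int[mu]_x fn n x = (F n%:R - F (- n%:R))%:E)%E.
  move=> n0; have nn : (- n%:R < n%:R :> R).
    by have : 0 < n%:R :> R by [rewrite ltr0n]; lra.
  rewrite EFinB -(@continuous_FTC2 R f F _ _ nn).
  - rewrite [RHS]integral_mkcond; apply: eq_integral => x _.
    by rewrite /fn restrict_EFin.
  - exact: continuous_subspaceT.
  - split; first by move=> x _; case: (dF x).
    + by apply: cvg_at_right_filter; exact: cF.
    + by apply: cvg_at_left_filter; exact: cF.
  - by move=> x _; rewrite derive1E; case: (dF x).
have lim1 : (\int[mu]_x fn n x)%E @[n --> \oo] --> (\int[mu]_x (f x)%:E)%E.
  have mf : measurable_fun setT f by exact: continuous_measurable_fun.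
  have mfn n : measurable_fun setT (fn n).
    apply/measurable_EFinP; apply/(measurable_restrictT _ _).1; first exact: measurable_itv.
    exact: measurable_funTS.
  have cvfn : {ae mu, forall x, setT x -> fn ^~ x @ \oo --> (EFin \o f) x}.
    apply: aeW => x _; apply: cvg_near_cst; near=> n.
    rewrite /fn patchE ifT// inE /= in_itv /= -ler_norml.
    near: n; exact: nbhs_infty_ger.
  have intaf : mu.-integrable setT (fun x => `|f x|%:E) by exact: integrable_norm.
  have domf : {ae mu, forall x n, setT x -> (`|fn n x| <= `|f x|%:E)%E}.
    apply: aeW => x n _; rewrite /fn patchE; case: ifP => _ //=.
    by rewrite lee_fin normr0.
  have mf' : measurable_fun setT (EFin \o f) by apply/measurable_EFinP.
  by have [_ _] := @dominated_convergence _ _ R mu setT measurableT fn (EFin \o f)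
    (fun x => `|f x|%:E) mfn mf' cvfn intaf domf.
(* The boundary term decays: (1 + x^2) x^j has polynomial growth, so its product with the density is
   bounded. *)
have [C0 FC] : exists C, forall x, `|F x| <= C / (1 + x ^+ 2).
  have ph : poly_bounded (fun x : R => (1 + x ^+ 2) * x ^+ j).
    by apply: poly_boundedM => //; apply: poly_boundedD => //; exact: poly_bounded_cst.
  have [C hC] := poly_bounded_gauss ph.
  exists (`|C| * normal_peak (Num.sqrt 2)) => x.
  have x1 : 0 < 1 + x ^+ 2 by rewrite ltr_pwDl// sqr_ge0.
  rewrite ler_pdivlMr// -[X in _ * X](ger0_norm (ltW x1)) -normrM.
  have -> : F x * (1 + x ^+ 2) = - ((1 + x ^+ 2) * x ^+ j * pdf x) by rewrite /F; ring.
  rewrite normrN.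
  rewrite (le_trans (hC x))// (le_trans (ler_norm _))// normrM ler_wpM2l//.
  by rewrite ger0_norm ?normal_pdf_ge0// normal_pdf_ub.
have lim2 : (\int[mu]_x fn n x)%E @[n --> \oo] --> 0%E.
  have c0 : F n%:R - F (- n%:R) @[n --> \oo] --> (0 : R).
    have cvC : (2 * `|C0|) * n.+1%:R^-1 @[n --> \oo] --> (0 : R).
      by rewrite -(mulr0 (2 * `|C0|)); apply: cvgMl_tmp; exact: cvg_harmonic.
    apply/cvgr0Pnorm_le => e e0; move/cvgr0Pnorm_le : cvC => /(_ _ e0).
    apply: filterS => n; apply: le_trans.
    have FCn (x : R) : x ^+ 2 = n%:R ^+ 2 -> `|F x| <= `|C0| * n.+1%:R^-1.
      move=> xn; rewrite (le_trans (FC x))// xn (le_trans (ler_norm _))// normrM ler_wpM2l//.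
      rewrite normfV ler_pV2 ?inE ?unitfE ?normr_gt0 ?normr_eq0 ?gt_eqF ?ltr_pwDl ?sqr_ge0 ?ltr0n//.
      rewrite ger0_norm ?addr_ge0 ?sqr_ge0// -nat1r lerD2l expr2 -natrM ler_nat.
      by case: n {xn} => // n; rewrite leq_pmulr.
    rewrite [leRHS]ger0_norm ?mulr_ge0// (le_trans (ler_normB _ _))//.
    by rewrite -mulrA mulr2n mulrDl mul1r lerD// FCn// sqrrN.
  have : (F n%:R - F (- n%:R))%:E @[n --> \oo] --> 0%:E by apply: cvg_EFin => //; exact: nearW.
  apply: cvg_trans; apply: near_eq_cvg; near=> n.
  by rewrite FTC//; near: n; exists 1%N.
have e0 : (\int[mu]_x (f x)%:E)%E = 0%E := cvg_unique (@ereal_hausdorff R) lim1 lim2.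
by rewrite /gauss_expectation /Rintegral e0.
Unshelve. all: by end_near.
Qed.

Lemma gauss_expectationX (k : nat) : gauss_expectation (fun x => x ^+ k) = gauss_moment R k.
Proof.
have pX i : poly_bounded (fun x : R => x ^+ i).
  by apply: poly_boundedX; exact: poly_bounded_id.
elim/ltn_ind: k => -[|[|k]] ih.
- by under [X in gauss_expectation X]eq_fun do rewrite expr0; exact: expectation_one is_expectation_gauss.
- rewrite /= -(gauss_by_parts 0); congr gauss_expectation; apply/funext => x.
  by rewrite expr0 mulr1 mul0r subr0 expr1.
have /eqP := gauss_by_parts k.+1.
have -> : (fun x : R => x * x ^+ k.+1 - k.+1%:R * x ^+ k.+1.-1) =
    fun x => (- k.+1%:R) * x ^+ k + x ^+ k.+2.
  by apply/funext => x; rewrite /= -exprS addrC mulNr.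
rewrite (expectation_lin is_expectation_gauss)// ih// mulNr addrC subr_eq0 => /eqP ->.
by [].
Qed.

(** This is (2M - 1)!! / (2M)! = 1 / (2^M M!). It turns the remainder in the method of moments into
    a term of the series of exp(t^2 / 2). *)
Lemma gauss_moment_double (M : nat) :
  gauss_moment R M.*2 / (M.*2)`!%:R = (2^-1) ^+ M / M`!%:R.
Proof.
elim: M => [|M ih]; first by rewrite /= fact0 expr0 mul1r.
rewrite doubleS /= -/(gauss_moment R) !factS !natrM.
have h1 : M.*2.+2%:R = 2 * M.+1%:R :> R by rewrite -natrM mul2n.
have h2 : (M.*2.+1)%:R != 0 :> R by rewrite pnatr_eq0.
have h3 : (M.+1)%:R != 0 :> R by rewrite pnatr_eq0.
rewrite h1 exprS.
transitivity ((2 * M.+1%:R)^-1 * (gauss_moment R M.*2 / (M.*2)`!%:R)).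
  move: h2 h3; move: (M.*2.+1%:R : R) (M.+1%:R : R) => u v u0 v0.
  by field; rewrite u0 v0 fact_neq0.
rewrite ih; move: h3; move: (M.+1%:R : R) => v v0.
by field; rewrite v0 fact_neq0.
Qed.

Lemma gauss_moments_small (t : R) :
  t ^+ M.*2 / (M.*2)`!%:R * gauss_expectation (fun x => x ^+ M.*2) @[M --> \oo] --> (0 : R).
Proof.
under eq_cvg => M.
  rewrite gauss_expectationX mulrAC -mulrA gauss_moment_double -mul2n exprM mulrA -exprMn.
  over.
exact: (cvg_series_cvg_0 (is_cvg_series_exp_coeff (t ^+ 2 * 2^-1))).
Qed.

End gaussian.

(** * Expectations of bounded random variables *)

Section bounded_measurable.
Context d (T : measurableType d) (R : realType) (P : probability T R).
Implicit Types f g : T -> R.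

Definition bounded_measurable f : Prop :=
  measurable_fun setT f /\ exists M, forall u, `|f u| <= M.

Definition Ex f : R := (\int[P]_u f u)%R.

Lemma bounded_measurable_integrable f : bounded_measurable f ->
  P.-integrable setT (EFin \o f).
Proof.
move=> [mf [M fM]]; apply: (@le_integrable _ _ _ P setT measurableT _ (EFin \o cst M)).
- exact/measurable_EFinP.
- by move=> u _ /=; rewrite lee_fin (le_trans (fM u))// ler_norm.
- exact: finite_measure_integrable_cst.
Qed.
Local Hint Resolve bounded_measurable_integrable : core.

Lemma bounded_measurable_cst (c : R) : bounded_measurable (fun=> c).
Proof. by split; [exact: measurable_cst|exists `|c|]. Qed.

Lemma bounded_measurableD f g : bounded_measurable f -> bounded_measurable g ->
  bounded_measurable (fun u => f u + g u).
Proof.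
move=> [mf [M fM]] [mg [N gN]]; split; first exact: measurable_funD.
by exists (M + N) => u; rewrite (le_trans (ler_normD _ _))// lerD.
Qed.

Lemma bounded_measurableM f g : bounded_measurable f -> bounded_measurable g ->
  bounded_measurable (fun u => f u * g u).
Proof.
move=> [mf [M fM]] [mg [N gN]]; split; first exact: measurable_funM.
by exists (M * N) => u; rewrite normrM ler_pM.
Qed.

Lemma bounded_measurableN f : bounded_measurable f -> bounded_measurable (fun u => - f u).
Proof.
move=> bf; under eq_fun do rewrite -mulN1r.
by apply: bounded_measurableM => //; exact: bounded_measurable_cst.
Qed.

Lemma bounded_measurableB f g : bounded_measurable f -> bounded_measurable g ->
  bounded_measurable (fun u => f u - g u).
Proof. by move=> bf bg; apply: bounded_measurableD => //; exact: bounded_measurableN. Qed.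

Lemma bounded_measurable_norm f : bounded_measurable f -> bounded_measurable (fun u => `|f u|).
Proof.
move=> [mf [M fM]]; split; last by exists M => u; rewrite normr_id.
exact: measurableT_comp.
Qed.

Lemma bounded_measurableX f n : bounded_measurable f -> bounded_measurable (fun u => f u ^+ n).
Proof.
move=> bf; elim: n => [|n ih].
  by under eq_fun do rewrite expr0; exact: bounded_measurable_cst.
by under eq_fun do rewrite exprS; exact: bounded_measurableM.
Qed.

Lemma bounded_measurable_sum (I : Type) (r : seq I) (f : I -> T -> R) :
  (forall i, bounded_measurable (f i)) ->
  bounded_measurable (fun u => \sum_(i <- r) f i u).
Proof.
move=> bf; elim: r => [|i r ih].
  by under eq_fun do rewrite big_nil; exact: bounded_measurable_cst.
by under eq_fun do rewrite big_cons; exact: bounded_measurableD.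
Qed.

Lemma bounded_measurable_prod (I : Type) (r : seq I) (f : I -> T -> R) :
  (forall i, bounded_measurable (f i)) ->
  bounded_measurable (fun u => \prod_(i <- r) f i u).
Proof.
move=> bf; elim: r => [|i r ih].
  by under eq_fun do rewrite big_nil; exact: bounded_measurable_cst.
by under eq_fun do rewrite big_cons; exact: bounded_measurableM.
Qed.

Lemma ExD f g : bounded_measurable f -> bounded_measurable g ->
  Ex (fun u => f u + g u) = Ex f + Ex g.
Proof. by move=> bf bg; rewrite /Ex RintegralD//; exact: bounded_measurable_integrable. Qed.

Lemma ExB f g : bounded_measurable f -> bounded_measurable g ->
  Ex (fun u => f u - g u) = Ex f - Ex g.
Proof. by move=> bf bg; rewrite /Ex RintegralB//; exact: bounded_measurable_integrable. Qed.

Lemma ExZ a f : bounded_measurable f -> Ex (fun u => a * f u) = a * Ex f.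
Proof. by move=> bf; rewrite /Ex RintegralZl//; exact: bounded_measurable_integrable. Qed.

Lemma Ex_cst a : Ex (fun=> a) = a.
Proof.
rewrite /Ex Rintegral_cst// -[RHS]mulr1; congr (_ * _).
by transitivity (fine (1%E : \bar R)) => //; congr fine; exact: probability_setT.
Qed.

Lemma Ex_ge0 f : (forall u, 0 <= f u) -> 0 <= Ex f.
Proof. by move=> f0; apply: Rintegral_ge0. Qed.

Lemma Ex_le f g : bounded_measurable f -> bounded_measurable g ->
  (forall u, f u <= g u) -> Ex f <= Ex g.
Proof.
by move=> bf bg fg; apply: le_Rintegral => //; exact: bounded_measurable_integrable.
Qed.

Lemma Ex_norm f : bounded_measurable f -> `|Ex f| <= Ex (fun u => `|f u|).
Proof.
by move=> bf; apply: le_normr_Rintegral => //; exact: bounded_measurable_integrable.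
Qed.

Lemma Ex_sum (I : Type) (r : seq I) (f : I -> T -> R) :
  (forall i, bounded_measurable (f i)) ->
  Ex (fun u => \sum_(i <- r) f i u) = \sum_(i <- r) Ex (f i).
Proof.
move=> bf; elim: r => [|i r ih].
  rewrite big_nil -[RHS](Ex_cst 0); congr Ex.
  by apply/funext => u; rewrite big_nil.
rewrite big_cons -ih -ExD//; last exact: bounded_measurable_sum.
by congr Ex; apply/funext => u; rewrite big_cons.
Qed.

Lemma expectation_Ex f : bounded_measurable f -> ('E_P[f] = (Ex f)%:E)%E.
Proof.
move=> bf; rewrite unlock /Ex /Rintegral fineK//.
by apply: integrable_fin_num => //; exact: bounded_measurable_integrable.
Qed.

Lemma Ex_sqr_le f : bounded_measurable f -> Ex f ^+ 2 <= Ex (fun u => f u ^+ 2).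
Proof.
move=> bf; have b2 := bounded_measurableX 2 bf.
have : 0 <= Ex (fun u => (f u - Ex f) ^+ 2) by apply: Ex_ge0 => u; exact: sqr_ge0.
have -> : (fun u => (f u - Ex f) ^+ 2) = fun u => (f u ^+ 2 - (2 * Ex f) * f u) + Ex f ^+ 2.
  by apply/funext => u; ring.
have bc c : bounded_measurable (fun=> c) by exact: bounded_measurable_cst.
have bZ : bounded_measurable (fun u => (2 * Ex f) * f u) by apply: bounded_measurableM.
rewrite ExD//; last by apply: bounded_measurableB.
by rewrite ExB// ExZ// Ex_cst => h; nra.
Qed.

Lemma variance_Ex f : bounded_measurable f ->
  ('V_P[f] = (Ex (fun u => (f u - Ex f) ^+ 2)%R)%:E)%E.
Proof.
move=> bf.
have b2 : bounded_measurable (fun u => (f u - Ex f) ^+ 2).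
  apply: bounded_measurableX; apply: bounded_measurableB => //.
  exact: bounded_measurable_cst.
rewrite /variance covariance.unlock (expectation_Ex bf) /=.
have e : (f \- cst (Ex f)) * (f \- cst (Ex f)) = fun u => (f u - Ex f) ^+ 2.
  by apply/funext => u; rewrite expr2.
by rewrite e expectation_Ex.
Qed.

Lemma bounded_measurable_comp (h : R -> R) f : poly_bounded h ->
  bounded_measurable f -> bounded_measurable (h \o f).
Proof.
move=> [mh [C [N hC]]] [mf [M fM]]; split; first exact: measurableT_comp.
exists (`|C| * (1 + M ^+ 2) ^+ N) => u /=.
rewrite (le_trans (hC _))// (le_trans (ler_norm _))// normrM ler_wpM2l//.
have f1 : 0 <= 1 + f u ^+ 2 by rewrite addr_ge0// sqr_ge0.
have M0 : 0 <= M by rewrite (le_trans _ (fM u)).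
rewrite ger0_norm ?exprn_ge0// lerXn2r ?nnegrE ?addr_ge0 ?sqr_ge0// lerD2l.
by rewrite -[leLHS]real_normK ?num_real// lerXn2r.
Qed.

Lemma is_expectation_Ex f : bounded_measurable f ->
  is_expectation (fun h => Ex (h \o f)).
Proof.
move=> bf; split.
- move=> a g h pg ph.
  rewrite -ExZ; last exact: bounded_measurable_comp.
  rewrite -ExD//; last exact: bounded_measurable_comp.
  by apply: bounded_measurableM; [exact: bounded_measurable_cst|exact: bounded_measurable_comp].
- by move=> g _ g0; apply: Ex_ge0 => u; exact: g0.
- exact: Ex_cst.
Qed.

Lemma moment_positive_Ex f : bounded_measurable f ->
  moment_positive (fun l => Ex (fun u => f u ^+ l)).
Proof.
move=> bf N v.
have bX l : bounded_measurable (fun u => v l * f u ^+ l).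
  apply: bounded_measurableM; [exact: bounded_measurable_cst|exact: bounded_measurableX].
have e1 : \sum_(j < N) v j * Ex (fun u => f u ^+ j) = Ex (fun u => \sum_(j < N) v j * f u ^+ j).
  rewrite (@Ex_sum _ _ (fun (j : 'I_N) u => v j * f u ^+ j))//.
  by apply: eq_bigr => j _; rewrite ExZ//; exact: bounded_measurableX.
have e2 : \sum_(i < N) \sum_(j < N) v i * v j * Ex (fun u => f u ^+ (i + j)) =
    Ex (fun u => (\sum_(j < N) v j * f u ^+ j) ^+ 2).
  have -> : (fun u => (\sum_(j < N) v j * f u ^+ j) ^+ 2) =
      fun u => \sum_(i < N) \sum_(j < N) (v i * v j) * f u ^+ (i + j).
    apply/funext => u; rewrite expr2 mulr_suml; apply: eq_bigr => i _.
    by rewrite mulr_sumr; apply: eq_bigr => j _; rewrite exprD; ring.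
  have bij (i j : 'I_N) : bounded_measurable (fun u => (v i * v j) * f u ^+ (i + j)).
    by apply: bounded_measurableM; [exact: bounded_measurable_cst|exact: bounded_measurableX].
  rewrite (@Ex_sum _ _ (fun (i : 'I_N) u => \sum_(j < N) (v i * v j) * f u ^+ (i + j))); last first.
    by move=> i; apply: bounded_measurable_sum => j.
  apply: eq_bigr => i _; rewrite (@Ex_sum _ _ (fun (j : 'I_N) u => (v i * v j) * f u ^+ (i + j)))//.
  by apply: eq_bigr => j _; rewrite ExZ//; exact: bounded_measurableX.
rewrite e1 e2; apply: Ex_sqr_le; exact: bounded_measurable_sum.
Qed.

End bounded_measurable.

Lemma clt_of_cumulants d (T : measurableType d) (R : realType) (P : probability T R)
    (Y : nat -> T -> R) (k : nat -> nat -> R) (s : nat) :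
  (forall n, bounded_measurable (Y n)) ->
  (forall n, is_cumulant (fun l => Ex P (fun u => Y n u ^+ l)) (k n)) ->
  (forall n, k n 0%N = 0) -> (forall n, k n 1%N = 0) -> (forall n, k n 2%N = 1) ->
  (forall j, (s <= j)%N -> k n j @[n --> \oo] --> (0 : R)) ->
  cvg_in_distribution P Y (normal_prob 0 1).
Proof.
move=> bY mk k0 k1 k2 ks x cx.
have mpos n := moment_positive_Ex P (bY n).
have mcvg := moments_cvg_gauss mk mpos k0 k1 k2 ks.
have EnE n := is_expectation_Ex P (bY n).
have -> : (fun n => P [set u | Y n u <= x]) =
    fun n => (Ex P ((fun y : R => (y <= x)%R%:R) \o Y n))%:E.
  apply/funext => n.
  have mA : measurable [set u | Y n u <= x].
    rewrite (_ : [set u | _] = Y n @^-1` `]-oo, x]); last first.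
      by apply/seteqP; split => u /=; rewrite in_itv.
    by rewrite -[X in measurable X]setTI; case: (bY n) => mY _; apply: mY => //; exact: measurable_itv.
  rewrite /Ex /Rintegral (_ : (fun u => _) = (fun u => (\1_[set u | Y n u <= x] u)%:E)); last first.
    by apply/funext => u; rewrite indicE /= mem_setE.
  by rewrite integral_indic// setIT fineK// fin_num_measure.
have gE (t : R) : (normal_prob 0 1 : probability (measurableTypeR R) R) `]-oo, t]%classic =
    (gauss_expectation (fun y => (y <= t)%R%:R))%:E by exact: gauss_expectation_le_ind.
rewrite gE; apply: cvg_EFin; first exact: nearW.
apply: (@moments_cvg_cdf R (fun n h => Ex P (h \o Y n)) (@gauss_expectation R)) => //.
- exact: is_expectation_gauss.
- by move=> l; rewrite gauss_expectationX; exact: mcvg.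
- exact: gauss_moments_small.
move: cx; rewrite /prop_for /continuous_at /= gE => /fine_cvg; apply: cvg_trans.
by apply: near_eq_cvg; apply: nearW => t /=; rewrite gE.
Qed.

(** * Ursell functions *)

Section list_splits.
Variables (R : realType) (V : eqType).
Implicit Types (s a b : seq V) (G H : seq V -> seq V -> R).

(** Each position of [s] goes to one of two sublists, giving 2 ^ size terms. Repeated points count
    as distinct positions, as powers in a mixed moment require. *)
Fixpoint splits_sum s G : R :=
  match s with
  | [::] => G [::] [::]
  | x :: s' => splits_sum s' (fun a b => G (x :: a) b) + splits_sum s' (fun a b => G a (x :: b))
  end.

Lemma splits_sum_eq s G H : (forall a b, perm_eq (a ++ b) s -> G a b = H a b) ->
  splits_sum s G = splits_sum s H.
Proof.
elim: s G H => [|x s ih] G H GH /=; first exact: GH.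
congr (_ + _); apply: ih => a b ab; apply: GH; first by rewrite /= perm_cons.
by rewrite -cat1s perm_catCA /= perm_cons.
Qed.

Lemma splits_sum_norm s G (B : R) : (forall a b, perm_eq (a ++ b) s -> `|G a b| <= B) ->
  `|splits_sum s G| <= 2 ^+ size s * B.
Proof.
elim: s G => [|x s ih] G GB /=; first by rewrite expr0 mul1r; exact: GB.
rewrite exprS -mulrA mulr2n mulrDl mul1r (le_trans (ler_normD _ _))// lerD//; apply: ih => a b ab.
  by apply: GB; rewrite /= perm_cons.
by apply: GB; rewrite -cat1s perm_catCA /= perm_cons.
Qed.

Lemma splits_sumD s G H :
  splits_sum s (fun a b => G a b + H a b) = splits_sum s G + splits_sum s H.
Proof. by elim: s G H => //= x s ih G H; rewrite !ih addrACA. Qed.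

Lemma splits_sum0 s G : (forall a b, G a b = 0) -> splits_sum s G = 0.
Proof. by elim: s G => //= x s ih G G0; rewrite !ih ?addr0. Qed.

Lemma splits_sum_nil s G :
  splits_sum s (fun a b => if b is [::] then G a b else 0) = G s [::].
Proof.
elim: s G => //= x s ih G; rewrite (ih (fun a b => G (x :: a) b)).
by rewrite splits_sum0 ?addr0.
Qed.

(** If [a] lies in [A], everything of [s] outside [A] falls into [b]; such splits of [s] are
    therefore splits of its part in [A]. *)
Lemma splits_sum_filter s G (N : seq V -> R) (A : pred V) :
  splits_sum s (fun a b => if all A a then G a (seq.filter A b) * N (seq.filter (predC A) b) else 0) =
  splits_sum (seq.filter A s) G * N (seq.filter (predC A) s).
Proof.
elim: s G N => //= x s ih G N; case: (A x) => /=.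
  by rewrite (ih (fun a b => G (x :: a) b)) (ih (fun a b => G a (x :: b))) -mulrDl.
by rewrite splits_sum0// add0r (ih G (fun c => N (x :: c))).
Qed.

Section ursell.
Variable M : seq V -> R.

(** The moment of x0 :: s sums, over the blocks x0 :: a containing the base point, the cumulant of
    the block times the moment of the rest; this is solved for the full block, b = [::]. [n] is
    fuel, sufficient above [size s] because a nonempty [b] makes [a] shorter. *)
Fixpoint ursell_rec (n : nat) (x0 : V) s : R :=
  if n is n'.+1 then
    M (x0 :: s) - splits_sum s (fun a b => if b is [::] then 0 else ursell_rec n' x0 a * M b)
  else 0.

(* The joint cumulant of x0 :: s, with x0 as base point of the recursion. *)
Definition ursell (x0 : V) s : R := ursell_rec (size s).+1 x0 s.

Lemma ursell_recE n x0 s : (size s < n)%N -> ursell_rec n x0 s = ursell x0 s.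
Proof.
have [k ks] := ubnP (size s); elim: k n s ks => // k ih [//|n] s sk sn.
rewrite /ursell /=; congr (_ - _); apply: splits_sum_eq => a [|y b] // ab.
have sz : (size a < size s)%N by rewrite -(perm_size ab) size_cat /= addnS ltnS leq_addr.
rewrite (ih n a)//; last by rewrite (leq_trans sz).
  by rewrite [in RHS](ih (size s) a)// (leq_trans sz).
by rewrite (leq_trans sz).
Qed.

Lemma ursellE x0 s :
  ursell x0 s =
  M (x0 :: s) - splits_sum s (fun a b => if b is [::] then 0 else ursell x0 a * M b).
Proof.
rewrite {1}/ursell /=; congr (_ - _); apply: splits_sum_eq => a [|y b] // ab.
by rewrite ursell_recE// -(perm_size ab) size_cat /= addnS ltnS leq_addr.
Qed.

Hypothesis M1 : M [::] = 1.

Lemma ursell_sum x0 s : M (x0 :: s) = splits_sum s (fun a b => ursell x0 a * M b).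
Proof.
rewrite (@splits_sum_eq _ _ (fun a b => (if b is [::] then ursell x0 a * M b else 0) +
    (if b is [::] then 0 else ursell x0 a * M b))).
  by rewrite splits_sumD splits_sum_nil M1 mulr1 ursellE subrK.
by move=> a [|y b] _; rewrite ?addr0 ?add0r.
Qed.

Fixpoint ursell_bound (B : R) (n : nat) : R :=
  if n is n'.+1 then B + 2 ^+ n * (ursell_bound B n' * B) else B.

Lemma ursell_bound_ge (B : R) n : 1 <= B -> B <= ursell_bound B n.
Proof.
move=> B1; have B0 : 0 <= B by rewrite (le_trans ler01).
elim: n => //= n ih; rewrite lerDl mulr_ge0// ?exprn_ge0// mulr_ge0//.
by rewrite (le_trans B0).
Qed.

Lemma ursell_bound_mono (B : R) n k : 1 <= B -> (n <= k)%N ->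
  ursell_bound B n <= ursell_bound B k.
Proof.
move=> B1; have B0 : 0 <= B by rewrite (le_trans ler01).
elim: k => [|k ih]; first by rewrite leqn0 => /eqP ->.
rewrite leq_eqVlt => /orP[/eqP -> //|]; rewrite ltnS => /ih/le_trans; apply => /=.
have u0 : 0 <= ursell_bound B k by rewrite (le_trans B0)// ursell_bound_ge.
rewrite -[leLHS]add0r lerD// -[leLHS]mul1r ler_pM//.
  by rewrite exprn_ege1// ler1n.
by rewrite ler_peMr.
Qed.

Lemma ursell_le (B : R) x0 s : 1 <= B ->
  (forall l, {subset l <= x0 :: s} -> (size l <= (size s).+1)%N -> `|M l| <= B) ->
  `|ursell x0 s| <= ursell_bound B (size s).
Proof.
move=> B1; have B0 : 0 <= B by rewrite (le_trans ler01).
have [k ks] := ubnP (size s); elim: k s ks => // k ih s sk MB.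
rewrite ursellE (le_trans (ler_normB _ _))//.
case: s sk MB => [|x s] sk MB; first by rewrite /= normr0 addr0; exact: MB.
rewrite [ursell_bound _ _]/= lerD//; first exact: MB.
apply: (@splits_sum_norm (x :: s)) => a [|y b] ab.
  by rewrite normr0 mulr_ge0// (le_trans B0)// ursell_bound_ge.
have sz : (size a <= size s)%N.
  by have := perm_size ab; rewrite size_cat /= addnS => -[<-]; rewrite leq_addr.
have sub_a : {subset a <= x :: s}.
  by move=> z za; rewrite -(perm_mem ab) mem_cat za.
have sub_b : {subset y :: b <= x :: s}.
  by move=> z zb; rewrite -(perm_mem ab) mem_cat zb orbT.
rewrite normrM ler_pM//.
  apply: le_trans (ursell_bound_mono B1 sz); apply: ih => [|l la lsz].
    by move: sk sz => /=; clear; lia.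
  apply: MB => [z /la|]; last by rewrite (leq_trans lsz)// ltnS (leq_trans sz).
  by rewrite !inE => /orP[->//|/sub_a]; rewrite inE => ->; rewrite orbT.
apply: MB => [z /sub_b|]; first by rewrite [in X in _ -> X]inE => ->; rewrite orbT.
by have := perm_size ab; rewrite size_cat => <-; rewrite (leq_trans _ (leqnSn _))// leq_addl.
Qed.

Fixpoint cluster_bound (B : R) (n : nat) : R :=
  if n is n'.+1 then 1 + 2 ^+ n * (ursell_bound B n' + cluster_bound B n' * B) else 0.

Lemma cluster_bound_mono (B : R) n k : 1 <= B -> (n <= k)%N ->
  0 <= cluster_bound B n <= cluster_bound B k.
Proof.
move=> B1; have B0 : 0 <= B by rewrite (le_trans ler01).
have ge0 i : 0 <= cluster_bound B i.
  elim: i => //= i ih; rewrite addr_ge0// mulr_ge0 ?exprn_ge0// addr_ge0 ?mulr_ge0//.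
  by rewrite (le_trans B0)// ursell_bound_ge.
rewrite ge0 /=; elim: k => [|k ih]; first by rewrite leqn0 => /eqP ->.
rewrite leq_eqVlt => /orP[/eqP -> //|]; rewrite ltnS => /ih/le_trans; apply => /=.
rewrite -[leLHS]add0r lerD// -[leLHS]mul1r ler_pM//.
  by rewrite exprn_ege1// ler1n.
rewrite -[leLHS]add0r lerD// ?(le_trans B0)// ?ursell_bound_ge//.
by rewrite ler_peMr.
Qed.

(* In the recursion for [ursell], the terms whose first block stays in A
   factorise, up to e, and sum up to the product of the two moments. *)
Lemma ursell_cluster (B e : R) (A : pred V) x0 s : 1 <= B -> 0 <= e -> A x0 -> has (predC A) s ->
  (forall l, {subset l <= x0 :: s} -> (size l <= (size s).+1)%N -> `|M l| <= B) ->
  (forall l, {subset l <= x0 :: s} -> (size l <= (size s).+1)%N ->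
    `|M l - M (seq.filter A l) * M (seq.filter (predC A) l)| <= e) ->
  `|ursell x0 s| <= cluster_bound B (size s) * e.
Proof.
move=> B1 e0 Ax0; have B0 : 0 <= B by rewrite (le_trans ler01).
have [k ks] := ubnP (size s); elim: k s ks => // k ih s sk hs MB Me.
(* For [a] inside [A] only the defect of factorisation of [M] on [b] remains; for [a] leaving [A],
   the block x0 :: a is itself split by [A], so the induction hypothesis applies to it. *)
pose G2 a b := if all A a then ursell x0 a * (M b - M (seq.filter A b) * M (seq.filter (predC A) b))
  else if b is [::] then 0 else ursell x0 a * M b.
have e1 : ursell x0 s = (M (x0 :: s) - M (seq.filter A (x0 :: s)) * M (seq.filter (predC A) (x0 :: s)))
    - splits_sum s G2.
  rewrite ursellE /= Ax0 /=.
  rewrite [M (x0 :: seq.filter A s)]ursell_sum -splits_sum_filter -addrA; congr (_ + _).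
  rewrite -opprD -splits_sumD; congr (- _); apply: splits_sum_eq => a b ab.
  rewrite /G2; case: ifP => Aa; last by rewrite add0r.
  case: b ab => [|y b] ab; last by rewrite mulrBr mulrA addrC subrK.
  exfalso; move: hs; rewrite -(perm_has _ ab) cats0 has_predC.
  by rewrite Aa.
case: s sk hs MB Me e1 => [//|x s] sk hs MB Me e1.
rewrite e1 (le_trans (ler_normB _ _))// [cluster_bound _ _]/= mulrDl mul1r lerD//.
  exact: Me.
rewrite -mulrA; apply: (@splits_sum_norm (x :: s)) => a b ab.
have sub_a : {subset a <= x :: s}.
  by move=> z za; rewrite -(perm_mem ab) mem_cat za.
have sub_b : {subset b <= x0 :: x :: s}.
  by move=> z zb; rewrite inE -(perm_mem ab) mem_cat zb !orbT.
have sz_b : (size b <= size (x :: s))%N.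
  by rewrite -(perm_size ab) size_cat leq_addl.
have sub_l l : {subset l <= x0 :: a} -> {subset l <= x0 :: x :: s}.
  by move=> la z /la; rewrite !inE => /orP[->//|/sub_a]; rewrite inE => ->; rewrite orbT.
have u0 : 0 <= ursell_bound B (size s) by rewrite (le_trans B0)// ursell_bound_ge.
have c0 : 0 <= cluster_bound B (size s) by case/andP: (cluster_bound_mono B1 (leqnn (size s))).
have sz_a : b != [::] -> (size a <= size s)%N.
  case: b ab {sub_b sz_b} => [//|y b] ab _.
  by have := perm_size ab; rewrite size_cat /= addnS => -[<-]; rewrite leq_addr.
rewrite /G2; case: ifP => Aa.
  have b0 : b != [::].
    apply/eqP => b0; move: hs; rewrite -(perm_has _ ab) b0 cats0 has_predC.
    by rewrite Aa.
  rewrite normrM mulrDl -[leLHS]addr0 lerD ?mulr_ge0// ler_pM//.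
    apply: le_trans (ursell_bound_mono B1 (sz_a b0)); apply: ursell_le => // l la lsz.
    by apply: MB; [exact: sub_l|rewrite (leq_trans lsz)// ltnS ltnW// ltnS sz_a].
  by apply: Me => //; rewrite ltnW.
case: b ab sub_b sz_b sz_a => [|y b] ab sub_b sz_b sz_a.
  by rewrite normr0 mulr_ge0// addr_ge0// mulr_ge0.
have {}sz_a := sz_a isT.
rewrite normrM mulrDl -[leLHS]add0r lerD ?mulr_ge0//.
rewrite mulrAC ler_pM//; last by apply: MB => //; rewrite ltnW.
have /andP[_ cm] := cluster_bound_mono B1 sz_a.
apply: le_trans (ler_wpM2r e0 cm); apply: ih.
- by move: sk sz_a => /=; clear; lia.
- by rewrite has_predC Aa.
- by move=> l la lsz; apply: MB; [exact: sub_l|rewrite (leq_trans lsz)// ltnS ltnW// ltnS].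
- by move=> l la lsz; apply: Me; [exact: sub_l|rewrite (leq_trans lsz)// ltnS ltnW// ltnS].
Qed.

End ursell.
End list_splits.

(** * Cumulants of sums over a finite set *)

Section sum_tuples.
Variables (R : realType) (V : eqType) (W : seq V).
Implicit Types F G : seq V -> R.

Fixpoint sum_tuples (l : nat) F : R :=
  if l is l'.+1 then \sum_(x <- W) sum_tuples l' (fun s => F (x :: s)) else F [::].

Arguments sum_tuples : simpl never.

Lemma sum_tuplesS l F :
  sum_tuples l.+1 F = \sum_(x <- W) sum_tuples l (fun s => F (x :: s)).
Proof. by []. Qed.

Lemma sum_tuples_le l F G :
  (forall s, {subset s <= W} -> size s = l -> F s <= G s) -> sum_tuples l F <= sum_tuples l G.
Proof.
elim: l F G => [|l ih] F G FG; rewrite ?sum_tuplesS; first exact: FG.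
rewrite !big_seq; apply: ler_sum => x xW; apply: ih => s sW sl.
apply: FG; last by rewrite /= sl.
by move=> y; rewrite inE => /orP[/eqP ->//|/sW].
Qed.

Lemma sum_tuples_eq l F G :
  (forall s, {subset s <= W} -> size s = l -> F s = G s) -> sum_tuples l F = sum_tuples l G.
Proof.
by move=> FG; apply/eqP; rewrite eq_le; apply/andP; split; apply: sum_tuples_le => s sW sl; rewrite FG.
Qed.

Lemma sum_tuples_norm l F : `|sum_tuples l F| <= sum_tuples l (fun s => `|F s|).
Proof.
elim: l F => [|l ih] F; rewrite ?sum_tuplesS // (le_trans (ler_norm_sum _ _ _))//.
by apply: ler_sum => x _; exact: ih.
Qed.

Lemma sum_tuplesD l F G :
  sum_tuples l (fun s => F s + G s) = sum_tuples l F + sum_tuples l G.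
Proof.
elim: l F G => [|l ih] F G; rewrite ?sum_tuplesS // -big_split /=.
by apply: eq_bigr => x _; rewrite ih.
Qed.

Lemma sum_tuplesZ l (c : R) F : sum_tuples l (fun s => c * F s) = c * sum_tuples l F.
Proof.
elim: l F => [|l ih] F; rewrite ?sum_tuplesS // mulr_sumr.
by apply: eq_bigr => x _; rewrite ih.
Qed.

Lemma sum_tuples_sum l (I : Type) (r : seq I) (F : I -> seq V -> R) :
  sum_tuples l (fun s => \sum_(i <- r) F i s) = \sum_(i <- r) sum_tuples l (F i).
Proof.
elim: l F => [|l ih] F; rewrite ?sum_tuplesS // exchange_big /=.
by apply: eq_bigr => x _; rewrite ih.
Qed.

(** The points range over all of W^l, so a choice of positions for the first block matters only
    through their number j, whence the binomial coefficient. *)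
Lemma sum_tuples_splits l (G : seq V -> seq V -> R) :
  sum_tuples l (fun s => splits_sum s G) =
  \sum_(j < l.+1) 'C(l, j)%:R * sum_tuples j (fun a => sum_tuples (l - j) (fun b => G a b)).
Proof.
elim: l G => [|l ih] G; first by rewrite big_ord1 bin0 mul1r.
have -> : sum_tuples l.+1 (fun s => splits_sum s G) =
  \sum_(j < l.+1) 'C(l, j)%:R * sum_tuples j.+1 (fun a => sum_tuples (l - j) (fun b => G a b)) +
  \sum_(j < l.+1) 'C(l, j)%:R * sum_tuples j (fun a => sum_tuples (l - j).+1 (fun b => G a b)).
  rewrite sum_tuplesS /=; under eq_bigr do rewrite sum_tuplesD !ih.
  rewrite big_split /=; congr (_ + _).
    rewrite exchange_big /=; apply: eq_bigr => j _.
    by rewrite sum_tuplesS mulr_sumr.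
  rewrite exchange_big /=; apply: eq_bigr => j _.
  by rewrite -mulr_sumr sum_tuples_sum.
rewrite [RHS]big_ord_recl bin0 subn0.
rewrite [X in _ + X]big_ord_recl bin0 subn0 addrCA; congr (_ + _).
rewrite [X in X + _]big_ord_recr /= subnn binn mul1r.
under [RHS]eq_bigr do rewrite /bump /= add1n subSS binS natrD mulrDl.
rewrite big_split /= addrC [X in _ = X + _]big_ord_recr /= bin_small// mul0r addr0.
congr (_ + _); last by rewrite big_ord_recr /= subnn binn mul1r.
apply: eq_bigr => j _; rewrite (_ : bump 0 j = j.+1)//.
by rewrite subnSK.
Qed.

Variables (M : seq V -> R).
Hypothesis M1 : M [::] = 1.

Definition total_cumulant (l : nat) : R :=
  if l is l'.+1 then \sum_(x0 <- W) sum_tuples l' (ursell M x0) else 0.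

(** Multilinearity of joint cumulants: the Ursell recursion with the first point as base point,
    summed over all tuples, is the moment-cumulant recursion of the sum. *)
Lemma is_cumulant_total : is_cumulant (fun l => sum_tuples l M) total_cumulant.
Proof.
split => // l; rewrite sum_tuplesS /=.
have -> : \sum_(x <- W) sum_tuples l (fun s => M (x :: s)) =
    \sum_(x <- W) \sum_(j < l.+1) 'C(l, j)%:R * (sum_tuples j (ursell M x) * sum_tuples (l - j) M).
  apply: eq_bigr => x _.
  rewrite (@sum_tuples_eq l _ (fun s => splits_sum s (fun a b => ursell M x a * M b))); last first.
    by move=> s _ _; rewrite ursell_sum.
  rewrite sum_tuples_splits; apply: eq_bigr => j _; congr (_ * _).
  rewrite mulrC -sum_tuplesZ; apply: sum_tuples_eq => a _ _.
  by rewrite sum_tuplesZ mulrC.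
rewrite exchange_big /=; apply: eq_bigr => j _.
by rewrite -mulr_sumr -mulr_suml mulrA.
Qed.

Lemma sum_tuples_prod l (f : V -> R) :
  sum_tuples l (fun s => \prod_(x <- s) f x) = (\sum_(x <- W) f x) ^+ l.
Proof.
elim: l => [|l ih]; first by rewrite expr0 /sum_tuples big_nil.
rewrite sum_tuplesS exprS mulr_suml; apply: eq_bigr => x _.
rewrite -ih -sum_tuplesZ; apply: sum_tuples_eq => s _ _.
by rewrite big_cons.
Qed.

Lemma seq_argmax (T : eqType) (f : T -> nat) (s : seq T) (z : T) : z \in s ->
  exists2 w, w \in s & forall x, x \in s -> (f x <= f w)%N.
Proof.
elim: s z => // y s ih z _; case: s ih => [|y' s] ih.
  by exists y => [|x]; rewrite ?inE// => /eqP ->.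
have [w ws wm] := ih y' (mem_head _ _).
case: (leqP (f y) (f w)) => fyw.
  by exists w => [|x]; rewrite inE ?ws ?orbT// => /orP[/eqP ->//|/wm].
exists y => [|x]; rewrite inE ?eqxx// => /orP[/eqP ->//|/wm h].
exact: leq_trans (ltnW fyw).
Qed.

(* With n.+1 points at distance at most D from x0, one of the n.+1 shells
   between i * D / n.+1 and i.+1 * D / n.+1 is empty. *)
Lemma distance_gap (s : seq nat) (D : nat) : (0 < D)%N -> D \in s ->
  exists2 i, (i < size s)%N & forall v, v \in s ->
    (size s * v <= i * D)%N \/ (i.+1 * D <= size s * v)%N.
Proof.
move=> D0 Ds.
pose L := [seq (size s * v) %/ D | v <- s]%N.
have nL : size s \in L by apply/mapP; exists D => //; rewrite mulnK.
have [i iL] : exists i : 'I_(size s).+1, nat_of_ord i \notin L.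
  have [/existsP//|/existsPn h] := boolP [exists i : 'I_(size s).+1, nat_of_ord i \notin L].
  exfalso.
  have sub : {subset iota 0 (size s).+1 <= L}.
    by move=> j; rewrite mem_iota /= add0n => js; have := h (Ordinal js); rewrite negbK.
  have := uniq_leq_size (iota_uniq 0 (size s).+1) sub.
  by rewrite size_iota size_map ltnn.
exists i.
  have := ltn_ord i; rewrite ltnS leq_eqVlt => /orP[/eqP e|//].
  by move: iL; rewrite e nL.
move=> v vs; have : ((size s * v) %/ D)%N != i.
  by apply: contra iL => /eqP <-; apply/mapP; exists v.
rewrite neq_ltn ltn_divLR// => /orP[h|h]; [left; exact: ltnW|right].
by rewrite -leq_divRL.
Qed.

Section total_cumulant_bound.
Variables (dist : V -> V -> nat) (n : nat) (B C K : R) (rho : nat -> R).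
Hypothesis distxx : forall x, dist x x = 0%N.
Hypothesis dist_triangle : forall x y z, (dist x z <= dist x y + dist y z)%N.
Hypotheses (B1 : 1 <= B) (C0 : 0 <= C) (K0 : 0 <= K).
Hypotheses (rho0 : rho 0%N = 1) (rho_ge0 : forall i, 0 <= rho i)
  (rho_mono : forall i j, (i <= j)%N -> rho j <= rho i).
Hypothesis rho_sum : forall x0, x0 \in W -> \sum_(x <- W) rho (dist x0 x) <= K.
Hypothesis M_bounded : forall l, {subset l <= W} -> (size l <= n.+1)%N -> `|M l| <= B.
Hypothesis M_cluster : forall l (A : pred V) g, {subset l <= W} -> (size l <= n.+1)%N ->
  (forall x y, x \in l -> y \in l -> A x -> ~~ A y -> (g <= n.+1 * dist x y)%N) ->
  `|M l - M (seq.filter A l) * M (seq.filter (predC A) l)| <= C * rho g ^+ n.+1.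

(** With D the largest distance from x0, an empty shell separates the points near x0 from the others
    at mutual distance at least D / (n + 1). The resulting factor rho(D)^(n + 1) is at most the
    product of the n factors rho(dist x0 x), each of which is at least rho(D). *)
Lemma ursell_decay x0 s : x0 \in W -> {subset s <= W} -> size s = n ->
  `|ursell M x0 s| <= (ursell_bound B n + cluster_bound B n * C) * \prod_(x <- s) rho (dist x0 x).
Proof.
move=> x0W sW sn.
have sub l : {subset l <= x0 :: s} -> {subset l <= W}.
  by move=> ls x /ls; rewrite inE => /orP[/eqP ->//|/sW].
have B0 : 0 <= B by rewrite (le_trans ler01).
have u0 : 0 <= ursell_bound B n by rewrite (le_trans B0)// ursell_bound_ge.
have c0 : 0 <= cluster_bound B n * C.
  by rewrite mulr_ge0//; case/andP: (cluster_bound_mono B1 (leqnn n)).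
have P0 : 0 <= \prod_(x <- s) rho (dist x0 x) by rewrite prodr_ge0.
(* If all points are at distance 0 there is no gap, but the product of the rates is 1 and the plain
   bound suffices. *)
have [all0|] := boolP (all (fun x => dist x0 x == 0%N) s).
  rewrite [X in _ * X]big_seq [X in _ * X]big1; last first.
    by move=> x xs; rewrite (eqP (allP all0 x xs)).
  rewrite mulr1 -[leLHS]addr0 lerD// -[in leRHS]sn; apply: ursell_le => // l ls lsz.
  by apply: M_bounded; [exact: sub|rewrite -sn].
rewrite -has_predC => /hasP[z zs /= dz].
have [w ws wmax] := seq_argmax (dist x0) zs.
pose D := dist x0 w.
have D0 : (0 < D)%N by rewrite (leq_trans _ (wmax _ zs))// lt0n.
have Ds : D \in [seq dist x0 x | x <- s] by apply: map_f.
have [i] := distance_gap D0 Ds; rewrite size_map sn => iN gap.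
pose A : pred V := fun x => (n * dist x0 x <= i * D)%N.
have Ax0 : A x0 by rewrite /A distxx muln0.
have hA : has (predC A) s.
  have /mapP[y ys yD] := Ds.
  by apply/hasP; exists y => //; rewrite /A /= -yD -ltnNge ltn_mul2r D0.
have gapA x y : x \in x0 :: s -> y \in x0 :: s -> A x -> ~~ A y -> (D <= n.+1 * dist x y)%N.
  move=> xs ys Ax; rewrite /A => nAy.
  have ys' : y \in s.
    by move: ys nAy; rewrite inE => /orP[/eqP ->|//]; rewrite distxx muln0.
  have [h|h] := gap _ (map_f (dist x0) ys'); first by rewrite h in nAy.
  have t1 := dist_triangle x0 x y; move: Ax; rewrite /A.
  have : (n * dist x0 y <= n * dist x0 x + n * dist x y)%N by rewrite -mulnDr leq_mul2l t1 orbT.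
  move: h; rewrite !mulSn -/D.
  move: (n * dist x0 y)%N (n * dist x0 x)%N (n * dist x y)%N (i * D)%N (dist x y) (D).
  by clear; lia.
have e0 : 0 <= C * rho D ^+ n.+1 by rewrite mulr_ge0// exprn_ge0.
have h := @ursell_cluster R V M M1 B _ A x0 s B1 e0 Ax0 hA.
rewrite sn in h.
apply: le_trans (h _ _) _.
- by move=> l ls lsz; apply: M_bounded => //; exact: sub.
- move=> l ls lsz; apply: M_cluster => //; first exact: sub.
  by move=> x y xl yl; apply: gapA; exact: ls.
rewrite mulrDl -[leLHS]add0r lerD ?mulr_ge0// mulrA ler_wpM2l//.
have r1 : rho D <= 1 by rewrite -rho0 rho_mono.
rewrite (@le_trans _ _ (rho D ^+ n))//; first by rewrite exprS ler_piMl ?exprn_ge0.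
rewrite -sn; have : {in s, forall x, rho D <= rho (dist x0 x)}.
  by move=> x xs; rewrite rho_mono// wmax.
elim: (s) => [|x t ih] st; first by rewrite big_nil expr0.
rewrite big_cons exprS ler_pM ?exprn_ge0// ?st ?mem_head//.
by apply: ih => y yt; apply: st; rewrite inE yt orbT.
Qed.

Lemma total_cumulant_bound :
  `|total_cumulant n.+1| <= (size W)%:R * ((ursell_bound B n + cluster_bound B n * C) * K ^+ n).
Proof.
have B0 : 0 <= B by rewrite (le_trans ler01).
have u0 : 0 <= ursell_bound B n by rewrite (le_trans B0)// ursell_bound_ge.
have c0 : 0 <= cluster_bound B n * C.
  by rewrite mulr_ge0//; case/andP: (cluster_bound_mono B1 (leqnn n)).
rewrite /= (le_trans (ler_norm_sum _ _ _))//.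
pose c := ursell_bound B n + cluster_bound B n * C.
have c1 : 0 <= c by rewrite addr_ge0.
apply: (@le_trans _ _ (\sum_(x0 <- W) c * K ^+ n)); last first.
  by rewrite big_const_seq count_predT iter_addr addr0 mulr_natl.
rewrite big_seq [leRHS]big_seq; apply: ler_sum => x0 x0W.
rewrite (le_trans (sum_tuples_norm _ _))//.
apply: (@le_trans _ _ (sum_tuples n (fun s => c * \prod_(x <- s) rho (dist x0 x)))).
  by apply: sum_tuples_le => s sW sn; exact: ursell_decay.
rewrite sum_tuplesZ sum_tuples_prod ler_wpM2l//.
by rewrite lerXn2r ?nnegrE ?sumr_ge0// rho_sum.
Qed.
End total_cumulant_bound.

End sum_tuples.

(** * Word metric and local functionals *)

Lemma leastP (A : set nat) (k : nat) : A k -> A (least A) /\ forall j, A j -> (least A <= j)%N.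
Proof.
move=> Ak; rewrite /least; case: xgetP => [m _ []//|].
move=> no; exfalso.
have ex : exists m, `[< A m >] by exists k; apply/asboolP.
case: (ex_minnP ex) => m /asboolP Am mmin.
by apply: (no m); split => // j Aj; apply: mmin; apply/asboolP.
Qed.

Section word_metric.
Variables (V : groupType) (S : set V).
Hypothesis hS : cayley_generators S.
Local Open Scope group_scope.
Local Notation edge := (cayley_edge S).
Local Notation wd := (word_dist S).

Definition reach (k : nat) (x y : V) : Prop :=
  exists p : seq V, [/\ path edge x p, last x p = y & size p = k].

Lemma edge_mul (g x y : V) : edge (g * x) (g * y) = edge x y.
Proof. by rewrite /cayley_edge invgM -mulgA mulKg. Qed.

Lemma edge_sym (x y : V) : edge x y = edge y x.
Proof.
rewrite /cayley_edge; apply/idP/idP; rewrite !inE => /(gen_symmetric hS);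
by rewrite invgM invgK.
Qed.

Lemma reach_mul (g : V) k x y : reach k x y -> reach k (g * x) (g * y).
Proof.
move=> [p [xp <- <-]]; exists [seq g * z | z <- p]; rewrite size_map last_map; split => //.
elim: p x xp => //= z p ih x /andP[xz zp].
by rewrite edge_mul xz ih.
Qed.

Lemma reach_cat j k x y z : reach j x y -> reach k y z -> reach (j + k) x z.
Proof.
move=> [p [xp <- <-]] [q [yq <- <-]]; exists (p ++ q).
by rewrite cat_path last_cat size_cat xp yq.
Qed.

Lemma reach_sym k x y : reach k x y -> reach k y x.
Proof.
move=> [p [xp <- <-]]; elim: p x xp => [|z p ih] x /=; first by exists [::].
move=> /andP[xz zp]; rewrite -addn1; apply: reach_cat (ih _ zp) _.
by exists [:: x]; rewrite /= edge_sym xz.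
Qed.

Lemma reach_ex x y : exists k, reach k x y.
Proof.
suff h z : exists k, reach k 1 z.
  have [k kz] := h (x^-1 * y); exists k.
  by have := reach_mul x kz; rewrite mulg1 mulVKg.
have : smallest (@is_subgroup V) S z by rewrite (gen_generates hS).
(* The elements reachable from 1 form a subgroup containing [S]. *)
apply: (@smallest_sub _ _ S [set w | exists k, reach k 1 w]); first split.
- by exists 0%N, [::].
- move=> a b [j ja] [k kb]; exists (j + k)%N; apply: reach_cat ja _.
  by have := reach_mul a kb; rewrite mulg1.
- move=> a [k ka]; exists k; apply: reach_sym.
  by have := reach_mul a^-1 ka; rewrite mulg1 mulVg.
move=> s Ss; exists 1%N, [:: s]; split => //=.
by rewrite /cayley_edge invg1 mul1g andbT inE.
Qed.

Lemma reach_word_dist x y : reach (wd x y) x y.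
Proof. by have [k h] := reach_ex x y; case: (leastP (A := [set k | reach k x y]) h). Qed.

Lemma word_dist_le k x y : reach k x y -> (wd x y <= k)%N.
Proof. by move=> h; case: (leastP (A := [set k | reach k x y]) h) => _; apply. Qed.

Lemma word_dist_triangle x y z : (wd x z <= wd x y + wd y z)%N.
Proof. by apply: word_dist_le; apply: reach_cat; exact: reach_word_dist. Qed.

Lemma word_distxx x : wd x x = 0%N.
Proof. by apply/eqP; rewrite -leqn0; apply: word_dist_le; exists [::]. Qed.

Lemma word_dist_sym x y : wd x y = wd y x.
Proof.
by apply/eqP; rewrite eqn_leq !word_dist_le//; apply: reach_sym; exact: reach_word_dist.
Qed.

Lemma word_dist_mul g x y : wd (g * x) (g * y) = wd x y.
Proof.
apply/eqP; rewrite eqn_leq; apply/andP; split; apply: word_dist_le.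
  by apply: reach_mul; exact: reach_word_dist.
by have := reach_mul g^-1 (reach_word_dist (g * x) (g * y)); rewrite !mulKg.
Qed.

Lemma word_dist1 x y : wd x y = wd 1 (x^-1 * y).
Proof. by rewrite -(word_dist_mul x 1) mulg1 mulVKg. Qed.

Lemma wball_finite n : finite_set (wball S n).
Proof.
elim: n => [|n ih].
  apply: (@sub_finite_set _ _ [set 1]); last exact: finite_set1.
  move=> y; rewrite /wball /= leqn0 => /eqP d0.
  by have := reach_word_dist 1 y; rewrite d0 => -[p [_ <- /eqP]]; rewrite size_eq0 => /eqP ->.
apply: (@sub_finite_set _ _ (wball S n `|` [set x * h | x in wball S n & h in S])); last first.
  rewrite finite_setU; split => //; apply: finite_image2 => //; exact: gen_finite hS.
move=> y; rewrite /wball /= => dy.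
have [p [pp py sz]] := reach_word_dist 1 y.
rewrite -{}sz in dy; rewrite -{}py; case/lastP: p pp dy => [|p z] pp dy.
  by left; rewrite /= word_distxx.
move: pp dy; rewrite rcons_path last_rcons size_rcons ltnS => /andP[pp e] dy.
right; exists (last 1 p).
  have h : reach (size p) 1 (last 1 p) by exists p.
  exact: leq_trans (word_dist_le h) dy.
exists ((last 1 p)^-1 * z); last by rewrite mulVKg.
by move: e; rewrite /cayley_edge inE.
Qed.

End word_metric.

Section local_functions.
Variables (R : realType) (V : choiceType).
Implicit Types (B A : seq V) (F G : set V -> R) (mu : set V).

Definition depends_on B F : Prop :=
  forall mu mu' : set V, (forall b, b \in B -> (mu b <-> mu' b)) -> F mu = F mu'.

Definition contains_ind A mu : R := \prod_(a <- A) (`[< mu a >])%:R.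

Lemma depends_on_sub B B' F : {subset B <= B'} -> depends_on B F -> depends_on B' F.
Proof. by move=> BB dF mu mu' h; apply: dF => b /BB; exact: h. Qed.

Lemma depends_on2 B F G (h : R -> R -> R) : depends_on B F -> depends_on B G ->
  depends_on B (fun mu => h (F mu) (G mu)).
Proof. by move=> dF dG mu mu' e; rewrite (dF mu mu')// (dG mu mu'). Qed.

Lemma depends_on_contains A : depends_on A (contains_ind A).
Proof.
move=> mu mu' h; rewrite /contains_ind !big_seq; apply: eq_bigr => a aA.
by congr (_%:R); congr nat_of_bool; apply: asbool_equiv_eq; exact: h.
Qed.

Lemma contains_indE A mu : contains_ind A mu = (`[< [set` A] `<=` mu >])%:R.
Proof.
rewrite /contains_ind; elim: A => [|a A ih].
  by rewrite big_nil; case: asboolP => // -[]; move=> x.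
rewrite big_cons ih -natrM mulnb; congr (_%:R); congr nat_of_bool.
apply/idP/idP.
  move=> /andP[/asboolP ma /asboolP mA]; apply/asboolP => x.
  by rewrite /= inE => /orP[/eqP ->//|]; exact: mA.
move=> /asboolP h; apply/andP; split; apply/asboolP.
  by apply: h; rewrite /= mem_head.
by move=> x xA; apply: h; rewrite /= inE xA orbT.
Qed.

(** Forcing the spin at [b] to 1 or to 0 removes one site from the dependence, which drives
    inductions on [B]. *)
Lemma depends_on_split b B F : depends_on (b :: B) F ->
  [/\ depends_on B (fun mu => F (mu `|` [set b])), depends_on B (fun mu => F (mu `\` [set b])) &
    forall mu, F mu = (`[< mu b >])%:R * F (mu `|` [set b]) +
      (F (mu `\` [set b]) - (`[< mu b >])%:R * F (mu `\` [set b]))].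
Proof.
move=> dF; split.
- move=> mu mu' h; apply: dF => x; rewrite inE => /orP[/eqP ->|/h e].
    by split; right.
  by split=> -[/e|]; [left|right|left|right].
- move=> mu mu' h; apply: dF => x; rewrite inE => /orP[/eqP ->|/h e].
    by split=> -[_ []].
  by split=> -[/e].
move=> mu; case: asboolP => mb.
  rewrite !mul1r subrr addr0; apply: dF => x; rewrite inE => /orP[/eqP ->|_].
    by split=> // _; right.
  by split=> [|[//|->]//]; left.
rewrite !mul0r add0r subr0; apply: dF => x _.
by split=> [mx|[]//]; split=> // xb; apply: mb; rewrite -xb.
Qed.

Definition is_local F : Prop := exists B, depends_on B F.

Lemma is_local_contains A : is_local (contains_ind A).
Proof. by exists A; exact: depends_on_contains. Qed.

Lemma is_local2 F G (h : R -> R -> R) : is_local F -> is_local G ->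
  is_local (fun mu => h (F mu) (G mu)).
Proof.
move=> [B dF] [B' dG]; exists (B ++ B'); apply: depends_on2.
  by apply: depends_on_sub dF => x xB; rewrite mem_cat xB.
by apply: depends_on_sub dG => x xB; rewrite mem_cat xB orbT.
Qed.

(* A local function is a combination of [3 ^ size B] indicators. *)
Lemma local_functional_bound (L : (set V -> R) -> R) (e m : R) (B0 : seq V) :
  (forall a F, is_local F -> L (fun mu => a * F mu) = a * L F) ->
  (forall F G, is_local F -> is_local G -> L (fun mu => F mu + G mu) = L F + L G) ->
  0 <= e -> (forall A, {subset A <= B0} -> `|L (contains_ind A)| <= e) ->
  forall B A F, {subset B <= B0} -> {subset A <= B0} -> depends_on B F ->
  (forall mu, `|F mu| <= m) ->
  `|L (fun mu => contains_ind A mu * F mu)| <= 3 ^+ size B * (m * e).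
Proof.
move=> LZ LD e0 Le; elim=> [|b B ih] A F BB AB dF Fm.
  rewrite expr0 mul1r (_ : (fun mu => _) = fun mu => F set0 * contains_ind A mu); last first.
    by apply/funext => mu; rewrite mulrC (dF mu set0).
  rewrite LZ; last exact: is_local_contains.
  by rewrite normrM ler_pM// ?Fm// Le.
have [d1 d0 eF] := depends_on_split dF.
set F1 := (fun mu => F (mu `|` [set b])) in d1 eF.
set F0 := (fun mu => F (mu `\` [set b])) in d0 eF.
have BB' : {subset B <= B0} by move=> x xB; apply: BB; rewrite inE xB orbT.
have bA : {subset b :: A <= B0}.
  by move=> x; rewrite inE => /orP[/eqP ->|/AB//]; apply: BB; rewrite mem_head.
have l1 : is_local (fun mu => contains_ind (b :: A) mu * F1 mu).
  by apply: is_local2 => //; [exact: is_local_contains|exists B].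
have l2 : is_local (fun mu => contains_ind A mu * F0 mu).
  by apply: is_local2 => //; [exact: is_local_contains|exists B].
have l3 : is_local (fun mu => contains_ind (b :: A) mu * F0 mu).
  by apply: is_local2 => //; [exact: is_local_contains|exists B].
have l4 : is_local (fun mu => -1 * (contains_ind (b :: A) mu * F0 mu)).
  by apply: (@is_local2 (fun=> -1)) => //; exists [::].
(* Three terms, whence the base 3: with 1_b the indicator of b, 1_A F = 1_A 1_b F1 + 1_A F0 - 1_A
   1_b F0. *)
have -> : (fun mu => contains_ind A mu * F mu) = (fun mu => contains_ind (b :: A) mu * F1 mu +
    (contains_ind A mu * F0 mu + -1 * (contains_ind (b :: A) mu * F0 mu))).
  apply/funext => mu; rewrite eF /F1 /F0 /contains_ind big_cons; ring.
rewrite LD//; last exact: is_local2.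
rewrite LD// LZ// exprS -mulrA.
have h1 := ih (b :: A) F1 BB' bA d1 (fun mu => Fm _).
have h2 := ih A F0 BB' AB d0 (fun mu => Fm _).
have h3 := ih (b :: A) F0 BB' bA d0 (fun mu => Fm _).
rewrite (le_trans (ler_normD _ _))// -[3]/(1 + 2) mulrDl mul1r lerD//.
rewrite (le_trans (ler_normD _ _))// normrM normrN1 mul1r.
by rewrite mulr2n mulrDl mul1r lerD.
Qed.

Lemma local_functional_le (L : (set V -> R) -> R) (e m : R) (B : seq V) F :
  (forall a F, is_local F -> L (fun mu => a * F mu) = a * L F) ->
  (forall F G, is_local F -> is_local G -> L (fun mu => F mu + G mu) = L F + L G) ->
  0 <= e -> (forall A, {subset A <= B} -> `|L (contains_ind A)| <= e) ->
  depends_on B F -> (forall mu, `|F mu| <= m) -> `|L F| <= 3 ^+ size B * (m * e).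
Proof.
move=> LZ LD e0 Le dF Fm.
have := @local_functional_bound L e m B LZ LD e0 Le B [::] F (fun x h => h) (fun x => ltac:(by [])) dF Fm.
by under [X in L X]eq_fun do rewrite /contains_ind big_nil mul1r.
Qed.

End local_functions.

(** * Covariances of functions of finitely many spins *)

Section spin_covariance.
Context d (T : measurableType d) (R : realType) (P : probability T R).
Context (V : groupType) (S : set V) (hS : cayley_generators S).
Variable X : {RV P >-> configuration V}.

Lemma bounded_measurable_site (x : V) : bounded_measurable (fun u => (`[< (X u : set V) x >])%:R : R).
Proof.
split; last by exists 1 => u; case: asbool; rewrite ?normr1 ?normr0.
have mX : measurable [set u | (X u : set V) x].
  have := @measurable_funPTI _ _ _ _ X [set mu : set V | mu x].
  by apply; apply: sub_sigma_algebra; exists x.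
have -> : (fun u => (`[< (X u : set V) x >])%:R) = \1_[set u | (X u : set V) x] :> (T -> R).
  by apply/funext => u; rewrite indicE; congr (_%:R); congr nat_of_bool; apply/asboolP/idP; rewrite inE.
exact: measurable_indic.
Qed.

Lemma bounded_measurable_depends (B : seq V) (F : set V -> R) :
  depends_on B F -> bounded_measurable (fun u => F (X u)).
Proof.
elim: B F => [|b B ih] F dF.
  have -> : (fun u => F (X u)) = fun=> F set0 by apply/funext => u; exact: dF.
  exact: bounded_measurable_cst.
have [d1 d0 eF] := depends_on_split dF.
under eq_fun do rewrite eF.
apply: bounded_measurableD.
  by apply: bounded_measurableM; [exact: bounded_measurable_site|exact: ih d1].
apply: bounded_measurableB; first exact: ih d0.
by apply: bounded_measurableM; [exact: bounded_measurable_site|exact: ih d0].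
Qed.

Lemma bounded_measurable_local (F : set V -> R) :
  is_local F -> bounded_measurable (fun u => F (X u)).
Proof. by move=> [B dF]; exact: bounded_measurable_depends dF. Qed.

Definition cov (F G : set V -> R) : R :=
  Ex P (fun u => F (X u) * G (X u)) - Ex P (fun u => F (X u)) * Ex P (fun u => G (X u)).

Lemma covC F G : cov F G = cov G F.
Proof.
rewrite /cov [X in _ - X]mulrC; congr (_ - _); congr Ex.
by apply/funext => u; rewrite mulrC.
Qed.

Lemma covZl a F G : is_local F -> is_local G -> cov (fun mu => a * F mu) G = a * cov F G.
Proof.
move=> lF lG; rewrite /cov.
have -> : (fun u => a * F (X u) * G (X u)) = fun u => a * (F (X u) * G (X u)).
  by apply/funext => u; rewrite mulrA.
have b1 := bounded_measurable_local lF; have b2 := bounded_measurable_local lG.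
by rewrite (ExZ P a (bounded_measurableM b1 b2)) (ExZ P a b1); ring.
Qed.

Lemma covDl F1 F2 G : is_local F1 -> is_local F2 -> is_local G ->
  cov (fun mu => F1 mu + F2 mu) G = cov F1 G + cov F2 G.
Proof.
move=> l1 l2 lG; rewrite /cov.
have -> : (fun u => (F1 (X u) + F2 (X u)) * G (X u)) =
    fun u => F1 (X u) * G (X u) + F2 (X u) * G (X u).
  by apply/funext => u; rewrite mulrDl.
have b1 := bounded_measurable_local l1; have b2 := bounded_measurable_local l2.
have bG := bounded_measurable_local lG.
rewrite (ExD P (bounded_measurableM b1 bG) (bounded_measurableM b2 bG)) (ExD P b1 b2); ring.
Qed.

Lemma prob_containsE (A : seq V) :
  prob_contains X [set` A] = (Ex P (fun u => contains_ind R A (X u)))%:E.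
Proof.
have bm := bounded_measurable_local (is_local_contains R A).
have E : (fun u => contains_ind R A (X u)) = \1_[set u | [set` A] `<=` (X u : set V)] :> (T -> R).
  apply/funext => u; rewrite contains_indE indicE; congr (_%:R); congr nat_of_bool.
have mA : measurable [set u | [set` A] `<=` (X u : set V)].
  by have [mE _] := bm; rewrite E in mE; apply/(measurable_indicP R).
rewrite E /prob_contains /Ex /Rintegral integral_indic// setIT fineK//.
exact: fin_num_measure.
Qed.

Lemma word_set_dist_ge (A B : seq V) (g : nat) : A != [::] -> B != [::] ->
  (forall x y, x \in A -> y \in B -> (g <= word_dist S x y)%N) ->
  (g <= set_dist S [set` A] [set` B])%N.
Proof.
case: A => // a A _; case: B => // b B _ h.
have : [set word_dist S x y | x in [set` a :: A] & y in [set` b :: B]] (word_dist S a b).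
  by exists a; [rewrite /= mem_head|exists b => //; rewrite /= mem_head].
by rewrite /set_dist => /leastP[[x xA [y yB <-]] _]; exact: h.
Qed.

Section with_clustering.
Variables (phi : R -> R) (C c : nat -> R).
Hypotheses (phi_fast : fast_decreasing phi) (phiC : clustering_bound S X phi C c).

(** Clustering concerns two nonempty lists of distinct points. An empty list gives covariance 0,
    repetitions do not change an indicator, and 0 < g makes the two lists disjoint. *)
Lemma cov_contains_le (A1 A2 : seq V) (K g : nat) : (0 < g)%N ->
  (size (undup A1) + size (undup A2) <= K)%N ->
  (forall x y, x \in A1 -> y \in A2 -> (g <= word_dist S x y)%N) ->
  `|cov (contains_ind R A1) (contains_ind R A2)| <= C K * phi (c K * g%:R).
Proof.
move=> g0 AK Ag; have [Cpos cpos Cmono cmono bnd] := phiC.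
have [phi01 phi_mono _] := phi_fast.
have rhs0 : 0 <= C K * phi (c K * g%:R).
  rewrite mulr_ge0//; first exact/ltW/Cpos.
  by case/andP: (phi01 (c K * g%:R) (mulr_ge0 (ltW (cpos K)) (ler0n _ _))).
have triv (A : seq V) F : A = [::] -> cov (contains_ind R A) F = 0.
  move=> ->; rewrite /cov /contains_ind.
  under [X in X - _]eq_Rintegral do rewrite big_nil mul1r.
  under [X in _ - X * _]eq_Rintegral do rewrite big_nil.
  by rewrite -/(Ex P (fun=> 1)) Ex_cst mul1r subrr.
have [A10|A10] := eqVneq A1 [::]; first by rewrite triv// normr0.
have [A20|A20] := eqVneq A2 [::]; first by rewrite covC triv// normr0.
have undupE (A : seq V) : contains_ind R A = contains_ind R (undup A).
  apply/funext => mu; rewrite !contains_indE; congr (_%:R); congr nat_of_bool.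
  by congr asbool; congr (_ `<=` _); apply/seteqP; split => x /=; rewrite mem_undup.
have undup0 (A : seq V) : A != [::] -> (1 <= size (undup A))%N.
  case: A => // a A _; have : a \in undup (a :: A) by rewrite mem_undup mem_head.
  by case: (undup _).
have disj x : x \in A1 -> x \notin A2.
  move=> x1; apply/negP => x2; have := Ag x x x1 x2.
  by rewrite word_distxx// leqNgt g0.
have uq : uniq (in_tuple (undup A1) ++ in_tuple (undup A2)).
  rewrite cat_uniq !undup_uniq andbT /=; apply/hasPn => x; rewrite !mem_undup => x2.
  by apply/negP => x1; move: (disj x x1); rewrite x2.
have := bnd _ _ (in_tuple (undup A1)) (in_tuple (undup A2)) (undup0 _ A10) (undup0 _ A20) uq.
rewrite /= !prob_containsE -EFinM -EFinB abse_EFin lee_fin.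
have -> : Ex P (fun u => contains_ind R (undup A1 ++ undup A2) (X u)) -
    Ex P (fun u => contains_ind R (undup A1) (X u)) * Ex P (fun u => contains_ind R (undup A2) (X u)) =
    cov (contains_ind R A1) (contains_ind R A2).
  rewrite [in RHS]undupE [contains_ind R A2]undupE /cov; congr (_ - _); congr Ex.
  by apply/funext => u; rewrite /contains_ind big_cat.
move=> /le_trans; apply.
have sd : (g <= set_dist S [set` undup A1] [set` undup A2])%N.
  apply: word_set_dist_ge; rewrite -?size_eq0 -?lt0n ?undup0// => x y.
  by rewrite !mem_undup; exact: Ag.
have c1 : c K * g%:R <= c (size (undup A1) + size (undup A2))%N *
   (set_dist S [set` undup A1] [set` undup A2])%:R.
  have cK := cmono _ _ AK.
  by apply: ler_pM => //; [exact/ltW/cpos|rewrite ler_nat].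
have cK0 : 0 <= c K * g%:R by rewrite mulr_ge0// ltW.
have CK := Cmono _ _ AK.
apply: ler_pM => //; first exact/ltW/Cpos.
- by case/andP: (phi01 _ (le_trans cK0 c1)).
- exact: phi_mono.
Qed.

(** The covariance is linear in each argument: [local_functional_le] expands first [G] against an
    indicator, then [F] against [G]. *)
Lemma cov_local_le (B1 B2 : seq V) (F G : set V -> R) (m1 m2 : R) (K g : nat) :
  (0 < g)%N -> (size B1 + size B2 <= K)%N ->
  (forall x y, x \in B1 -> y \in B2 -> (g <= word_dist S x y)%N) ->
  depends_on B1 F -> depends_on B2 G ->
  (forall mu, `|F mu| <= m1) -> (forall mu, `|G mu| <= m2) ->
  `|cov F G| <= 3 ^+ K * (m1 * m2) * (C K * phi (c K * g%:R)).
Proof.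
move=> g0 BK Bg dF dG Fm Gm.
have lF : is_local F by exists B1.
have lG : is_local G by exists B2.
have m10 : 0 <= m1 by rewrite (le_trans _ (Fm set0)).
have m20 : 0 <= m2 by rewrite (le_trans _ (Gm set0)).
have [Cpos cpos Cmono cmono bnd] := phiC.
have [phi01 phi_mono _] := phi_fast.
have rhs0 : 0 <= C K * phi (c K * g%:R).
  rewrite mulr_ge0//; first exact/ltW/Cpos.
  by case/andP: (phi01 (c K * g%:R) (mulr_ge0 (ltW (cpos K)) (ler0n _ _))).
pose e2 := 3 ^+ size B2 * (m2 * (C K * phi (c K * g%:R))).
have e20 : 0 <= e2 by rewrite mulr_ge0 ?exprn_ge0// mulr_ge0.
have step A : {subset A <= B1} -> `|cov (contains_ind R A) G| <= e2.
  move=> AB1; rewrite covC.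
  apply: (@local_functional_le R V (fun H => cov H (contains_ind R A)) _ _ B2 G) => //.
  - by move=> a H lH; apply: covZl => //; exact: is_local_contains.
  - by move=> H1 H2 l1 l2; apply: covDl => //; exact: is_local_contains.
  move=> A' AB2; rewrite covC; apply: cov_contains_le => //.
    rewrite (leq_trans _ BK)// leq_add// uniq_leq_size ?undup_uniq// => x; rewrite mem_undup.
      exact: AB1.
    exact: AB2.
  by move=> x y /AB1 ? /AB2 ?; exact: Bg.
have := @local_functional_le R V (fun H => cov H G) e2 m1 B1 F
  (fun a H lH => covZl a lH lG) (fun H1 H2 l1 l2 => covDl l1 l2 lG) e20 step dF Fm.
move=> /le_trans; apply; rewrite /e2.
rewrite (_ : 3 ^+ size B1 * _ = 3 ^+ (size B1 + size B2) * (m1 * m2) * (C K * phi (c K * g%:R))); last first.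
  by rewrite exprD; ring.
apply: ler_wpM2r => //; apply: ler_wpM2r; first exact: mulr_ge0.
by apply: ler_weXn2l => //; rewrite ler1n.
Qed.

End with_clustering.
End spin_covariance.

(** * A central limit theorem under linear growth of cumulants *)

Section clt_of_growth.
Context d (T : measurableType d) (R : realType) (P : probability T R) (V : eqType).
Variables (W : nat -> seq V) (Z : nat -> V -> T -> R) (nu c : R).

Definition window_sum (n : nat) (u : T) : R := \sum_(x <- W n) Z n x u.
Definition mixed_moment (n : nat) (l : seq V) : R := Ex P (fun u => \prod_(x <- l) Z n x u).

Hypothesis Zb : forall n x, bounded_measurable (Z n x).

Lemma bounded_measurable_window_sum n : bounded_measurable (window_sum n).
Proof. exact: bounded_measurable_sum. Qed.

Lemma mixed_moment_nil n : mixed_moment n [::] = 1.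
Proof.
rewrite /mixed_moment -[RHS](Ex_cst P 1); congr Ex.
by apply/funext => u; rewrite big_nil.
Qed.

Lemma window_sum_moment n l :
  Ex P (fun u => window_sum n u ^+ l) = sum_tuples (W n) l (mixed_moment n).
Proof.
(* The weight [g] carries the factors already extracted from the power. *)
suff h (g : T -> R) : bounded_measurable g ->
    Ex P (fun u => g u * window_sum n u ^+ l) =
    sum_tuples (W n) l (fun s => Ex P (fun u => g u * \prod_(x <- s) Z n x u)).
  have := h _ (bounded_measurable_cst T (1 : R)).
  have -> : (fun u => 1 * window_sum n u ^+ l) = (fun u => window_sum n u ^+ l).
    by apply/funext => u; rewrite mul1r.
  move=> ->; apply: sum_tuples_eq => s _ _; congr Ex.
  by apply/funext => u; rewrite mul1r.
elim: l g => [|l ih] g bg.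
  by rewrite /sum_tuples; congr Ex; apply/funext => u; rewrite expr0 big_nil.
have bgZ x : bounded_measurable (fun u => g u * Z n x u) by exact: bounded_measurableM.
have bl : bounded_measurable (fun u => window_sum n u ^+ l).
  by apply: bounded_measurableX; exact: bounded_measurable_window_sum.
have -> : (fun u => g u * window_sum n u ^+ l.+1) =
    fun u => \sum_(x <- W n) (g u * Z n x u) * window_sum n u ^+ l.
  by apply/funext => u; rewrite exprS mulrA mulr_sumr mulr_suml.
rewrite (@Ex_sum _ _ _ P _ _ (fun x u => (g u * Z n x u) * window_sum n u ^+ l)); last first.
  by move=> x; exact: bounded_measurableM.
rewrite sum_tuplesS; apply: eq_bigr => x _; rewrite ih//.
apply: sum_tuples_eq => s _ _; congr Ex; apply/funext => u.
by rewrite big_cons mulrA.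
Qed.

Hypothesis centered : forall n, Ex P (window_sum n) = 0.
Hypotheses (nu0 : 0 < nu) (c0 : 0 < c).
Hypothesis var_ge : \forall n \near \oo,
  c * (size (W n))%:R `^ nu <= Ex P (fun u => window_sum n u ^+ 2).
Hypothesis W_unbounded : forall m : nat, \forall n \near \oo, (m <= size (W n))%N.
Hypothesis cumulant_growth : forall k, exists C, forall n, (1 <= n)%N ->
  `|total_cumulant (W n) (mixed_moment n) k.+1| <= (size (W n))%:R * C.

Let v n := Ex P (fun u => window_sum n u ^+ 2).

(* The cumulant of order j of the normalised sum is O(w ^ (1 - j * nu / 2)). *)
Lemma normalized_cumulant_small (s j : nat) : 4 <= s%:R * nu -> (1 <= s <= j)%N ->
  (Num.sqrt (v n))^-1 ^+ j * total_cumulant (W n) (mixed_moment n) j @[n --> \oo] --> (0 : R).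
Proof.
move=> snu /andP[s1 sj].
have j0 : (0 < j)%N by rewrite (leq_trans s1).
have [C hC] := cumulant_growth j.-1; rewrite prednK// in hC.
apply/cvgr0Pnorm_le => e e0.
have sc0 : 0 < Num.sqrt c by rewrite sqrtr_gt0.
pose q := `|C| / (Num.sqrt c ^+ j * e).
near=> n.
have n1 : (1 <= n)%N by near: n; exists 1%N.
have w1 : (1 <= size (W n))%N by near: n; exact: W_unbounded.
have vn : c * (size (W n))%:R `^ nu <= v n by near: n.
have wq : q <= (size (W n))%:R.
  have : ((Num.truncn q).+1 <= size (W n))%N by near: n; exact: W_unbounded.
  by rewrite -(ler_nat R); apply: le_trans; exact/ltW/truncnS_gt.
have {}hC := hC n n1.
move: w1 vn wq hC; set w := size (W n) => w1 vn wq hC.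
have w0 : 0 < w%:R :> R by rewrite ltr0n.
have w1' : 1 <= w%:R :> R by rewrite ler1n.
have pw : 0 < w%:R `^ nu by rewrite powR_gt0.
have v0 : 0 < v n by rewrite (lt_le_trans _ vn)// mulr_gt0.
have sv : Num.sqrt c * w%:R `^ (nu / 2) <= Num.sqrt (v n).
  apply: le_trans (ler_wsqrtr vn).
  by rewrite (sqrtrM _ (ltW c0)) -(powR12_sqrt (ltW pw)) -powRrM.
(* Since j nu >= 4, w^(j nu / 2) >= w^2: one factor w beats the linear growth of the cumulant, the
   other beats |C| / e. *)
have lo : Num.sqrt c ^+ j * w%:R ^+ 2 <= Num.sqrt (v n) ^+ j.
  have h1 : w%:R ^+ 2 <= (w%:R `^ (nu / 2)) ^+ j :> R.
    rewrite -powR_mulrn// -[leRHS]powR_mulrn ?powR_ge0// -powRrM ler_powR//.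
    have : s%:R * nu <= j%:R * nu by rewrite (ler_wpM2r (ltW nu0))// ler_nat.
    lra.
  apply: le_trans (_ : (Num.sqrt c * w%:R `^ (nu / 2)) ^+ j <= _).
    by rewrite exprMn ler_wpM2l// exprn_ge0// ltW.
  by rewrite lerXn2r ?nnegrE// ?sqrtr_ge0// mulr_ge0 ?sqrtr_ge0// powR_ge0.
have sv0 : 0 < Num.sqrt (v n) ^+ j by rewrite exprn_gt0// sqrtr_gt0.
rewrite normrM exprVn normfV (gtr0_norm sv0) mulrC ler_pdivrMr//.
apply: (le_trans hC); apply: le_trans (ler_wpM2l (ltW e0) lo).
rewrite (@le_trans _ _ (w%:R * `|C|))//; first by rewrite ler_wpM2l ?ler_norm.
have : `|C| <= (Num.sqrt c ^+ j * e) * w%:R.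
  by move: wq; rewrite /q ler_pdivrMr ?mulr_gt0 ?exprn_gt0// mulrC.
move=> h; apply: le_trans (ler_wpM2l (ltW w0) h) _.
by rewrite le_eqVlt; apply/orP; left; apply/eqP; ring.
Unshelve. all: by end_near.
Qed.

Lemma clt_of_cumulant_growth :
  cvg_in_distribution P (fun n u => window_sum n u / Num.sqrt (v n)) (normal_prob 0 1).
Proof.
have v_gt0 : \forall n \near \oo, 0 < v n.
  near=> n.
  have w1 : (1 <= size (W n))%N by near: n; exact: W_unbounded.
  have : c * (size (W n))%:R `^ nu <= v n by near: n.
  by apply: lt_le_trans; rewrite mulr_gt0// powR_gt0// ltr0n.
have [N0 _ vN0] := v_gt0.
pose s := maxn 1 (Num.truncn (4 / nu)).+1.
have s4 : 4 <= s%:R * nu.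
  rewrite -ler_pdivrMr// (le_trans (ltW (truncnS_gt _)))// ler_nat.
  exact: leq_maxr.
(* Positivity of the variance is known only from N0 on, while a second cumulant equal to 1 is
   required at every index; hence the shift. *)
pose Y n u := window_sum (n + N0) u / Num.sqrt (v (n + N0)).
pose k n j := (Num.sqrt (v (n + N0)))^-1 ^+ j *
  total_cumulant (W (n + N0)) (mixed_moment (n + N0)) j.
have kcum n : is_cumulant (fun l => Ex P (fun u => Y n u ^+ l)) (k n).
  have h := is_cumulant_scale (Num.sqrt (v (n + N0)))^-1
    (is_cumulant_total (W (n + N0)) (mixed_moment_nil (n + N0))).
  have -> : (fun l => Ex P (fun u => Y n u ^+ l)) =
    (fun l => (Num.sqrt (v (n + N0)))^-1 ^+ l * sum_tuples (W (n + N0)) l (mixed_moment (n + N0))).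
    apply/funext => l; rewrite -window_sum_moment -ExZ.
      by congr Ex; apply/funext => u; rewrite /Y exprMn mulrC.
    by apply: bounded_measurableX; exact: bounded_measurable_window_sum.
  exact: h.
have bY n : bounded_measurable (Y n).
  apply: bounded_measurableM; first exact: bounded_measurable_window_sum.
  exact: bounded_measurable_cst.
have vpos n : 0 < v (n + N0) by apply: vN0; rewrite /= leq_addl.
have k0 n : k n 0%N = 0 by rewrite /k mulr0.
have k1 n : k n 1%N = 0.
  have [m0 mS] := kcum n; have := mS 0%N.
  rewrite big_ord1 bin0 mul1r m0 mulr1 => <-.
  have -> : (fun u => Y n u ^+ 1) = fun u => (Num.sqrt (v (n + N0)))^-1 * window_sum (n + N0) u.
    by apply/funext => u; rewrite expr1 mulrC.
  by rewrite ExZ ?centered ?mulr0//; exact: bounded_measurable_window_sum.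
have k2 n : k n 2%N = 1.
  have [m0 mS] := kcum n; have := mS 1%N.
  rewrite big_ord_recl big_ord1 /= k1 mulr0 mul0r add0r binn mul1r m0 mulr1 => <-.
  have -> : (fun u => Y n u ^+ 2) = fun u => (v (n + N0))^-1 * window_sum (n + N0) u ^+ 2.
    by apply/funext => u; rewrite /Y exprMn exprVn sqr_sqrtr ?(ltW (vpos n))// mulrC.
  rewrite ExZ; last by apply: bounded_measurableX; exact: bounded_measurable_window_sum.
  by rewrite mulVf// gt_eqF// vpos.
have ks j : (s <= j)%N -> k n j @[n --> \oo] --> (0 : R).
  move=> sj; have h := @normalized_cumulant_small s j s4 ltac:(by rewrite leq_maxl sj).
  pose f n := (Num.sqrt (v n))^-1 ^+ j * total_cumulant (W n) (mixed_moment n) j.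
  have : [sequence f (n + N0)%N]_n @ \oo --> (0 : R) by rewrite cvg_shiftn.
  exact.
have clt := clt_of_cumulants bY kcum k0 k1 k2 ks.
move=> x cx; have := clt x cx.
pose f n := P [set u | window_sum n u / Num.sqrt (v n) <= x].
move=> h; have : [sequence f (n + N0)%N]_n @ \oo --> normal_prob (0:R) 1 `]-oo, x]%classic by exact: h.
by rewrite cvg_shiftn.
Unshelve. all: by end_near.
Qed.

End clt_of_growth.

(** * Clustering of truncated scores *)

Lemma product_perturbation_le (R : realType) (m m1 m2 e e1 e2 B err c r : R) :
  1 <= B -> 0 <= err -> `|m - e| <= err -> `|m1 - e1| <= err -> `|m2 - e2| <= err ->
  `|m1| <= B -> `|e2| <= B -> e - e1 * e2 = c -> `|c| <= r ->
  `|m - m1 * m2| <= (1 + 2 * B) * err + r.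
Proof.
move=> B1 err0 he h1 h2 m1B e2B ec cr.
have -> : m - m1 * m2 = (m - e) + c + (e1 - m1) * e2 + m1 * (e2 - m2) by rewrite -ec; ring.
apply: (le_trans (ler_normD _ _)); rewrite (normrM m1).
have -> : (1 + 2 * B) * err + r = err + r + err * B + B * err by ring.
apply: lerD; last by rewrite ler_pM// distrC.
apply: (le_trans (ler_normD _ _)); rewrite normrM.
apply: lerD; last by rewrite ler_pM// distrC.
by apply: (le_trans (ler_normD _ _)); apply: lerD.
Qed.

Section window_scores.
Context d (T : measurableType d) (R : realType) (P : probability T R).
Context (V : groupType) (S : set V) (hS : cayley_generators S).
Variables (X : {RV P >-> configuration V}) (xi : V -> set V -> R).
Local Notation wd := (word_dist S).

Definition ball_seq (n : nat) : seq V := fset_set (wball S n).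

Lemma mem_ball_seq n x : (x \in ball_seq n) = (wd 1%g x <= n)%N.
Proof.
rewrite /ball_seq; apply/idP/idP.
  by rewrite in_fset_set ?inE//; exact: wball_finite.
by move=> h; rewrite in_fset_set ?inE//; exact: wball_finite.
Qed.

Lemma uniq_ball_seq n : uniq (ball_seq n).
Proof. exact: fset_uniq. Qed.

Lemma size_ball_seq n : size (ball_seq n) = wcard S n.
Proof. by []. Qed.

Definition ball_at (x : V) (t : nat) : seq V := [seq (x * y)%g | y <- ball_seq t].

Lemma mem_ball_at x t y : (y \in ball_at x t) = (wd x y <= t)%N.
Proof.
rewrite (word_dist1 hS x y) -mem_ball_seq; apply/mapP/idP => [[z zt ->]|h].
  by rewrite mulKg.
by exists (x^-1 * y)%g => //; rewrite mulVKg.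
Qed.

Definition window_score (n : nat) (x : V) (mu : set V) : R := xi x (mu `&` wball S n).

Lemma depends_on_window_score n x : depends_on (ball_seq n) (window_score n x).
Proof.
move=> mu mu' h; rewrite /window_score; congr (xi x _).
apply/seteqP; split => y [my yn]; split => //; apply/h => //; rewrite mem_ball_seq//.
Qed.

Definition centered_score (n : nat) (x : V) (u : T) : R :=
  window_score n x (X u) - Ex P (fun u => window_score n x (X u)).

Lemma bounded_measurable_window_score n x :
  bounded_measurable (fun u => window_score n x (X u)).
Proof. exact: bounded_measurable_depends (depends_on_window_score (n := n) x). Qed.

Lemma bounded_measurable_centered n x : bounded_measurable (centered_score n x).
Proof.
apply: bounded_measurableB; first exact: bounded_measurable_window_score.
exact: bounded_measurable_cst.
Qed.

Local Notation M := (mixed_moment P centered_score).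

Section mixed_cluster.
Variables (n k t : nat) (B b dl lam : R) (l : seq V) (gd : V -> set V -> bool).
Let Z := centered_score n.
Let gdR x (mu : set V) : R := (gd x mu)%:R.
(** [gd x] stands for the event that the score at x is settled by the spins within distance t, and
    [Zt] is the centred score cut off outside it. Then [b] bounds [Zt], [dl] bounds the probability
    of the complement, and [lam] balances the two parts of the truncation error. *)
Let Zt x (mu : set V) : R :=
  (window_score n x mu - Ex P (fun u => window_score n x (X u))) * gdR x mu.

Hypotheses (lk : (size l <= k)%N) (B1 : 1 <= B) (b1 : 1 <= b) (lam0 : 0 < lam) (dl0 : 0 <= dl).
(** Twice k factors, because the square of a product over at most k points is the product over the
    list concatenated with itself. *)
Hypothesis EZ : forall l', {subset l' <= l} -> (size l' <= k + k)%N ->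
  Ex P (fun u => `|\prod_(x <- l') Z x u|) <= B.
Hypothesis gd_local : forall x, is_local (gdR x).
Hypothesis Zt_dep : forall x, x \in l -> depends_on (ball_at x t) (Zt x).
Hypothesis Zt_b : forall x mu, x \in l -> `|Zt x mu| <= b.
Hypothesis gd_prob : forall x, x \in l -> Ex P (fun u => 1 - gdR x (X u)) <= dl.

Let Zb x : bounded_measurable (Z x). Proof. exact: bounded_measurable_centered. Qed.
Let gb x : bounded_measurable (fun u => gdR x (X u)).
Proof. exact: bounded_measurable_local. Qed.
Let Ztb x : bounded_measurable (fun u => Zt x (X u)).
Proof. exact: (bounded_measurableM (Zb x) (gb x)). Qed.

Lemma one_minus_prod_le (l' : seq V) mu :
  0 <= 1 - \prod_(x <- l') gdR x mu <= \sum_(x <- l') (1 - gdR x mu).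
Proof.
elim: l' => [|x l' ih]; first by rewrite !big_nil subrr lexx.
rewrite !big_cons; case/andP: ih => ih0 ih1.
have [->|->] : gdR x mu = 1 \/ gdR x mu = 0.
  by rewrite /gdR; case: (gd x mu); [left|right].
  by rewrite !mul1r subrr add0r ih0.
by rewrite !mul0r subr0 ler01 /= lerDl (le_trans ih0).
Qed.

(* AM-GM: [a * b <= lam * a ^ 2 + b / lam] for 0 <= b <= 1. *)
Lemma truncation_error (l' : seq V) : {subset l' <= l} -> (size l' <= k)%N ->
  `|Ex P (fun u => \prod_(x <- l') Z x u) - Ex P (fun u => \prod_(x <- l') Zt x (X u))| <=
  lam * B + k%:R * dl / lam.
Proof.
move=> sl l'k.
have bZ : bounded_measurable (fun u => \prod_(x <- l') Z x u) by exact: bounded_measurable_prod.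
have bZt : bounded_measurable (fun u => \prod_(x <- l') Zt x (X u)).
  by apply: bounded_measurable_prod.
have bs : bounded_measurable (fun u => \sum_(x <- l') (1 - gdR x (X u))).
  apply: (@bounded_measurable_sum _ _ _ _ l' (fun x u => 1 - gdR x (X u))) => x.
  by apply: bounded_measurableB => //; exact: bounded_measurable_cst.
have bn2 : bounded_measurable (fun u => `|\prod_(x <- l' ++ l') Z x u|).
  by apply: bounded_measurable_norm; exact: bounded_measurable_prod.
have bl2 : bounded_measurable (fun u => lam * `|\prod_(x <- l' ++ l') Z x u|).
  by apply: bounded_measurableM => //; exact: bounded_measurable_cst.
have bsl : bounded_measurable (fun u => lam^-1 * \sum_(x <- l') (1 - gdR x (X u))).
  by apply: bounded_measurableM => //; exact: bounded_measurable_cst.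
rewrite -ExB//; apply: le_trans (Ex_norm P (bounded_measurableB bZ bZt)) _.
have h u : `|\prod_(x <- l') Z x u - \prod_(x <- l') Zt x (X u)| <=
    lam * `|\prod_(x <- l' ++ l') Z x u| + lam^-1 * \sum_(x <- l') (1 - gdR x (X u)).
  have -> : \prod_(x <- l') Zt x (X u) = \prod_(x <- l') Z x u * \prod_(x <- l') gdR x (X u).
    by rewrite -big_split.
  rewrite -[X in `|X - _|]mulr1 -mulrBr normrM.
  have /andP[g0 g1] := one_minus_prod_le l' (X u).
  have P1 : 0 <= \prod_(x <- l') gdR x (X u).
    by apply: prodr_ge0 => x _; rewrite /gdR.
  rewrite big_cat normrM (ger0_norm g0).
  apply: (@le_trans _ _ (lam * (`|\prod_(x <- l') Z x u| * `|\prod_(x <- l') Z x u|) +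
     lam^-1 * (1 - \prod_(x <- l') gdR x (X u)))); last first.
    by rewrite lerD2l ler_wpM2l// invr_ge0 ltW.
  move: g0 P1; move: (`|\prod_(x <- l') Z x u|) (normr_ge0 (\prod_(x <- l') Z x u)) => a a0.
  move: (\prod_(x <- l') gdR x (X u)) => y y1 y0.
  have li : lam * lam^-1 = 1 by rewrite mulfV// gt_eqF.
  have li0 : 0 < lam^-1 by rewrite invr_gt0.
  have s1 : 0 <= (lam * a - (1 - y) / 2) ^+ 2 by exact: sqr_ge0.
  have -> : a * (1 - y) = lam^-1 * (lam * (a * (1 - y))) by field; rewrite gt_eqF.
  have -> : lam * (a * a) = lam^-1 * (lam * lam * (a * a)).
    by field; rewrite gt_eqF.
  rewrite -mulrDr ler_wpM2l ?(ltW li0)//.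
  have s2 : 0 <= (1 - y) * y by rewrite mulr_ge0.
  rewrite -subr_ge0 (_ : _ - _ =
    (lam * a - (1 - y) / 2) ^+ 2 + (3 / 4) * (1 - y) + 4^-1 * ((1 - y) * y)); last by field.
  by rewrite !addr_ge0// mulr_ge0.
apply: (le_trans (Ex_le P (bounded_measurable_norm (bounded_measurableB bZ bZt))
  (bounded_measurableD bl2 bsl) h)).
rewrite (ExD P bl2 bsl) (ExZ P lam bn2) (ExZ P lam^-1 bs); apply: lerD.
  rewrite ler_wpM2l ?(ltW lam0)//; apply: EZ; last by rewrite size_cat leq_add.
  by move=> x; rewrite mem_cat orbb; exact: sl.
rewrite mulrC ler_wpM2r ?invr_ge0 ?(ltW lam0)//.
rewrite (@Ex_sum _ _ _ P _ l' (fun x u => 1 - gdR x (X u))); last first.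
  by move=> x; apply: bounded_measurableB => //; exact: bounded_measurable_cst.
apply: (@le_trans _ _ (\sum_(x <- l') dl)).
  by rewrite big_seq [leRHS]big_seq; apply: ler_sum => x xl; apply: gd_prob; exact: sl.
rewrite big_const_seq count_predT iter_addr addr0 -[leLHS]mulr_natl ler_wpM2r// ler_nat//.
Qed.

(** After truncation the two groups are functions of the spins in balls of radius t about their
    points: at most k |W_t| spins, the balls of different groups being at distance at least g - 2t.
    The truncation is then undone in the joint moment and in both factors. *)
Lemma mixed_cluster (phi : R -> R) (C c : nat -> R) (g : nat) (A : pred V) :
  fast_decreasing phi -> clustering_bound S X phi C c ->
  (t + t < g)%N -> (forall x y, x \in l -> y \in l -> A x -> ~~ A y -> (g <= wd x y)%N) ->
  `|M n l - M n (seq.filter A l) * M n (seq.filter (predC A) l)| <=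
  (1 + 2 * B) * (lam * B + k%:R * dl / lam) +
  3 ^+ (k * size (ball_seq t)) * b ^+ k *
   (C (k * size (ball_seq t))%N * phi (c (k * size (ball_seq t))%N * (g - (t + t))%:R)).
Proof.
move=> phif clus tg Ag.
set l1 := seq.filter A l; set l2 := seq.filter (predC A) l.
have s1 : {subset l1 <= l} by move=> x; rewrite mem_filter => /andP[].
have s2 : {subset l2 <= l} by move=> x; rewrite mem_filter => /andP[].
have sz12 : (size l1 + size l2 = size l)%N by rewrite !size_filter count_predC.
have k1 : (size l1 <= k)%N by rewrite (leq_trans _ lk)// -sz12 leq_addr.
have k2 : (size l2 <= k)%N by rewrite (leq_trans _ lk)// -sz12 leq_addl.
pose F mu := \prod_(x <- l1) Zt x mu; pose G mu := \prod_(x <- l2) Zt x mu.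
pose err := lam * B + k%:R * dl / lam.
have err0 : 0 <= err.
  by rewrite addr_ge0// ?mulr_ge0 ?invr_ge0 ?(ltW lam0)// (le_trans ler01).
have E0 := @truncation_error l (fun x h => h) lk.
have E1 := truncation_error s1 k1.
have E2 := truncation_error s2 k2.
have prodE (f : V -> R) : \prod_(x <- l) f x = \prod_(x <- l1) f x * \prod_(x <- l2) f x.
  by rewrite !big_filter [LHS](bigID A).
have E0' : Ex P (fun u => \prod_(x <- l) Zt x (X u)) = Ex P (fun u => F (X u) * G (X u)).
  by congr Ex; apply/funext => u; rewrite prodE.
rewrite E0' in E0.
have bM (l' : seq V) : {subset l' <= l} -> (size l' <= k)%N ->
    Ex P (fun u => `|\prod_(x <- l') Z x u|) <= B.
  by move=> sl' kl'; apply: EZ => //; rewrite (leq_trans kl')// leq_addr.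
have bZl (l' : seq V) : bounded_measurable (fun u => \prod_(x <- l') Z x u).
  exact: bounded_measurable_prod.
have bZtl (l' : seq V) : bounded_measurable (fun u => \prod_(x <- l') Zt x (X u)).
  by apply: bounded_measurable_prod.
have M1B : `|M n l1| <= B by rewrite (le_trans (Ex_norm P (bZl l1)))// bM.
have GB : `|Ex P (fun u => G (X u))| <= B.
  rewrite (le_trans (Ex_norm P (bZtl l2)))// (le_trans _ (bM l2 s2 k2))//.
  apply: (Ex_le P (bounded_measurable_norm (bZtl l2)) (bounded_measurable_norm (bZl l2))) => u.
  rewrite [X in `|X| <= _](_ : _ = \prod_(x <- l2) Z x u * \prod_(x <- l2) gdR x (X u)); last first.
    by rewrite -big_split.
  rewrite normrM ler_piMr//.
  have /andP[g0 _] := one_minus_prod_le l2 (X u).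
  rewrite ger0_norm; first by rewrite -subr_ge0.
  by apply: prodr_ge0 => x _; rewrite /gdR.
have depP (l' : seq V) : {subset l' <= l} ->
    depends_on (flatten [seq ball_at x t | x <- l']) (fun mu => \prod_(x <- l') Zt x mu).
  move=> sl' mu mu' h; rewrite big_seq [RHS]big_seq; apply: eq_bigr => x xl.
  apply: Zt_dep; first exact: sl'.
  by move=> y yx; apply: h; apply/flatten_mapP; exists x.
have bP (l' : seq V) mu : {subset l' <= l} -> `|\prod_(x <- l') Zt x mu| <= b ^+ size l'.
  elim: l' => [|x l' ih] sl'; first by rewrite big_nil normr1 expr0.
  rewrite big_cons normrM exprS ler_pM//.
    by apply: Zt_b; apply: sl'; rewrite mem_head.
  by apply: ih => y yl'; apply: sl'; rewrite inE yl' orbT.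
have szB (l' : seq V) : size (flatten [seq ball_at x t | x <- l']) = (size l' * size (ball_seq t))%N.
  elim: l' => //= x l' ih; by rewrite size_cat ih size_map mulSn.
have tg' : (0 < g - (t + t))%N by rewrite subn_gt0.
have szK : (size (flatten [seq ball_at x t | x <- l1]) +
    size (flatten [seq ball_at x t | x <- l2]) <= k * size (ball_seq t))%N.
  by rewrite !szB -mulnDl sz12 leq_mul2r lk orbT.
have covFG Bg := cov_local_le phif clus tg' szK Bg
  (depP _ s1) (depP _ s2) (fun mu => bP l1 mu s1) (fun mu => bP l2 mu s2).
have {}covFG : `|cov X F G| <= 3 ^+ (k * size (ball_seq t)) * b ^+ k *
   (C (k * size (ball_seq t))%N * phi (c (k * size (ball_seq t))%N * (g - (t + t))%:R)).
  apply: (le_trans (covFG _)).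
    move=> x y /flatten_mapP[x1 x1l]; rewrite mem_ball_at => dx.
    move=> /flatten_mapP[y1 y1l]; rewrite mem_ball_at => dy.
    move: x1l y1l; rewrite !mem_filter => /andP[Ax1 x1l] /andP[Ay1 y1l].
    have := Ag _ _ x1l y1l Ax1 Ay1.
    have := word_dist_triangle hS x1 x y1; have := word_dist_triangle hS x y y1.
    rewrite (word_dist_sym hS y y1); move: dx dy; clear; lia.
  have [Cpos cpos _ _ _] := clus; have [phi01 _ _] := phif.
  apply: ler_wpM2r.
    apply: mulr_ge0; first exact/ltW/Cpos.
    have /phi01/andP[//] : 0 <= c (k * size (ball_seq t))%N * (g - (t + t))%:R.
    by rewrite mulr_ge0// ltW.
  by rewrite ler_wpM2l// -exprD sz12 ler_weXn2l.
have ME : M n l = Ex P (fun u => \prod_(x <- l) Z x u) by [].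
rewrite -/err in E0 E1 E2 *.
have covE : Ex P (fun u => F (X u) * G (X u)) -
    Ex P (fun u => F (X u)) * Ex P (fun u => G (X u)) = cov X F G by [].
rewrite -ME in E0; rewrite -[Ex P (fun u => \prod_(x <- l1) _)]/(M n l1) in E1.
rewrite -[Ex P (fun u => \prod_(x <- l2) _)]/(M n l2) in E2.
exact: (product_perturbation_le B1 err0 E0 E1 E2 M1B GB covE covFG).
Qed.

End mixed_cluster.
End window_scores.

Section sum_bounds.
Variables (R : realType) (V : groupType) (S : set V) (hS : cayley_generators S).
Local Notation wd := (word_dist S).

Lemma window_sum_dist_le (h : nat -> R) (K : R) (W : seq V) (x0 : V) :
  (forall F : seq V, uniq F -> \sum_(y <- F) h (wd 1%g y) <= K) -> uniq W ->
  \sum_(x <- W) h (wd x0 x) <= K.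
Proof.
move=> hK uW; have := hK [seq (x0^-1 * x)%g | x <- W].
rewrite map_inj_uniq; last by move=> x y /mulgI.
move=> /(_ uW); rewrite big_map; apply: le_trans.
by apply: ler_sum => x _; rewrite -word_dist1.
Qed.

Lemma esum_finite_le (h : V -> R) : (forall x, 0 <= h x) ->
  (\esum_(x in [set: V]) (h x)%:E < +oo)%E ->
  exists K, forall F : seq V, uniq F -> \sum_(y <- F) h y <= K.
Proof.
move=> h0 hoo; exists (fine (\esum_(x in [set: V]) (h x)%:E)%E) => F uF.
have e0 : (0 <= \esum_(x in [set: V]) (h x)%:E)%E by apply: esum_ge0 => x _; rewrite lee_fin.
rewrite -lee_fin fineK; last by rewrite ge0_fin_numE.
apply: ereal_sup_ubound; exists [set` F].
  by split => //; exact: finite_seq.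
by rewrite -sumEFin; apply/esym/fsbig_seq.
Qed.

Lemma count_ball_le (F : seq V) (N : nat) : uniq F ->
  (count (fun y => (wd 1%g y <= N)%N) F <= size (ball_seq S N))%N.
Proof.
move=> uF; rewrite -size_filter; apply: uniq_leq_size; first exact: filter_uniq.
by move=> x; rewrite mem_filter mem_ball_seq// => /andP[].
Qed.

Lemma sum_ball_ind_le (F : seq V) (N : nat) : uniq F ->
  \sum_(y <- F) (wd 1%g y <= N)%N%:R <= (size (ball_seq S N))%:R :> R.
Proof.
move=> uF; rewrite -natr_sum ler_nat.
rewrite (leq_trans _ (count_ball_le N uF))// -sum1_count [leqRHS]big_mkcond.
by apply: leq_sum => y _; case: (wd 1%g y <= N)%N.
Qed.

End sum_bounds.

Section prod_bounds.
Variable R : realType.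

Lemma normr_prod_le (I : eqType) (l : seq I) (a : I -> R) (m : R) :
  (forall x, x \in l -> `|a x| <= m) -> `|\prod_(x <- l) a x| <= m ^+ size l.
Proof.
elim: l => [|x l ih] am; first by rewrite big_nil normr1 expr0.
rewrite big_cons normrM exprS ler_pM ?am ?mem_head//.
by apply: ih => y yl; rewrite am// inE yl orbT.
Qed.

(** If m is the maximum of 1 and of the |a x|, the product is at most m^N, and m^N is one of the
    terms on the right. This does the work of the Hoelder inequality for mixed moments. *)
Lemma prod_le_sum_pow (I : eqType) (l : seq I) (a : I -> R) (N : nat) : (size l <= N)%N ->
  `|\prod_(x <- l) a x| <= 1 + \sum_(x <- l) `|a x| ^+ N.
Proof.
move=> lN.
have [m [m1 am mN]] : exists m, [/\ 1 <= m, forall x, x \in l -> `|a x| <= m &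
    m ^+ N <= 1 + \sum_(x <- l) `|a x| ^+ N].
  elim: l {lN} => [|x l [m [m1 am mN]]].
    by exists 1; split => //; rewrite expr1n big_nil addr0.
  have s0 : 0 <= \sum_(x <- l) `|a x| ^+ N by apply: sumr_ge0 => y _; rewrite exprn_ge0.
  have [xm|mx] := leP `|a x| m.
    exists m; split => // [y|]; first by rewrite inE => /orP[/eqP ->|/am].
    by rewrite (le_trans mN)// big_cons addrCA lerDr exprn_ge0.
  exists `|a x|; split => [|y|].
  - by rewrite (le_trans m1)// ltW.
  - by rewrite inE => /orP[/eqP ->//|/am /le_trans]; apply; exact: ltW.
  - by rewrite big_cons addrCA lerDl addr_ge0.
by rewrite (le_trans (normr_prod_le am))// (le_trans _ mN)// ler_weXn2l.
Qed.

Context d (T : measurableType d) (P : probability T R).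

Lemma Ex_prod_le (I : eqType) (Z : I -> T -> R) (l : seq I) (N : nat) (m : R) :
  (forall x, bounded_measurable (Z x)) -> (size l <= N)%N -> 0 <= m ->
  (forall x, x \in l -> Ex P (fun u => `|Z x u| ^+ N) <= m) ->
  Ex P (fun u => `|\prod_(x <- l) Z x u|) <= 1 + N%:R * m.
Proof.
move=> bZ lN m0 Zm.
have bN x : bounded_measurable (fun u => `|Z x u| ^+ N).
  by apply: bounded_measurableX; exact: bounded_measurable_norm.
have bS : bounded_measurable (fun u => \sum_(x <- l) `|Z x u| ^+ N).
  exact: (@bounded_measurable_sum _ _ _ _ l (fun x u => `|Z x u| ^+ N)).
apply: le_trans (Ex_le P (g := fun u => 1 + \sum_(x <- l) `|Z x u| ^+ N) _ _ _) _.
- by apply: bounded_measurable_norm; exact: bounded_measurable_prod.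
- by apply: bounded_measurableD => //; exact: bounded_measurable_cst.
- by move=> u; exact: prod_le_sum_pow.
rewrite ExD//; last exact: bounded_measurable_cst.
rewrite Ex_cst lerD2l (@Ex_sum _ _ _ P _ l (fun x u => `|Z x u| ^+ N))//.
apply: (@le_trans _ _ (\sum_(x <- l) m)).
  by rewrite big_seq [leRHS]big_seq; apply: ler_sum => x xl; exact: Zm.
by rewrite big_const_seq count_predT iter_addr addr0 -[leLHS]mulr_natl ler_wpM2r// ler_nat.
Qed.

End prod_bounds.

Section cumulant_growth.
Variables (R : realType) (V : groupType) (S : set V) (hS : cayley_generators S).
Local Notation wd := (word_dist S).

Lemma cumulant_growth_of_cluster (W : nat -> seq V) (M : nat -> seq V -> R) (k : nat)
    (rho : nat -> R) (B D K : R) :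
  (forall n, M n [::] = 1) -> (forall n, uniq (W n)) -> 1 <= B -> 0 <= D -> 0 <= K ->
  rho 0%N = 1 -> (forall i, 0 <= rho i) -> (forall i j, (i <= j)%N -> rho j <= rho i) ->
  (forall F : seq V, uniq F -> \sum_(y <- F) rho (wd 1%g y %/ k.+1)%N <= K) ->
  (forall n l, (1 <= n)%N -> {subset l <= W n} -> (size l <= k.+1)%N -> `|M n l| <= B) ->
  (forall n l (A : pred V) g, (1 <= n)%N -> {subset l <= W n} -> (size l <= k.+1)%N ->
    (forall x y, x \in l -> y \in l -> A x -> ~~ A y -> (g <= wd x y)%N) ->
    `|M n l - M n (seq.filter A l) * M n (seq.filter (predC A) l)| <= D * rho g ^+ k.+1) ->
  exists C, forall n, (1 <= n)%N -> `|total_cumulant (W n) (M n) k.+1| <= (size (W n))%:R * C.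
Proof.
move=> M1 uW B1 D0 K0 rho0 rho_ge0 rho_mono rho_sum MB Mc.
exists ((ursell_bound B k + cluster_bound B k * D) * K ^+ k) => n n1.
(* The gap argument only yields groups at distance g / (k + 1), so the rate is evaluated there;
   rounding down keeps it monotone. *)
apply: (@total_cumulant_bound R V (W n) (M n) (M1 n) wd k B D K (fun g => rho (g %/ k.+1)%N)) => //.
- exact: word_distxx.
- exact: word_dist_triangle.
- by move=> i j ij; apply: rho_mono; exact: leq_div2r.
- move=> x0 _.
  exact: (@window_sum_dist_le R V S hS (fun j => rho (j %/ k.+1)%N)).
- by move=> l ls lsz; apply: MB.
move=> l A g ls lsz Ag; apply: Mc => // x y xl yl Ax Ay.
have := Ag _ _ xl yl Ax Ay; move: (wd x y) => w h.
have : (g %/ k.+1 <= (k.+1 * w) %/ k.+1)%N by exact: leq_div2r.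
by rewrite mulKn.
Qed.

(** Let t be the largest integer with t^q <= g. Then 1 + g <= (1 + t)^q, so decay of order q E in t
    is decay of order E in g. If t < t1, then g is bounded and the bound B is absorbed in the
    constant. *)
Lemma power_rate (E q t1 : nat) (B D0 : R) : (0 < q)%N -> 0 <= B -> 0 <= D0 ->
  exists2 D, 0 <= D & forall (g : nat) (v : R), v <= B ->
  (forall t, (t1 <= t)%N -> (t ^ q <= g)%N -> v <= D0 * (1 + t)%:R^-1 ^+ (q * E)) ->
  v <= D * (1 + g)%:R^-1 ^+ E.
Proof.
move=> q0 B0 D00; exists (B * (1 + t1)%:R ^+ (q * E) + D0); first by rewrite addr_ge0// mulr_ge0.
move=> g v vB vt.
have ex0 : exists t, (t ^ q <= g)%N by exists 0%N; rewrite exp0n.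
have bd t : (t ^ q <= g)%N -> (t <= g)%N.
  by move=> h; apply: leq_trans h; case: t => // t; rewrite -{1}(expn1 t.+1) leq_pexp2l.
case: (ex_maxnP ex0 bd) => t tg tmax.
have gt : (1 + g <= (1 + t) ^ q)%N.
  by rewrite add1n ltnNge; apply/negP => /tmax; rewrite add1n ltnn.
have ie : ((1 + t)%:R^-1 : R) ^+ (q * E) <= (1 + g)%:R^-1 ^+ E.
  rewrite exprM lerXn2r ?nnegrE ?exprn_ge0 ?invr_ge0// exprVn lef_pV2 ?posrE ?exprn_gt0 ?ltr0n//.
  by rewrite -natrX ler_nat.
have e0 : 0 <= ((1 + g)%:R^-1 : R) ^+ E by rewrite exprn_ge0 ?invr_ge0.
rewrite mulrDl; have [tt1|t1t] := leqP t1 t.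
  rewrite (le_trans (vt _ tt1 tg))// -[leLHS]add0r lerD//; last by rewrite ler_wpM2l.
  by rewrite mulr_ge0// mulr_ge0.
rewrite -[v]addr0 lerD ?mulr_ge0// (le_trans vB)// -mulrA ler_peMr//.
apply: (@le_trans _ _ ((1 + t)%:R ^+ (q * E) * (1 + g)%:R^-1 ^+ E)); last first.
  by rewrite ler_wpM2r// lerXn2r ?nnegrE// ler_nat leq_add2l ltnW.
apply: le_trans (ler_wpM2l _ ie); last by rewrite exprn_ge0.
by rewrite -exprMn mulfV ?expr1n// pnatr_eq0.
Qed.

End cumulant_growth.

Section stretched.
Variable R : realType.

Lemma stretched_exp_decay_le (f : R -> R) (b : R) : stretched_exp_decay f b ->
  exists2 beta : R, 0 < beta & \forall t \near +oo, f t <= expR (- (beta * t `^ b)).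
Proof.
rewrite /stretched_exp_decay limf_esupE => /ereal_inf_lt[_ [B FB <-]] sup0.
have [beta beta0 hb] : exists2 beta : R, 0 < beta &
    forall t, B t -> (lne (f t)%:E * ((t `^ b)^-1)%:E <= (- beta)%:E)%E.
  have ub t : B t -> (lne (f t)%:E * ((t `^ b)^-1)%:E <= ereal_sup [set lne (f t)%:E * ((t `^ b)^-1)%:E | t in B])%E.
    by move=> Bt; apply: ereal_sup_ubound; exists t.
  move: sup0 ub; case: (ereal_sup _) => [s|//|] s0 ub.
    exists (- s); first by rewrite oppr_gt0 -lte_fin.
    by move=> t /ub; rewrite opprK.
  (* If the supremum is -oo, so is every value, and any rate serves. *)
  exists 1 => // t /ub; rewrite leeNy_eq => /eqP ->; exact: leNye.
exists beta => //; near=> t.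
have t0 : 0 < t by near: t; exact: nbhs_pinfty_gt.
have Bt : B t by near: t.
have tb : 0 < t `^ b by rewrite powR_gt0.
have [f0|f0] := leP (f t) 0; first by rewrite (le_trans f0)// expR_ge0.
have := hb t Bt; rewrite lne_EFin// -EFinM lee_fin ler_pdivrMr// => h.
by rewrite -[f t]lnK ?posrE// ler_expR -mulNr.
Unshelve. all: by end_near.
Qed.

End stretched.

(** * Growth and decay rates *)

Section superpolynomial.
Variable R : realType.

Lemma near_pinfty_nat (Q : R -> Prop) : (\forall t \near +oo, Q t) ->
  exists t1 : nat, forall t : nat, (t1 <= t)%N -> Q t%:R.
Proof.
move=> [M [_ hM]]; exists (Num.truncn `|M|).+1 => t ht; apply: hM.
rewrite (le_lt_trans (ler_norm M))// (lt_le_trans (truncnS_gt _))//.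
by rewrite ler_nat.
Qed.

Lemma nat_ge (x : R) : exists n : nat, x <= n%:R.
Proof. by exists (Num.truncn `|x|).+1; rewrite (le_trans (ler_norm x))// ltW// truncnS_gt. Qed.

Lemma expR_ge_pow (y : R) (j : nat) : 0 <= y -> (0 < j)%N -> (y / j%:R) ^+ j <= expR y.
Proof.
move=> y0 j0; have j0' : j%:R != 0 :> R by rewrite pnatr_eq0 -lt0n.
have -> : expR y = expR (y / j%:R) ^+ j.
  by rewrite -expRM_natl mulrC mulfVK.
rewrite lerXn2r ?nnegrE ?expR_ge0 ?divr_ge0//.
by rewrite (le_trans _ (expR_ge1Dx _))// lerDr.
Qed.

Lemma stretched_exp_decay_power (f : R -> R) (c : R) (m : nat) : 0 < c -> stretched_exp_decay f c ->
  exists2 D, 0 <= D & exists t1 : nat, forall t : nat, (t1 <= t)%N ->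
    f t%:R <= D * (1 + t)%:R^-1 ^+ m.
Proof.
move=> c0 /stretched_exp_decay_le[beta beta0 /near_pinfty_nat[t1 ft]].
(* With c j >= m, the bound exp(y) >= (y / j)^j at y = beta t^c provides the power t^m. *)
have [j0 hj0] := nat_ge (m%:R / c); pose j := j0.+1.
have cj : m%:R <= c * j%:R.
  rewrite mulrC -ler_pdivrMr// (le_trans hj0)// ler_nat; exact: leqnSn.
exists ((j%:R / beta) ^+ j * 2 ^+ m).
  by rewrite mulr_ge0// exprn_ge0// divr_ge0// ltW.
exists (maxn 1 t1) => t; rewrite geq_max => /andP[t0 tt1].
have t1' : 1 <= t%:R :> R by rewrite ler1n.
have tp : 0 < t%:R :> R by rewrite ltr0n.
have tc : 0 < t%:R `^ c :> R by rewrite powR_gt0.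
rewrite (le_trans (ft t tt1))// expRN.
have y0 : 0 < beta * t%:R `^ c by rewrite mulr_gt0.
have yj : 0 < (beta * t%:R `^ c / j%:R) ^+ j.
  by rewrite exprn_gt0// divr_gt0// ltr0n.
apply: (@le_trans _ _ ((beta * t%:R `^ c / j%:R) ^+ j)^-1).
  rewrite lef_pV2 ?posrE ?expR_gt0//.
  by apply: expR_ge_pow => //; exact: ltW.
have -> : ((beta * t%:R `^ c / j%:R) ^+ j)^-1 = (j%:R / beta) ^+ j * (t%:R `^ c ^+ j)^-1.
  by rewrite -!exprVn -exprMn; congr (_ ^+ _); rewrite !invfM invrK; ring.
rewrite -mulrA ler_wpM2l//; first by rewrite exprn_ge0// divr_ge0// ltW.
have u0 : 0 < (1 + t)%:R :> R by rewrite ltr0n.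
have -> : 2 ^+ m * (1 + t)%:R^-1 ^+ m = (((1 + t)%:R / 2) ^+ m)^-1 :> R.
  by rewrite -exprVn -exprMn invfM invrK mulrC.
rewrite lef_pV2 ?posrE ?exprn_gt0 ?divr_gt0//.
have -> : t%:R `^ c ^+ j = t%:R `^ (c * j%:R) by rewrite powRrM powR_mulrn// powR_ge0.
apply: (@le_trans _ _ (t%:R `^ m%:R)); last by rewrite ler_powR.
rewrite powR_mulrn ?ler0n// lerXn2r ?nnegrE ?divr_ge0//.
by rewrite ler_pdivrMr// natrD; lra.
Qed.

(** k^(a k) <= k^k <= exp(k^2), and monotonicity of [C] covers the indices before the asymptotic
    bound holds. The crude exponent is harmless because the decay of phi will be taken at a large
    power of t. *)
Lemma superexponential_le (C : nat -> R) (a : R) : nondecreasing_seq C ->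
  a < 1 -> (C : nat -> R^o) =O_\oo (fun k => k%:R `^ (a * k%:R) : R^o) ->
  exists2 D, 0 <= D & forall K : nat, C K <= D * expR (K%:R ^+ 2).
Proof.
move=> Cmono a1 /eqOP; rewrite /=.
move=> [M [_ /(_ (`|M| + 1))]]; rewrite ltr_pwDr ?ler_norm// => /(_ isT)[N _ hN].
pose D := `|M| + 1 + `|C N.+1|.
have D0 : 0 <= D by rewrite !addr_ge0.
exists D => // K.
have e1 : 1 <= expR (K%:R ^+ 2 : R) by rewrite -expR0 ler_expR exprn_ge0.
have [KN|NK] := leqP K N.+1.
  apply: (@le_trans _ _ (C N.+1)); first exact: Cmono.
  rewrite (le_trans (ler_norm _))// (@le_trans _ _ D)// ?ler_peMr// lerDr addr_ge0//.
have K1 : 1 <= K%:R :> R by rewrite ler1n (leq_trans _ NK).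
have := hN K (ltnW (ltnW NK)).
rewrite /= (ger0_norm (powR_ge0 _ _)) => h; rewrite (le_trans (ler_norm _))//.
rewrite (le_trans h)// ler_pM ?powR_ge0 ?addr_ge0//; first by rewrite lerDl.
rewrite (@le_trans _ _ (K%:R `^ K%:R))//.
  by rewrite ler_powR// ler_piMl// ltW.
rewrite powR_mulrn// expr2 expRM_natl lerXn2r ?nnegrE ?expR_ge0//.
by rewrite (le_trans _ (expR_ge1Dx _))// lerDr.
Qed.

End superpolynomial.

Section polynomial_growth.
Variables (R : realType) (V : groupType) (S : set V) (hS : cayley_generators S).
Local Notation wd := (word_dist S).
Local Notation w n := (size (ball_seq S n)).

Lemma ball_seq_mono (i j : nat) : (i <= j)%N -> (w i <= w j)%N.
Proof.
move=> ij; apply: uniq_leq_size; first exact: uniq_ball_seq.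
by move=> x; rewrite !mem_ball_seq// => /leq_trans; apply.
Qed.

(** The exponent is an integer that also dominates [kappa], so one power of 1 + t controls both the
    size of a ball and the exponent in the growth of the score. *)
Lemma polynomial_growth_le (kappa : R) : polynomial_growth S R -> exists e1 : nat,
  [/\ (1 <= e1)%N, kappa <= e1%:R &
   exists2 D : R, 0 <= D & forall n, (w n)%:R <= D * (1 + n)%:R ^+ e1].
Proof.
move=> [d2 d20 /eqOP].
move=> [M [_ /(_ (`|M| + 1))]]; rewrite ltr_pwDr ?ler_norm// => /(_ isT)[N _ hN].
have [e0 he0] := nat_ge (Num.max d2 kappa).
exists e0.+1; split => //.
  by rewrite (@le_trans _ _ e0%:R)// ?ler_nat// (le_trans _ he0)// le_max lexx orbT.
have d2e : d2 <= e0.+1%:R.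
  by rewrite (@le_trans _ _ e0%:R)// ?ler_nat// (le_trans _ he0)// le_max lexx.
have D0 : 0 <= `|M| + 1 + (w N.+1)%:R by rewrite !addr_ge0.
exists (`|M| + 1 + (w N.+1)%:R) => // n.
have u1 : 1 <= (1 + n)%:R :> R by rewrite ler1n.
have p1 : 1 <= (1 + n)%:R ^+ e0.+1 :> R by rewrite exprn_ege1.
have [nN|Nn] := leqP n N.+1.
  apply: (@le_trans _ _ (w N.+1)%:R); first by rewrite ler_nat ball_seq_mono.
  apply: le_trans (_ : `|M| + 1 + (w N.+1)%:R <= _); last by rewrite ler_peMr.
  by rewrite lerDr addr_ge0.
have n1 : 1 <= n%:R :> R by rewrite ler1n (leq_trans _ Nn).
have := hN n (ltnW (ltnW Nn)).
rewrite /= normr_nat (ger0_norm (powR_ge0 _ _)) -size_ball_seq => h.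
rewrite (le_trans h)// ler_pM ?powR_ge0 ?addr_ge0//; first by rewrite lerDl.
rewrite (@le_trans _ _ (n%:R `^ e0.+1%:R))//; first by rewrite ler_powR.
by rewrite powR_mulrn// lerXn2r ?nnegrE// ler_nat leq_addl.
Qed.

Lemma sum_inv_square_le (N : nat) : \sum_(i < N) ((1 + i)%:R^-1 : R) ^+ 2 <= 2.
Proof.
case: N => [|N]; first by rewrite big_ord0.
suff : \sum_(i < N.+1) ((1 + i)%:R^-1 : R) ^+ 2 <= 2 - N.+1%:R^-1.
  by move=> /le_trans; apply; rewrite lerBlDr lerDl invr_ge0.
elim: N => [|N ih]; first by rewrite big_ord1 /= addn0 expr2 !invr1; lra.
rewrite big_ord_recr /=; apply: le_trans (lerD ih (lexx _)) _.
have a0 : 0 < N.+1%:R :> R by rewrite ltr0n.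
have -> : (1 + N.+1)%:R = 1 + N.+1%:R :> R by rewrite natrD.
move: (N.+1%:R) a0 => a a0.
rewrite -subr_ge0 (_ : _ - _ = a^-1 * (1 + a)^-1 ^+ 2); last first.
  have a1 : 0 < 1 + a by rewrite addr_gt0.
  by field; rewrite !gt_eqF.
by rewrite mulr_ge0 ?exprn_ge0 ?invr_ge0 ?addr_ge0 ?(ltW a0).
Qed.

(** At most D (1 + i)^e1 points lie at distance i; the two extra powers leave the convergent sum of
    (1 + i)^-2. *)
Lemma sum_power_dist_le (D : R) (e1 : nat) (F : seq V) :
  (forall n, (w n)%:R <= D * (1 + n)%:R ^+ e1) -> uniq F ->
  \sum_(y <- F) ((1 + wd 1%g y)%:R^-1 : R) ^+ (e1 + 2) <= D * 2.
Proof.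
move=> hw uF.
have D0 : 0 <= D by have := hw 0%N; rewrite addn0 expr1n mulr1; exact: le_trans.
pose N := (\max_(y <- F) wd 1%g y).+1.
pose g i : R := (1 + i)%:R^-1 ^+ (e1 + 2).
have g0 i : 0 <= g i by rewrite exprn_ge0.
have -> : \sum_(y <- F) (1 + wd 1%g y)%:R^-1 ^+ (e1 + 2) =
    \sum_(i < N) g i * (count (fun y => wd 1%g y == i) F)%:R.
  under [RHS]eq_bigr do rewrite -sum1_count natr_sum mulr_sumr big_mkcond.
  rewrite exchange_big /= big_seq [RHS]big_seq; apply: eq_bigr => y yF.
  have yN : (wd 1%g y < N)%N by rewrite ltnS; exact: (@leq_bigmax_seq _ F predT (fun y => wd 1%g y)).
  rewrite (bigD1 (Ordinal yN))//= eqxx mulr1 big1 ?addr0// => i iy.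
  by rewrite ifF//; apply: contraNF iy => /eqP e; apply/eqP/val_inj.
apply: (@le_trans _ _ (\sum_(i < N) D * ((1 + i)%:R^-1 : R) ^+ 2)); last first.
  by rewrite -mulr_sumr ler_wpM2l// sum_inv_square_le.
apply: ler_sum => i _.
have u0 : (1 + i)%:R != 0 :> R by rewrite pnatr_eq0.
apply: (@le_trans _ _ (g i * (D * (1 + i)%:R ^+ e1))).
  rewrite ler_wpM2l// (le_trans _ (hw i))// ler_nat (leq_trans _ (@count_ball_le V S hS F i uF))//.
  by apply: sub_count => y /eqP ->.
rewrite /g exprD [_ ^-1 ^+ e1]exprVn; move: ((1 + i)%:R : R) u0 => u u0.
rewrite le_eqVlt; apply/orP; left; apply/eqP.
have : u ^+ e1 != 0 by rewrite expf_neq0.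
by move: (u ^+ e1) => v v0; field; rewrite v0 u0.
Qed.

(** With v = (1 + t)^(2 e1), the factor 3^K, the score bound, C_K / Dc and (1 + t)^(q E) are each at
    most the exponential of a constant times v; for C_K this holds because K = k w_t makes K^2 of
    order v. Since q b >= 2 e1 + 1, phi is at most exp(- G2 t v), and the extra factor t wins. *)
Lemma truncation_choice (k E e1 : nat) (Dw Dc c0 cx m1 kappa b : R) (C c : nat -> R)
    (phi : R -> R) :
  (forall n, (w n)%:R <= Dw * (1 + n)%:R ^+ e1) -> (1 <= e1)%N -> kappa <= e1%:R -> 0 <= kappa ->
  0 <= Dc -> (forall K, C K <= Dc * expR (K%:R ^+ 2)) -> 0 <= m1 ->
  0 < c0 -> (forall K, c0 <= c K) -> fast_decreasing phi -> 0 < b -> stretched_exp_decay phi b ->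
  exists q t1 : nat, [/\ (0 < q)%N, (0 < t1)%N & forall t g : nat, (t1 <= t)%N -> (t ^ q <= g)%N ->
    (t + t < g)%N /\
    3 ^+ (k * w t) * (expR (cx * t%:R `^ kappa) + m1) ^+ k *
      (C (k * w t)%N * phi (c (k * w t)%N * (g - (t + t))%:R)) <=
    Dc * (1 + t)%:R^-1 ^+ (q * E)].
Proof.
move=> hw e11 ke kappa0 Dc0 hC m10 c00 hc [phi01 phimono _] b0.
move=> /stretched_exp_decay_le[beta beta0 hphi].
have Dw0 : 0 <= Dw by have := hw 0%N; rewrite addn0 expr1n mulr1; exact: le_trans.
have [q0 hq0] := nat_ge ((e1 + e1).+1%:R / b); pose q := q0.+2.
have qb : (e1 + e1).+1%:R <= q%:R * b.
  by rewrite -ler_pdivrMr// (le_trans hq0)// ler_nat /q -addn2 leq_addr.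
have {hphi} [M [_ hM]] := hphi.
pose G1 := k%:R * Dw; pose G := 2 * G1 + k%:R * (`|cx| + m1) + G1 ^+ 2 + (q * E)%:R.
pose G2 := beta * (c0 / 2) `^ b / 2 ^+ (e1 + e1).
have G10 : 0 <= G1 by rewrite mulr_ge0.
have G20 : 0 < G2 by rewrite divr_gt0 ?mulr_gt0 ?powR_gt0 ?divr_gt0 ?exprn_gt0.
have [t2 ht2] := nat_ge (2 * (`|M| + 1) / c0).
have [t3 ht3] := nat_ge (G / G2).
(* 4 gives 4 t <= t^2 <= g, hence g - 2t >= g / 2; t2 brings the argument of phi into the range of
   its bound; t3 makes G2 t reach G. *)
exists q, (4 + t2 + t3)%N; split => // t g tt tqg.
have t4 : (4 <= t)%N by rewrite (leq_trans _ tt)// -addnA leq_addr.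
have tt2 : t2%:R <= t%:R :> R by rewrite ler_nat (leq_trans _ tt)// addnAC leq_addl.
have tt3 : t3%:R <= t%:R :> R by rewrite ler_nat (leq_trans _ tt)// leq_addl.
have ttq : (t * t <= t ^ q)%N.
  by rewrite -[X in (X <= _)%N]/(t ^ 2)%N leq_pexp2l// (leq_trans _ t4).
have tg : (4 * t <= g)%N.
  by rewrite (leq_trans _ tqg)// (leq_trans _ ttq)// leq_mul2r t4 orbT.
split; first by move: tg t4; clear; lia.
have t0 : 0 < t%:R :> R by rewrite ltr0n (leq_trans _ t4).
have t1 : 1 <= t%:R :> R by rewrite ler1n (leq_trans _ t4).
have gt : t%:R ^+ q / 2 <= (g - (t + t))%:R :> R.
  rewrite ler_pdivrMr// -natrX -natrM ler_nat (leq_trans tqg)//.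
  by move: tg; clear; lia.
pose K := (k * w t)%N; rewrite -/K.
pose u := (1 + t)%:R : R.
have ut : u = 1 + t%:R by rewrite /u natrD.
have u1 : 1 <= u by rewrite ut lerDl.
have u0 : 0 < u by rewrite (lt_le_trans ltr01).
pose v := u ^+ (e1 + e1).
have v0 : 0 <= v by rewrite exprn_ge0// ltW.
have ue : u ^+ e1 <= v by rewrite ler_weXn2l// leq_addr.
have uv : u <= v by rewrite -{1}(expr1 u) ler_weXn2l// (leq_trans e11)// leq_addr.
have Ku : K%:R <= G1 * u ^+ e1 by rewrite /K natrM -mulrA ler_wpM2l.
pose s := c0 * (t%:R ^+ q / 2).
have s0 : 0 <= s by rewrite mulr_ge0 ?(ltW c00)// divr_ge0// exprn_ge0.
have sM : M < s.
  rewrite (le_lt_trans (ler_norm M))// (@lt_le_trans _ _ (`|M| + 1)) ?ltrDl//.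
  have h1 : 2 * (`|M| + 1) <= c0 * t%:R.
    by rewrite [leRHS]mulrC -ler_pdivrMr// (le_trans ht2).
  have h2 : c0 * t%:R <= c0 * t%:R ^+ q by rewrite ler_pM2l// -[leLHS]expr1 ler_weXn2l.
  by rewrite /s mulrA ler_pdivlMr// mulrC (le_trans h1).
have phis : phi (c K * (g - (t + t))%:R) <= expR (- (beta * s `^ b)).
  apply: le_trans (hM _ sM); apply: phimono => //.
  by rewrite /s ler_pM ?divr_ge0 ?exprn_ge0// ltW.
have sb : G2 * t%:R * v <= beta * s `^ b.
  have -> : s `^ b = (c0 / 2) `^ b * t%:R `^ (q%:R * b).
    rewrite powRrM powR_mulrn// -powRM ?exprn_ge0 ?divr_ge0 ?(ltW c00)//.
    by congr (_ `^ _); rewrite /s; ring.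
  have h1 : t%:R * (v / 2 ^+ (e1 + e1)) <= t%:R `^ (q%:R * b).
    apply: le_trans (ler_powR t1 qb); rewrite powR_mulrn// exprS ler_pM2l//.
    rewrite /v -expr_div_n lerXn2r ?nnegrE ?divr_ge0 ?(ltW u0)//.
    by rewrite ler_pdivrMr// ut; lra.
  apply: (@le_trans _ _ (beta * (c0 / 2) `^ b * (t%:R * (v / 2 ^+ (e1 + e1))))).
    by rewrite le_eqVlt; apply/orP; left; apply/eqP; rewrite /G2; ring.
  by rewrite [leRHS]mulrA ler_wpM2l// mulr_ge0 ?powR_ge0// ltW.
have b3 : 3 ^+ K <= expR (2 * G1 * v) :> R.
  apply: (@le_trans _ _ (expR (2 * K%:R))).
    rewrite mulrC expRM_natl lerXn2r ?nnegrE ?expR_ge0//.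
    by rewrite (le_trans _ (expR_ge1Dx _))//; lra.
  by rewrite ler_expR -mulrA ler_wpM2l// (le_trans Ku)// ler_wpM2l.
have bb : (expR (cx * t%:R `^ kappa) + m1) ^+ k <= expR (k%:R * (`|cx| + m1) * v).
  rewrite -mulrA expRM_natl lerXn2r ?nnegrE ?expR_ge0 ?addr_ge0 ?expR_ge0//.
  have h1 : cx * t%:R `^ kappa <= `|cx| * v.
    rewrite (@le_trans _ _ (`|cx| * t%:R `^ kappa))//.
      by rewrite ler_wpM2r ?powR_ge0// ler_norm.
    rewrite ler_wpM2l// (le_trans _ ue)// -powR_mulrn ?(ltW u0)//.
    apply: (@le_trans _ _ (t%:R `^ e1%:R)); first by rewrite ler_powR.
    by rewrite ge0_ler_powR// ?nnegrE ?(ltW u0)// ut lerDr.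
  have v1 : 1 <= v by rewrite (le_trans u1).
  apply: (@le_trans _ _ (expR (`|cx| * v) * (1 + m1 * v))).
    rewrite mulrDr mulr1 lerD ?ler_expR// -[leLHS]mul1r ler_pM//.
      by rewrite -expR0 ler_expR mulr_ge0.
    by rewrite ler_peMr.
  by rewrite mulrDl expRD ler_wpM2l ?expR_ge0// expR_ge1Dx.
have bC : C K <= Dc * expR (G1 ^+ 2 * v).
  rewrite (le_trans (hC K))// ler_wpM2l// ler_expR.
  by rewrite /v exprD -expr2 -exprMn lerXn2r ?nnegrE// mulr_ge0// exprn_ge0// ltW.
have bu : u ^+ (q * E) <= expR ((q * E)%:R * v).
  rewrite expRM_natl lerXn2r ?nnegrE ?expR_ge0 ?(ltW u0)//.
  by rewrite (le_trans uv)// (le_trans _ (expR_ge1Dx _))// lerDr.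
have phi0 : 0 <= phi (c K * (g - (t + t))%:R).
  have /phi01/andP[//] : 0 <= c K * (g - (t + t))%:R.
  by rewrite mulr_ge0// (le_trans (ltW c00)).
rewrite exprVn ler_pdivlMr ?exprn_gt0//.
apply: (@le_trans _ _ (expR (2 * G1 * v) * expR (k%:R * (`|cx| + m1) * v) *
   (Dc * expR (G1 ^+ 2 * v) * expR (- (beta * s `^ b))) * expR ((q * E)%:R * v))).
  have p0 : 0 <= 3 ^+ K * (expR (cx * t%:R `^ kappa) + m1) ^+ k :> R.
    by rewrite mulr_ge0 ?exprn_ge0 ?addr_ge0 ?expR_ge0.
  have p1 : 3 ^+ K * (expR (cx * t%:R `^ kappa) + m1) ^+ k <=
      expR (2 * G1 * v) * expR (k%:R * (`|cx| + m1) * v).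
    by rewrite ler_pM ?exprn_ge0 ?addr_ge0 ?expR_ge0.
  have p2 : C K * phi (c K * (g - (t + t))%:R) <=
      Dc * expR (G1 ^+ 2 * v) * expR (- (beta * s `^ b)).
    apply: (@le_trans _ _ (Dc * expR (G1 ^+ 2 * v) * phi (c K * (g - (t + t))%:R))).
      by rewrite ler_wpM2r.
    by rewrite ler_wpM2l// mulr_ge0 ?expR_ge0.
  apply: (@le_trans _ _ (expR (2 * G1 * v) * expR (k%:R * (`|cx| + m1) * v) *
   (Dc * expR (G1 ^+ 2 * v) * expR (- (beta * s `^ b))) * u ^+ (q * E))).
    rewrite ler_wpM2r ?exprn_ge0 ?(ltW u0)//.
    apply: (@le_trans _ _ (3 ^+ K * (expR (cx * t%:R `^ kappa) + m1) ^+ k *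
      (Dc * expR (G1 ^+ 2 * v) * expR (- (beta * s `^ b))))); first by rewrite ler_wpM2l.
    by rewrite ler_wpM2r// !mulr_ge0 ?expR_ge0.
  by rewrite ler_wpM2l// !mulr_ge0 ?expR_ge0.
have -> : expR (2 * G1 * v) * expR (k%:R * (`|cx| + m1) * v) *
   (Dc * expR (G1 ^+ 2 * v) * expR (- (beta * s `^ b))) * expR ((q * E)%:R * v) =
   Dc * expR (G * v - beta * s `^ b).
  by rewrite /G !mulrDl !expRD; ring.
rewrite ler_piMr// -expR0 ler_expR subr_le0 (le_trans _ sb)// ler_wpM2r//.
by rewrite mulrC -ler_pdivrMr// (le_trans ht3).
Qed.
End polynomial_growth.

(** * Stabilisation *)

Section stability.
Context d (T : measurableType d) (R : realType) (P : probability T R).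
Context (V : groupType) (S : set V) (hS : cayley_generators S).
Variables (X : {RV P >-> configuration V}) (xi : V -> configuration V -> R).
Hypothesis hxi : score_function xi.
Local Notation wd := (word_dist S).

Lemma Ex_indicator (Q : set V -> Prop) : is_local (fun mu => (`[< Q mu >])%:R : R) ->
  (Ex P (fun u => (`[< Q (X u) >])%:R))%:E = P [set u | Q (X u)].
Proof.
move=> lQ; have bm : bounded_measurable (fun u => (`[< Q (X u) >])%:R : R).
  exact: (@bounded_measurable_local _ _ _ P _ X _ lQ).
have E : (fun u => (`[< Q (X u) >])%:R) = \1_[set u | Q (X u)] :> (T -> R).
  apply/funext => u; rewrite indicE; congr (_%:R); congr nat_of_bool.
have mA : measurable [set u | Q (X u)].
  by have [mE _] := bm; rewrite E in mE; apply/(measurable_indicP R).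
rewrite E /Ex /Rintegral integral_indic// setIT fineK//.
exact: fin_num_measure.
Qed.

Lemma in_translate (x : V) (mu : set V) z : translate x^-1%g mu z <-> mu (x * z)%g.
Proof.
split=> [[y my <-]|m]; first by rewrite mulVKg.
by exists (x * z)%g; rewrite ?mulKg.
Qed.

Lemma score_translate (x : V) (mu : set V) : xi x mu = xi 1%g (translate x^-1%g mu).
Proof. by rewrite -(score_invariant hxi x x^-1%g mu) mulVg. Qed.

Definition stable (t : nat) (x : V) (mu : set V) : Prop :=
  forall nu : set V, nu `&` wball S t = translate x^-1%g mu `&` wball S t ->
    xi 1%g (translate x^-1%g mu) = xi 1%g nu.

(** Whether the score at x is stable at radius t is itself decided by the spins in that ball; so
    discarding unstable configurations keeps the dependence local. *)
Lemma stable_eq t x (mu mu' : set V) :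
  (forall y, y \in ball_at S x t -> (mu y <-> mu' y)) -> stable t x mu ->
  stable t x mu' /\ xi x mu = xi x mu'.
Proof.
move=> h st.
have E : translate x^-1%g mu' `&` wball S t = translate x^-1%g mu `&` wball S t.
  apply/seteqP; split => z [/in_translate mz zt]; split => //; apply/in_translate;
    apply/(h (x * z)%g) => //; rewrite mem_ball_at//;
    by rewrite -{1}(mulg1 x) word_dist_mul.
have e := st _ E.
split; last by rewrite [LHS]score_translate e -score_translate.
by move=> nu nuE; rewrite -e; apply: st; rewrite nuE.
Qed.

Lemma stable_radius t x (mu : set V) : ~ stable t x mu -> ((t%:R)%:E <= stab_radius S xi x mu)%E.
Proof.
move=> nst; apply: le_ereal_inf_tmp => _ [r [r0 hr] <-]; rewrite lee_fin ler_nat leqNgt.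
apply/negP => rt; apply: nst => nu nuE; apply: hr.
have sub : wball S t `&` wball S r = wball S r.
  by apply/seteqP; split => z [] //= h; split => //; exact: leq_trans h (ltnW rt).
by rewrite -sub setIA nuE -setIA.
Qed.

(** A stable score equals the score of the configuration cut to the ball, to which exponential
    growth applies. *)
Lemma stable_score_le (cx kappa : R) t x (mu : set V) :
  (forall (t : R) (mu : set V), 0 < t ->
      `| xi 1%g (mu `&` [set y | (wd 1%g y)%:R <= t]) | <= expR (cx * t `^ kappa)) ->
  (0 < t)%N -> stable t x mu -> `|xi x mu| <= expR (cx * t%:R `^ kappa).
Proof.
move=> hg t0 st; rewrite score_translate.
rewrite (st (translate x^-1%g mu `&` wball S t)); last by rewrite -setIA setIid.
have -> : wball S t = [set y | (wd 1%g y)%:R <= t%:R :> R].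
  by apply/seteqP; split => y; rewrite /wball /= ler_nat.
by apply: hg; rewrite ltr0n.
Qed.

Definition window_stable (n t : nat) (x : V) (mu : set V) : bool :=
  `[< stable t x (mu `&` wball S n) >].

Lemma window_stable_local n t x : is_local (fun mu => (window_stable n t x mu)%:R : R).
Proof.
exists (ball_seq S n) => mu mu' h; rewrite /window_stable; congr (_%:R).
suff -> : mu `&` wball S n = mu' `&` wball S n by [].
by apply/seteqP; split => y [my yn]; split => //; apply/h => //; rewrite mem_ball_seq.
Qed.

Lemma depends_on_truncated n t x (e : R) :
  depends_on (ball_at S x t)
    (fun mu => (window_score S xi n x mu - e) * (window_stable n t x mu)%:R).
Proof.
move=> mu mu' h; rewrite /window_score /window_stable.
have h' y : y \in ball_at S x t -> ((mu `&` wball S n) y <-> (mu' `&` wball S n) y).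
  by move=> /h e'; split => -[/e'].
case: asboolP => [st|nst]; case: asboolP => [st'|nst'].
- by have [_ ->] := stable_eq h' st.
- by have [/nst'] := stable_eq h' st.
- have h'' y : y \in ball_at S x t -> ((mu' `&` wball S n) y <-> (mu `&` wball S n) y).
    by move=> /h' e'; split => /e'.
  by have [/nst] := stable_eq h'' st'.
by rewrite !mulr0.
Qed.

Lemma unstable_prob_le n t x :
  ((Ex P (fun u => 1 - (window_stable n t x (X u))%:R))%:E <=
   P [set u | ((t%:R)%:E <= stab_radius S xi x (X u `&` wball S n))%E])%E.
Proof.
pose Q (mu : set V) := ((t%:R)%:E <= stab_radius S xi x (mu `&` wball S n))%E.
have lQ : is_local (fun mu => (`[< Q mu >])%:R : R).
  exists (ball_seq S n) => mu mu' h; rewrite /Q; congr (_%:R).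
  suff -> : mu `&` wball S n = mu' `&` wball S n by [].
  by apply/seteqP; split => y [my yn]; split => //; apply/h => //; rewrite mem_ball_seq.
rewrite -(Ex_indicator lQ) lee_fin; apply: Ex_le.
- apply: bounded_measurableB; first exact: bounded_measurable_cst.
  exact: (@bounded_measurable_local _ _ _ P _ X _ (window_stable_local n t x)).
- exact: (@bounded_measurable_local _ _ _ P _ X _ lQ).
move=> u; rewrite /window_stable; case: asboolP => [_|nst].
  by rewrite subrr.
by case: asboolP => [_|]; rewrite ?subr0//; case; exact: stable_radius.
Qed.

Lemma window_sup_le (f : set V -> V -> \bar R) n x : (1 <= n)%N -> x \in ball_seq S n ->
  (f (wball S n) x <= window_sup S f)%E.
Proof.
move=> n1; rewrite mem_ball_seq// => xn.
apply: ereal_sup_ubound; exists (wball S n, x) => //; split => //.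
by left; exists n.
Qed.

Lemma depends_on_bounded (B : seq V) (F : set V -> R) : depends_on B F ->
  exists2 b, 0 <= b & forall mu, `|F mu| <= b.
Proof.
elim: B F => [|x B ih] F dF.
  by exists `|F set0| => // mu; rewrite (dF mu set0).
have [/ih[b1 b10 h1] /ih[b0 b00 h0] eF] := depends_on_split dF.
exists (b1 + b0) => [|mu]; first exact: addr_ge0.
rewrite eF; case: asboolP => _; rewrite ?mul1r ?mul0r ?subrr ?addr0 ?subr0 ?add0r.
  by rewrite (le_trans (h1 mu))// lerDl.
by rewrite (le_trans (h0 mu))// lerDr.
Qed.

End stability.

(** * Cumulant growth for local scores *)

Section local_case.
Context d (T : measurableType d) (R : realType) (P : probability T R).
Context (V : groupType) (S : set V) (hS : cayley_generators S).
Variables (X : {RV P >-> configuration V}) (xi : V -> configuration V -> R).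
Hypothesis hxi : score_function xi.
Variables (phi : R -> R) (C c : nat -> R).
Hypotheses (phif : fast_decreasing phi) (clus : clustering_bound S X phi C c).
Local Notation wd := (word_dist S).
Local Notation Z := (centered_score S X xi).
Local Notation M := (mixed_moment P Z).

Lemma mixed_moment_split_le (n k : nat) (l : seq V) (A : pred V) (B : R) :
  (forall l', {subset l' <= l} -> (size l' <= k)%N -> `|M n l'| <= B) -> (size l <= k)%N ->
  `|M n l - M n (seq.filter A l) * M n (seq.filter (predC A) l)| <= B + B * B.
Proof.
move=> MB lk.
have MF (A' : pred V) : `|M n (seq.filter A' l)| <= B.
  apply: MB; first by move=> x; rewrite mem_filter => /andP[].
  by rewrite size_filter (leq_trans (count_size _ _)).
by rewrite (le_trans (ler_normB _ _))// lerD ?MB// normrM ler_pM.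
Qed.

(** Every configuration is stable at the radius r of locality, so dl = 0 and the remaining
    truncation error tends to 0 with lam. The rate is a root of phi of order k + 1, because its
    power of that order must bound the clustering error. *)
Lemma local_cumulant_growth (k : nat) : summable_in S phi -> local_score S xi ->
  exists C', forall n, (1 <= n)%N ->
    `|total_cumulant (ball_seq S n) (M n) k.+1| <= (size (ball_seq S n))%:R * C'.
Proof.
move=> summ [r r0 loc]; set k' := k.+1.
have [Cpos cpos _ _ _] := clus; have [phi01 phimono _] := phif.
have dr : depends_on (ball_seq S r) (xi 1%g).
  move=> mu mu' h; apply: loc; apply/seteqP.
  by split => y [my yr]; split => //; apply/h => //; rewrite mem_ball_seq.
have [b0 b00 hb0] := depends_on_bounded dr.
have xib x mu : `|xi x mu| <= b0 by rewrite (score_translate hxi).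
pose b := 1 + 2 * b0.
have b1 : 1 <= b by rewrite lerDl mulr_ge0.
have Wb n x mu :
    `|window_score S xi n x mu - Ex P (fun u => window_score S xi n x (X u))| <= b.
  have bw := @bounded_measurable_window_score d T R P V S hS X xi n x.
  have e : `|Ex P (fun u => window_score S xi n x (X u))| <= b0.
    rewrite (le_trans (Ex_norm P bw))// -(Ex_cst P b0); apply: Ex_le => //.
    - exact: bounded_measurable_norm.
    - exact: bounded_measurable_cst.
    - by move=> v; exact: xib.
  rewrite (le_trans (ler_normB _ _))// (le_trans (lerD (xib _ _) e))//.
  by rewrite /b; lra.
have Zb n x u : `|Z n x u| <= b by exact: Wb.
have bb0 : 0 <= b by rewrite (le_trans ler01).
pose B := b ^+ (k' + k').
have B1 : 1 <= B by exact: exprn_ege1.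
have bZ n x : bounded_measurable (Z n x) by exact: bounded_measurable_centered.
have EZ n l : (size l <= k' + k')%N -> Ex P (fun u => `|\prod_(x <- l) Z n x u|) <= B.
  move=> lk; rewrite -(Ex_cst P B); apply: Ex_le.
  - by apply: bounded_measurable_norm; exact: bounded_measurable_prod.
  - exact: bounded_measurable_cst.
  - move=> u; rewrite (le_trans (normr_prod_le (m := b) _))//.
    by rewrite ler_weXn2l.
have MB n l : (size l <= k')%N -> `|M n l| <= B.
  move=> lk; rewrite /mixed_moment (le_trans (Ex_norm P _))//.
    exact: bounded_measurable_prod.
  by rewrite EZ// (leq_trans lk)// leq_addr.
have st x mu : stable S xi r x mu by move=> nu /esym/loc.
pose K := (k' * size (ball_seq S r))%N.
pose Dk := 3 ^+ K * b ^+ k' * C K.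
have B0' : 0 <= B by rewrite (le_trans ler01).
have Dk0 : 0 <= Dk.
  by rewrite mulr_ge0 ?(ltW (Cpos _))// mulr_ge0 ?exprn_ge0.
(* Equal to 1 up to 4r, where the trivial bound is used; beyond, g - 2r >= g / 2, whence the
   constant c K / 2. *)
pose rho (j : nat) := if (j <= 4 * r)%N then 1 else phi (c K / 2 * j%:R) `^ (k'%:R)^-1.
have cK j : 0 <= c K / 2 * j%:R by rewrite !mulr_ge0// ltW// cpos.
have ph j : 0 <= phi (c K / 2 * j%:R) <= 1 by exact: phi01.
have ki : 0 <= (k'%:R : R)^-1 by rewrite invr_ge0.
have ph1 j : phi (c K / 2 * j%:R) `^ (k'%:R)^-1 <= 1.
  have /andP[p0 p1] := ph j.
  by apply: le_trans (ge0_ler_powR ki _ _ p1) _; rewrite ?nnegrE ?powR1.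
(* The rate will be evaluated at the integer part of j / k', and j is at most 2 k' times that
   quotient once it is positive; hence the further factor k' + k'. *)
have [K0 hK0] : exists K0, forall F : seq V, uniq F ->
    \sum_(y <- F) phi (c K / (2 * (k' + k')%:R) * (wd 1%g y)%:R) `^ (k'%:R)^-1 <= K0.
  apply: esum_finite_le; first by move=> y; exact: powR_ge0.
  by apply: summ; rewrite ?ler1n// divr_gt0 ?cpos ?mulr_gt0.
have K00 : 0 <= K0 by have := hK0 [::] isT; rewrite big_nil.
apply: (@cumulant_growth_of_cluster R V S hS (ball_seq S) M k rho B (B + B * B + Dk)
    ((size (ball_seq S ((4 * r).+1 * k')))%:R + K0)) => //.
- by move=> n; exact: mixed_moment_nil.
- by move=> n; exact: uniq_ball_seq.
- exact: addr_ge0 (addr_ge0 B0' (mulr_ge0 B0' B0')) Dk0.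
- exact: addr_ge0.
- by move=> i; rewrite /rho; case: ifP => // _; exact: powR_ge0.
- move=> i j ij; rewrite /rho; case: ifPn => jr.
    by rewrite (leq_trans ij jr).
  case: ifPn => // ir.
  have /andP[pi0 _] := ph i; have /andP[pj0 _] := ph j.
  rewrite ge0_ler_powR ?nnegrE//; apply: phimono => //.
  by rewrite ler_wpM2l ?ler_nat// divr_ge0// ltW.
- move=> F uF.
  apply: le_trans (lerD (sum_ball_ind_le R hS ((4 * r).+1 * k') uF) (hK0 F uF)).
  rewrite -big_split /=; apply: ler_sum => y _; rewrite -/k' /rho.
  move: (wd 1%g y) => j.
  case: ifPn => [jr|]; last rewrite -ltnNge => rj.
    have -> : (j <= (4 * r).+1 * k')%N.
      rewrite {1}(divn_eq j k') -addn1 mulnDl leq_add ?leq_mul2r ?jr ?orbT// mul1n.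
      by rewrite ltnW// ltn_mod.
    by rewrite lerDl powR_ge0.
  rewrite -[leLHS]add0r lerD//.
  have /andP[p1 _] := ph (j %/ k')%N.
  have c1 : 0 <= c K / (2 * (k' + k')%:R) * j%:R.
    by rewrite mulr_ge0// divr_ge0 ?mulr_ge0// ltW.
  have /andP[p2 _] := phi01 _ c1.
  rewrite ge0_ler_powR ?nnegrE//; apply: phimono => //.
  have jk : (j <= (j %/ k') * (k' + k'))%N.
    rewrite {1}(divn_eq j k') mulnDr leq_add2l.
    by rewrite (leq_trans (ltnW (ltn_pmod _ _)))// leq_pmull// (leq_ltn_trans _ rj).
  have kk0 : 0 < (k' + k')%:R :> R by rewrite ltr0n.
  rewrite invfM !mulrA -[leLHS]mulrA ler_wpM2l ?divr_ge0 ?(ltW (cpos _))//.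
  by rewrite mulrC ler_pdivrMr// -natrM ler_nat.
- by move=> n l _ _; exact: MB.
move=> n l A g n1 ls lk Ag; rewrite /rho; case: ifPn => [gr|]; last rewrite -ltnNge => rg.
  rewrite expr1n mulr1 (le_trans (mixed_moment_split_le (k := k') A (fun l' _ => MB n l') lk))//.
  by rewrite lerDl.
have /andP[p0 _] := ph g.
rewrite -powR_mulrn ?powR_ge0// -powRrM mulVf ?pnatr_eq0// powRr1//.
have rg2 : (r + r < g)%N by move: rg; clear; lia.
apply: (@le_trans _ _ (Dk * phi (c K / 2 * g%:R))); last first.
  by rewrite ler_wpM2r// lerDr; exact: addr_ge0 B0' (mulr_ge0 B0' B0').
apply: (@le_trans _ _ (Dk * phi (c K * (g - (r + r))%:R))); last first.
  rewrite ler_wpM2l//; apply: phimono => //.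
  rewrite -mulrA ler_wpM2l ?(ltW (cpos _))// mulrC ler_pdivrMr// -natrM ler_nat.
  by move: rg; clear; lia.
apply/ler_addgt0Pr => e e0.
(* Makes the truncation error (1 + 2B) lam B equal to e. *)
pose lam := e / ((1 + 2 * B) * B).
have B0 : 0 < B by rewrite (lt_le_trans ltr01).
have BB : 0 < (1 + 2 * B) * B by rewrite mulr_gt0// addr_gt0// mulr_gt0.
have h := @mixed_cluster d T R P V S hS X xi n k' r B b 0 lam l (window_stable S xi n r)
  lk B1 b1 _ (lexx _) _ _ _ _ _ phi C c g A phif clus rg2 Ag.
apply: le_trans (h _ _ _ _ _ _) _.
- by rewrite divr_gt0.
- by move=> l' _; exact: EZ.
- by move=> x; exact: (window_stable_local hS).
- by move=> x _; exact: (depends_on_truncated hS hxi).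
- move=> x mu _; rewrite normrM.
  apply: (@le_trans _ _ (b * 1)); last by rewrite mulr1.
  rewrite ler_pM//.
  by case: window_stable; rewrite ?normr1 ?normr0.
- move=> x _; rewrite -[leRHS](Ex_cst P 0); apply: Ex_le.
  + apply: bounded_measurableB; first exact: bounded_measurable_cst.
    exact: (@bounded_measurable_local _ _ R P _ X _ (window_stable_local hS xi n r x)).
  + exact: bounded_measurable_cst.
  + by move=> u; rewrite /window_stable asboolT// subrr.
rewrite mulr0 mul0r addr0 addrC lerD//.
  by rewrite -/K /Dk mulrA.
by rewrite mulrCA mulfVK// gt_eqF.
Qed.

End local_case.

Lemma exprD_le (R : realType) (x y : R) (N : nat) : 0 <= x -> 0 <= y ->
  (x + y) ^+ N <= 2 ^+ N * (x ^+ N + y ^+ N).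
Proof.
move=> x0 y0.
have h (z : R) : x <= z -> y <= z -> (x + y) ^+ N <= 2 ^+ N * z ^+ N.
  move=> xz yz; rewrite -exprMn lerXn2r ?nnegrE ?addr_ge0//; last by lra.
  by rewrite mulr_ge0// (le_trans x0).
have [xy|yx] := leP x y.
  by rewrite (le_trans (h y xy (lexx _)))// ler_wpM2l ?exprn_ge0// lerDr exprn_ge0.
by rewrite (le_trans (h x (lexx _) (ltW yx)))// ler_wpM2l ?exprn_ge0// lerDl exprn_ge0.
Qed.

(** * Cumulant growth for quasi-local scores *)

Section quasi_local_case.
Context d (T : measurableType d) (R : realType) (P : probability T R).
Context (V : groupType) (S : set V) (hS : cayley_generators S).
Variables (X : {RV P >-> configuration V}) (xi : V -> configuration V -> R).
Hypothesis hxi : score_function xi.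
Local Notation wd := (word_dist S).
Local Notation Z := (centered_score S X xi).
Local Notation M := (mixed_moment P Z).

Lemma window_moment_le (N : nat) : (0 < N)%N -> moment_condition S xi X N%:R ->
  exists m, 1 <= m /\ forall n x, (1 <= n)%N -> x \in ball_seq S n ->
    Ex P (fun u => Num.max `|window_score S xi n x (X u)| 1 ^+ N) <= m.
Proof.
rewrite /moment_condition => N0 sup.
have [s hs] : exists s : R, (window_sup S (fun Wn x =>
     'E_P[fun u => (Num.max `| xi x (X u `&` Wn) | 1 `^ N%:R)%R]) <= s%:E)%E.
  move: sup; case: (window_sup _ _) => [s _|//|_]; first by exists s.
  by exists 0; exact: leNye.
exists (`|s| + 1); split; first by rewrite lerDr.
move=> n x n1 xn.
have bm : bounded_measurable (fun u => Num.max `|window_score S xi n x (X u)| 1 ^+ N).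
  apply: (@bounded_measurable_depends _ _ _ P _ X (ball_seq S n)
    (fun mu => Num.max `|window_score S xi n x mu| 1 ^+ N)) => mu mu' h.
  by rewrite (@depends_on_window_score _ _ _ hS xi n x _ _ h).
rewrite (@le_trans _ _ s)//; last by rewrite (le_trans (ler_norm s))// lerDl.
rewrite -lee_fin -(expectation_Ex P bm); apply: le_trans hs.
have -> : (fun u => Num.max `|window_score S xi n x (X u)| 1 ^+ N) =
    (fun u => (Num.max `| xi x (X u `&` wball S n) | 1 `^ N%:R)).
  by apply/funext => u; rewrite powR_mulrn// le_max ler01 orbT.
exact: (window_sup_le hS (fun Wn x =>
  'E_P[fun u => (Num.max `| xi x (X u `&` Wn) | 1 `^ N%:R)%R])%E n1 xn).
Qed.

Lemma quasi_local_cumulant_growth (phi : R -> R) (C c : nat -> R) (c0 a b : R) (k : nat) :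
  fast_decreasing phi -> clustering_bound S X phi C c ->
  0 < c0 -> (forall K, c0 <= c K) -> a < 1 ->
  (C : nat -> R^o) =O_\oo (fun k => k%:R `^ (a * k%:R) : R^o) ->
  0 < b -> stretched_exp_decay phi b ->
  polynomial_growth S R -> exponentially_quasi_local S xi X -> exponential_growth S xi ->
  (forall p : R, 1 <= p -> moment_condition S xi X p) ->
  exists C', forall n, (1 <= n)%N ->
    `|total_cumulant (ball_seq S n) (M n) k.+1| <= (size (ball_seq S n))%:R * C'.
Proof.
move=> phif clus c00 hc a1 CO b0 phis pg [A [f [A0 fmono f0 hf [cq cq0 fs]]]].
move=> [kappa [cx [kappa0 hg]]] mom; set k' := k.+1.
have [Cpos cpos Cmono _ _] := clus.
have [Dc Dc0 hC] := superexponential_le Cmono a1 CO.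
have [e1 [e11 ke [Dw Dw0 hw]]] := polynomial_growth_le hS kappa pg.
pose N := (k' + k')%N.
have [m [m1 hm]] := @window_moment_le N isT (mom N%:R ltac:(by rewrite ler1n)).
have m0 : 0 <= m by rewrite (le_trans ler01).
pose ws n x u := window_score S xi n x (X u).
have wb n x : bounded_measurable (ws n x).
  exact: (@bounded_measurable_window_score d T R P V S hS X xi n x).
have wmb n x : bounded_measurable (fun u => Num.max `|ws n x u| 1 ^+ N).
  apply: (@bounded_measurable_depends _ _ _ P _ X (ball_seq S n)
    (fun mu => Num.max `|window_score S xi n x mu| 1 ^+ N)) => mu mu' h.
  by rewrite (@depends_on_window_score _ _ _ hS xi n x _ _ h).
have em n x : (1 <= n)%N -> x \in ball_seq S n -> `|Ex P (ws n x)| <= m.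
  move=> n1 xn; rewrite (le_trans (Ex_norm P (wb n x)))// (le_trans _ (hm n x n1 xn))//.
  apply: Ex_le; [exact: bounded_measurable_norm|exact: wmb|].
  move=> u; apply: (@le_trans _ _ (Num.max `|ws n x u| 1)); first by rewrite le_max lexx.
  by rewrite -[leLHS]expr1 ler_weXn2l// le_max lexx orbT.
pose m' := 2 ^+ N * (m + m ^+ N).
have m'0 : 0 <= m' by rewrite mulr_ge0 ?addr_ge0 ?exprn_ge0.
have Zb n x : bounded_measurable (Z n x) by exact: bounded_measurable_centered.
have Zm n x : (1 <= n)%N -> x \in ball_seq S n -> Ex P (fun u => `|Z n x u| ^+ N) <= m'.
  move=> n1 xn.
  have b2 : bounded_measurable (fun u => Num.max `|ws n x u| 1 ^+ N + m ^+ N).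
    by apply: bounded_measurableD => //; exact: bounded_measurable_cst.
  apply: (@le_trans _ _ (Ex P (fun u => 2 ^+ N * (Num.max `|ws n x u| 1 ^+ N + m ^+ N)))).
    apply: Ex_le.
    - by apply: bounded_measurableX; exact: bounded_measurable_norm.
    - by apply: bounded_measurableM => //; exact: bounded_measurable_cst.
    - move=> u; apply: le_trans (exprD_le N _ m0); last by rewrite le_max ler01 orbT.
      rewrite lerXn2r ?nnegrE ?addr_ge0 ?le_max ?ler01 ?orbT//.
      by rewrite (le_trans (ler_normB _ _))// lerD ?le_max ?lexx//; exact: em.
  rewrite ExZ// ExD ?Ex_cst//; last exact: bounded_measurable_cst.
  by rewrite ler_wpM2l ?exprn_ge0// lerD2r; exact: hm.
pose B := 1 + N%:R * m'.
have B1 : 1 <= B by rewrite lerDl mulr_ge0.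
have B0 : 0 <= B by rewrite (le_trans ler01).
have BB : 0 <= B + B * B by rewrite addr_ge0 ?mulr_ge0.
have EZ n l : (1 <= n)%N -> {subset l <= ball_seq S n} -> (size l <= k' + k')%N ->
    Ex P (fun u => `|\prod_(x <- l) Z n x u|) <= B.
  by move=> n1 ls lk; apply: Ex_prod_le => // x xl; apply: Zm => //; exact: ls.
have MB n l : (1 <= n)%N -> {subset l <= ball_seq S n} -> (size l <= k')%N -> `|M n l| <= B.
  move=> n1 ls lk; rewrite /mixed_moment (le_trans (Ex_norm P _))//.
    exact: bounded_measurable_prod.
  by rewrite EZ// (leq_trans lk)// leq_addr.
(* With exponent p the rate is summable over V, and E = p k' since the clustering error must be
   bounded by the power k' of the rate. *)
pose p := (e1 + 2)%N; pose E := (p * k')%N.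
have [q [t1 [q0 t10 choice]]] := @truncation_choice R V S k' E e1 Dw Dc c0 cx m kappa b C c phi
  hw e11 ke kappa0 Dc0 hC m0
  c00 hc phif b0 phis.
(* Twice the exponent: the truncation error contains dl / lam with lam = u^(q E), and this quotient
   must again be of order u^(q E). *)
have [Df Df0 [t2 hfd]] := stretched_exp_decay_power (q * E + q * E) cq0 fs.
pose D0 := (1 + 2 * B) * (B + k'%:R * (A * Df)) + Dc.
have D00 : 0 <= D0.
  exact: addr_ge0 (mulr_ge0 (addr_ge0 ler01 (mulr_ge0 (ler0n R 2) B0))
    (addr_ge0 B0 (mulr_ge0 (ler0n R k') (mulr_ge0 (ltW A0) Df0)))) Dc0.
have [D DD0 hD] := power_rate E (t1 + t2) q0 BB D00.
pose rho (j : nat) : R := (1 + j)%:R^-1 ^+ p.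
have rho0 j : 0 <= rho j by rewrite exprn_ge0.
apply: (@cumulant_growth_of_cluster R V S hS (ball_seq S) M k rho B D
    (k'%:R ^+ p * (Dw * 2))) => //.
- by move=> n; exact: mixed_moment_nil.
- by move=> n; exact: uniq_ball_seq.
- by rewrite mulr_ge0 ?exprn_ge0 ?mulr_ge0.
- by rewrite /rho addn0 invr1 expr1n.
- move=> i j ij; rewrite /rho lerXn2r ?nnegrE ?invr_ge0// lef_pV2 ?posrE ?ltr0n//.
  by rewrite ler_nat leq_add2l.
- move=> F uF; apply: le_trans (ler_wpM2l _ (sum_power_dist_le hS hw uF)).
    rewrite mulr_sumr; apply: ler_sum => y _; move: (wd 1%g y) => j.
    rewrite /rho -exprMn lerXn2r ?nnegrE ?mulr_ge0 ?invr_ge0//.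
    rewrite ler_pdivlMr ?ltr0n// mulrC ler_pdivrMr ?ltr0n// -natrM ler_nat -/k'.
    by rewrite mulnC !add1n ltn_ceil.
  by rewrite exprn_ge0.
move=> n l A' g n1 ls lk Ag; rewrite /rho -exprM; apply: hD.
  apply: (mixed_moment_split_le (k := k')) => // l' ll' l'k; apply: MB => //.
  by move=> x /ll'/ls.
move=> t tt tg.
have tt1 : (t1 <= t)%N by rewrite (leq_trans _ tt)// leq_addr.
have tt2 : (t2 <= t)%N by rewrite (leq_trans _ tt)// leq_addl.
have t0 : (0 < t)%N by rewrite (leq_trans t10).
have [tg2 bnd] := choice t g tt1 tg.
set u : R := (1 + t)%:R^-1 in bnd *.
have u0 : 0 < u by rewrite invr_gt0 ltr0n.
pose lam := u ^+ (q * E); have lam0 : 0 < lam by rewrite exprn_gt0.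
pose dl := A * (Df * u ^+ (q * E + q * E)).
have dl0 : 0 <= dl by rewrite !mulr_ge0// ?exprn_ge0// ltW.
pose bt := expR (cx * t%:R `^ kappa) + m.
have bt1 : 1 <= bt by rewrite (le_trans m1)// lerDr expR_ge0.
apply: le_trans (@mixed_cluster d T R P V S hS X xi n k' t B bt dl lam l
  (window_stable S xi n t) lk B1 bt1 lam0 dl0 _ _ _ _ _ phi C c g A' phif clus tg2 Ag) _.
- by move=> l' ll' l'k; apply: EZ => // x /ll'/ls.
- by move=> x; exact: (window_stable_local hS).
- by move=> x _; exact: (depends_on_truncated hS hxi).
- move=> x mu xl; rewrite /window_stable; case: asboolP => st; last first.
    by rewrite mulr0 normr0 (le_trans ler01).
  rewrite mulr1 (le_trans (ler_normB _ _))// lerD//; last by apply: em => //; exact: ls.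
  exact: (stable_score_le hxi hg).
- move=> x xl; rewrite -lee_fin; apply: le_trans (unstable_prob_le hS X xi n t x) _.
  have t00 : 0 <= t%:R :> R by [].
  have := le_trans (window_sup_le hS (fun Wn x => P [set u | ((t%:R)%:E <= stab_radius S xi x (X u `&` Wn))%E])
    n1 (ls _ xl)) (hf _ t00).
  move=> /le_trans; apply; rewrite lee_fin ler_wpM2l ?(ltW A0)//.
  exact: hfd.
rewrite /D0 [leRHS]mulrDl lerD//.
rewrite -[leRHS]mulrA ler_wpM2l//; first by rewrite addr_ge0// mulr_ge0.
rewrite [leRHS]mulrDl lerD//; first by rewrite mulrC.
by rewrite /dl exprD le_eqVlt; apply/orP; left; apply/eqP; rewrite -/lam; field; rewrite gt_eqF.
Qed.

End quasi_local_case.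

(** * The total score as a sum over a fixed ball *)

Section total_scores.
Context d (T : measurableType d) (R : realType) (P : probability T R).
Context (V : groupType) (S : set V) (hS : cayley_generators S).
Variables (X : {RV P >-> configuration V}) (xi : V -> configuration V -> R).
Hypothesis hxi : score_function xi.

Lemma ball_seq_unbounded (m : nat) : ([set: V] #= [set: nat])%card ->
  \forall n \near \oo, (m <= size (ball_seq S n))%N.
Proof.
move=> /card_set_bijP[g [_ _ gsurj]].
have /choice[f gf] (i : nat) : exists x, g x = i.
  by have [x _ <-] := gsurj i Logic.I; exists x.
pose N := (\max_(x <- [seq f i | i <- iota 0 m]) word_dist S 1%g x)%N.
exists N => // n /= Nn.
rewrite -[leqLHS](size_iota 0) -(size_map f); apply: uniq_leq_size.
  by rewrite map_inj_uniq ?iota_uniq// => i j e; rewrite -(gf i) e gf.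
move=> x xs; rewrite mem_ball_seq// (leq_trans _ Nn)//.
exact: (@leq_bigmax_seq _ [seq f i | i <- iota 0 m] predT (fun x => word_dist S 1%g x)).
Qed.

(** Scores vanish off the configuration, so the random index set can be replaced by the whole
    ball. *)
Lemma total_scoreE n u :
  total_score S xi X n u = \sum_(x <- ball_seq S n) window_score S xi n x (X u).
Proof.
rewrite /total_score (@fsbig_widen _ _ _ _ (X u `&` wball S n) (wball S n)).
- by rewrite fsbig_finite//; exact: wball_finite.
- by move=> x [].
- by move=> x [xn nx]; apply: (score_out hxi).
Qed.

Lemma bounded_measurable_total_score n : bounded_measurable (total_score S xi X n).
Proof.
have -> : total_score S xi X n =
    fun u => \sum_(x <- ball_seq S n) window_score S xi n x (X u).
  by apply/funext => u; rewrite total_scoreE.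
apply: (@bounded_measurable_sum _ _ _ _ _ (fun x u => window_score S xi n x (X u))) => x.
exact: (@bounded_measurable_window_score d T R P V S hS X xi n x).
Qed.

Lemma window_sum_total_score n u :
  window_sum (ball_seq S) (centered_score S X xi) n u =
  total_score S xi X n u - Ex P (total_score S xi X n).
Proof.
rewrite /window_sum /centered_score sumrB -total_scoreE; congr (_ - _).
rewrite -(@Ex_sum _ _ _ P _ _ (fun x u => window_score S xi n x (X u))).
  by congr Ex; apply/funext => v; rewrite total_scoreE.
by move=> x; exact: (@bounded_measurable_window_score d T R P V S hS X xi n x).
Qed.

End total_scores.

Theorem theorem1p10 (R : realType)
    (V : groupType) (hV : ([set: V] #= [set: nat])%card)
    (S : set V) (hS : cayley_generators S)
    (d : measure_display) (T : measurableType d) (P : probability T R)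
    (X : {RV P >-> configuration V})
    (xi : V -> configuration V -> R) (hxi : score_function xi)
    (hcond :
      [/\ b_amenable S R,
          exists2 phi : R -> R, clustering S X phi & summable_in S phi
        & local_score S xi]
      \/
      [/\ polynomial_growth S R,
          exponentially_clustering S X,
          exponentially_quasi_local S xi X,
          exponential_growth S xi
        & forall p : R, 1 <= p -> moment_condition S xi X p])
    (nu : R) (hnu : 0 < nu)
    (hvar : exists2 c : R, 0 < c & \forall n \near \oo,
      ((c * (wcard S n)%:R `^ nu)%:E <= 'V_P[total_score S xi X n])%E) :
  cvg_in_distribution P
    (fun n u =>
      (total_score S xi X n u - fine 'E_P[total_score S xi X n])
      / Num.sqrt (fine 'V_P[total_score S xi X n]))
    (normal_prob 0 1).
Proof.
have [c c0 hc] := hvar.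
have bt := bounded_measurable_total_score hS X hxi.
have sumE n : window_sum (ball_seq S) (centered_score S X xi) n =
    fun u => total_score S xi X n u - Ex P (total_score S xi X n).
  by apply/funext => u; rewrite window_sum_total_score.
have varE n : 'V_P[total_score S xi X n]%E =
    (Ex P (fun u => window_sum (ball_seq S) (centered_score S X xi) n u ^+ 2))%:E.
  by rewrite variance_Ex// sumE.
have growth k : exists C, forall n, (1 <= n)%N ->
    `|total_cumulant (ball_seq S n) (mixed_moment P (centered_score S X xi) n) k.+1| <=
    (size (ball_seq S n))%:R * C.
  case: hcond => [[_ [phi [_ _ phif [C [c' clus]]] summ] loc]|].
    exact: (local_cumulant_growth hS hxi phif clus).
  move=> [pg [_ _ [phi [C [c' [phif clus [c1 c10 hc1] [a [a0 a1 Ca]] [b b0 phib]]]]]] ql eg mc].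
  exact: (quasi_local_cumulant_growth hS hxi k phif clus c10 hc1 a1 Ca b0 phib pg ql eg mc).
have clt := @clt_of_cumulant_growth d T R P V (ball_seq S) (centered_score S X xi) nu c
  _ _ hnu c0 _ _ growth.
have -> : (fun n u => (total_score S xi X n u - fine 'E_P[total_score S xi X n]%E)
      / Num.sqrt (fine 'V_P[total_score S xi X n]%E)) =
    (fun n u => window_sum (ball_seq S) (centered_score S X xi) n u /
      Num.sqrt (Ex P (fun u => window_sum (ball_seq S) (centered_score S X xi) n u ^+ 2))).
  by apply/funext => n; apply/funext => u; rewrite varE expectation_Ex// sumE.
apply: clt.
- by move=> n x; exact: bounded_measurable_centered.
- by move=> n; rewrite sumE ExB ?Ex_cst ?subrr//; exact: bounded_measurable_cst.
- by near=> n; rewrite -lee_fin -varE; near: n.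
- by move=> m; exact: ball_seq_unbounded.
Unshelve. all: by end_near.
Qed.
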